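(* Let $0<d<\pi/2$, $\mathscr{D}_d=\{\zeta\in\mathbb{C}:|\Im\zeta|<d\}$, $\mathscr{D}_d^{-}=\{\zeta\in\mathscr{D}_d:\Re\zeta<0\}$, $\mathscr{D}_d^{+}=\{\zeta\in\mathscr{D}_d:\Re\zeta\ge0\}$, and $\psi(t)=\sinh[(\pi/2)\sinh t]$. Assume $f$ is analytic on $\psi(\mathscr{D}_d)$ and there are constants $K,\alpha,\beta>0$ with $|f(z)|\le K|1+z^2|^{-(\alpha+1)/2}$ for $z\in\psi(\mathscr{D}_d^-)$ and $|f(z)|\le K|1+z^2|^{-(\beta+1)/2}$ for $z\in\psi(\mathscr{D}_d^+)$. Let $\mu=\min\{\alpha,\beta\}$, $\nu=\max\{\alpha,\beta\}$, let $n$ be a positive integer, $h=\log(4dn/\mu)/n$, and let $M=n$, $N=n-\lfloor\log(\beta/\alpha)/h\rfloor$ if $\mu=\alpha$, and $N=n$, $M=n-\lfloor\log(\alpha/\beta)/h\rfloor$ if $\mu=\beta$. Suppose $n\ge\nu e/(4d)$, $Mh\ge x_{\alpha/2}$, $Nh\ge x_{\beta/2}$. Then \[ \sup_{\tau\in\mathbb{R}}\left|\int_{-\infty}^{\tau}f(t)\,dt-\sum_{k=-M}^{N}f(\psi(kh))\psi'(kh)J(k,h)(\psi^{-1}(\tau))\right|\le C_1\,\frac{e^{-\pi dn/\log(4dn/\mu)}\log(4dn/\mu)}{n}, \] with $C_1=\frac{2^{\nu+1}K}{\mu d}\left\{\frac{1}{(1-e^{-\pi\mu e/2})\{\cos(\frac\pi2\sin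 d)\}^{\nu}\cos d}+e^{\pi(\alpha+\beta)/4}\right\}$.
   Context: $J(k,h)(x)=h\left\{\frac12+\frac1\pi\operatorname{Si}[\pi(x/h-k)]\right\}$ with $\operatorname{Si}(x)=\int_0^x\frac{\sin\sigma}{\sigma}d\sigma$. For $\gamma>0$, $x_\gamma=\operatorname{arcsinh}\!\left(\frac{\sqrt{1+\sqrt{1-(2\pi\gamma)^2}}}{2\pi\gamma}\right)$ if $0<\gamma<1/(2\pi)$, and $x_\gamma=\operatorname{arcsinh}(1)$ if $\gamma\ge1/(2\pi)$. *)

(* Defs.v *)
From Stdlib Require Import Reals ZArith List.
From Coquelicot Require Import Coquelicot.
Open Scope R_scope.

Definition Cexp (z : C) : C :=
  (exp (fst z) * cos (snd z), exp (fst z) * sin (snd z)).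
Definition Csinh (z : C) : C := ((Cexp z - Cexp (- z)) / 2)%C.

Definition psi (t : R) : R := sinh (PI / 2 * sinh t).
Definition psiC (z : C) : C := Csinh (RtoC (PI / 2) * Csinh z)%C.

Definition arsinh (x : R) : R := ln (x + sqrt (x ^ 2 + 1)).
Definition psi_inv (x : R) : R := arsinh (2 / PI * arsinh x).

Definition sinc (s : R) : R := if Req_EM_T s 0 then 1 else sin s / s.
Definition Si (x : R) : R := RInt sinc 0 x.

Definition J (k h x : R) : R := h * (1 / 2 + 1 / PI * Si (PI * (x / h - k))).

Definition x_gamma (g : R) : R :=
  if Rlt_dec g (1 / (2 * PI)) then
    arsinh (sqrt (1 + sqrt (1 - (2 * PI * g) ^ 2)) / (2 * PI * g))
  else arsinh 1.

Definition in_strip (d : R) (z : C) : Prop := Rabs (Im z) < d.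

Definition analytic_on_psi_strip (d : R) (f : C -> C) : Prop :=
  forall z : C, in_strip d z -> ex_derive (K := C_AbsRing) f (psiC z).

Definition sumZ (g : Z -> C) (a b : Z) : C :=
  fold_right Cplus (RtoC 0)
    (map (fun i => g (a + Z.of_nat i)%Z) (seq 0 (Z.to_nat (b - a + 1)))).

Definition h_step (d mu : R) (n : nat) : R := ln (4 * d * INR n / mu) / INR n.

Definition M_idx (al be d : R) (n : nat) : Z :=
  if Rle_dec al be then Z.of_nat n
  else (Z.of_nat n - Int_part (ln (al / be) / h_step d (Rmin al be) n))%Z.
Definition N_idx (al be d : R) (n : nat) : Z :=
  if Rle_dec al be then (Z.of_nat n - Int_part (ln (be / al) / h_step d (Rmin al be) n))%Z
  else Z.of_nat n.

Definition const_C1 (K al be d : R) : R :=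
  let mu := Rmin al be in let nu := Rmax al be in
  Rpower 2 (nu + 1) * K / (mu * d) *
  (1 / ((1 - exp (- (PI * mu * exp 1 / 2))) * Rpower (cos (PI / 2 * sin d)) nu * cos d)
   + exp (PI * (al + be) / 4)).

Definition approx (f : C -> C) (h : R) (M N : Z) (tau : R) : C :=
  sumZ (fun k => (f (RtoC (psi (IZR k * h))) *
                  RtoC (Derive psi (IZR k * h) * J (IZR k) h (psi_inv tau)))%C)
       (- M) N.

(* Main.v *)
Require Import Defs.
From Stdlib Require Import Reals ZArith List Lra Lia Psatz ClassicalEpsilon.
From Coquelicot Require Import Coquelicot.
Open Scope R_scope.

(* Put F = (f o psi) psi'. The sine residues on a rectangle whose vertical sides lie between grid
   points express the pointwise error F(x) - sum_k F(kh) S(k,h)(x) of sinc interpolation as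
   sin(pi x/h)/(2 pi i) times the contour integral of F(z)/((z - x) sin(pi z/h)). Integrating in x
   from -A to xi = psi^-1(tau) and exchanging the integrals leaves, for each z on the lines
   Im z = +-e, the integral of sin(pi x/h)/(z - x), which integration by parts bounds by
   (h/pi)(1 + pi)/e provided cos(pi A/h) = 0; the factor 1/sinh(pi e/h) is the decay of the
   discretization error. Then A -> oo (the functions J(k,h)(-A) tend to 0 by Dirichlet's integral,
   itself obtained by interpolating the constant 1) and e -> d. On the lines F is controlled by
   |cosh(pi/2 sinh(x+iy))| >= cos(pi/2 sin y) cosh(pi/2 cos y sinh x).

   For the truncation, h cosh(x+h) exp(-a sinh(x+h)) <= (1+h)/a (exp(-a sinh x) - exp(-a sinh(x+h)))
   telescopes; the loss of the factor 1 + h is absorbed by the final constant. *)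


(** * Complex differentiability *)

(** Two scales drive the constants. With [L = ln (4 d n / mu)] the truncation error carries
    [exp (- PI d n)], the discretization error [exp (- PI d n / L)]. The ratio pays for every crude
    step of the truncation: the bound [3/2 h] on [J], the factor [1 + h], and the factor [L / n]
    that the claim demands ([truncation_const]). The tails live on the real line, where the majorant
    has no cosine factor; hence the bare [exp (PI (al + be) / 4)] in the constant. On the
    discretization side, absolute values under the integral in [x] would lose the factor [h] and
    leave a logarithm in [A], so the oscillation of the sine must be used. The factor
    [1 - exp (- PI mu e / 2)], with [e = exp 1], is what the hyperbolic sine leaves once
    [exp L >= e L] is known. Analyticity is assumed as existence of the derivative at each point of
    the open strip. Cauchy's theorem therefore needs Goursat's argument, and all estimates are first
    made at heights below [d]. *)

Notation continuousC f x := (continuous (U := C_UniformSpace) f x).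

Lemma C_ext (u v : C) : fst u = fst v -> snd u = snd v -> u = v.
Proof. destruct u, v; simpl; congruence. Qed.

Lemma continuous_C_pair {U : UniformSpace} (f : U -> C) (x : U) :
  continuous (fun t => fst (f t)) x -> continuous (fun t => snd (f t)) x ->
  continuousC f x.
Proof.
intros H1 H2 P [eps HP].
assert (A1 : locally x (fun t => ball (fst (f x)) eps (fst (f t))))
  by exact (H1 _ (locally_ball (fst (f x)) eps)).
assert (A2 : locally x (fun t => ball (snd (f x)) eps (snd (f t))))
  by exact (H2 _ (locally_ball (snd (f x)) eps)).
unfold filtermap. generalize (filter_and _ _ A1 A2). apply filter_imp.
intros t [B1 B2]. apply HP. split; assumption.
Qed.

Lemma continuous_C_fst {U : UniformSpace} (f : U -> C) (x : U) :
  continuousC f x -> continuous (fun t => fst (f t)) x.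
Proof.
intros H. apply (continuous_comp (V := C_UniformSpace) f fst); [exact H|apply continuous_fst].
Qed.

Lemma continuous_C_snd {U : UniformSpace} (f : U -> C) (x : U) :
  continuousC f x -> continuous (fun t => snd (f t)) x.
Proof.
intros H. apply (continuous_comp (V := C_UniformSpace) f snd); [exact H|apply continuous_snd].
Qed.

Section ContinuousC.
Context {U : UniformSpace}.
Implicit Types f g : U -> C.

Lemma continuous_Cplus f g x :
  continuousC f x -> continuousC g x ->
  continuousC (fun t => f t + g t)%C x.
Proof.
intros Hf Hg; apply continuous_C_pair; simpl;
  apply (continuous_plus (K := R_AbsRing) (V := R_NormedModule));
  auto using continuous_C_fst, continuous_C_snd.
Qed.

Lemma continuous_Copp f x :
  continuousC f x ->
  continuousC (fun t => - f t)%C x.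
Proof.
intros Hf; apply continuous_C_pair; simpl;
  apply (continuous_opp (K := R_AbsRing) (V := R_NormedModule));
  auto using continuous_C_fst, continuous_C_snd.
Qed.

Lemma continuous_Cminus f g x :
  continuousC f x -> continuousC g x ->
  continuousC (fun t => f t - g t)%C x.
Proof. intros Hf Hg; apply continuous_Cplus, continuous_Copp; assumption. Qed.

Lemma continuous_Cmult f g x :
  continuousC f x -> continuousC g x ->
  continuousC (fun t => f t * g t)%C x.
Proof.
intros Hf Hg; apply continuous_C_pair; simpl;
  [apply (continuous_minus (K := R_AbsRing) (V := R_NormedModule))
  |apply (continuous_plus (K := R_AbsRing) (V := R_NormedModule))];
  apply (continuous_mult (K := R_AbsRing));
  auto using continuous_C_fst, continuous_C_snd.
Qed.

Lemma continuous_Rinv_fun (f : U -> R) x :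
  continuous f x -> f x <> 0 -> continuous (fun t => / f t) x.
Proof.
intros Hf H0; apply (continuous_comp f Rinv); [exact Hf|].
apply continuity_pt_filterlim, continuity_pt_inv; [apply continuity_pt_id|exact H0].
Qed.

Lemma Csq_neq_0 (z : C) : z <> 0%C -> fst z ^ 2 + snd z ^ 2 <> 0.
Proof. intros H E; apply H, C_ext; simpl; nra. Qed.

Lemma continuous_Cinv f x :
  continuousC f x -> f x <> 0%C ->
  continuousC (fun t => / f t)%C x.
Proof.
intros Hf H0.
assert (H1 := continuous_C_fst _ _ Hf). assert (H2 := continuous_C_snd _ _ Hf).
assert (S : forall u : U -> R, continuous u x -> continuous (fun t => u t ^ 2) x).
{ intros u Hu. apply (continuous_comp u (fun r => r ^ 2)); [exact Hu|].
  apply continuity_pt_filterlim. reg. }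
assert (HD : continuous (fun t => / (fst (f t) ^ 2 + snd (f t) ^ 2)) x).
{ apply continuous_Rinv_fun; [|apply Csq_neq_0, H0].
  apply (continuous_plus (K := R_AbsRing) (V := R_NormedModule) (fun t => fst (f t) ^ 2) (fun t => snd (f t) ^ 2));
    apply S; assumption. }
apply continuous_C_pair; apply (continuous_mult (K := R_AbsRing)); auto.
apply (continuous_opp (K := R_AbsRing) (V := R_NormedModule)); auto.
Qed.

Lemma continuous_RtoC (f : U -> R) x :
  continuous f x -> continuousC (fun t => RtoC (f t)) x.
Proof. intros Hf; apply continuous_C_pair; simpl; [exact Hf|apply continuous_const]. Qed.

End ContinuousC.

Lemma Cmod_le_sum (z : C) : Cmod z <= Rabs (fst z) + Rabs (snd z).
Proof.
unfold Cmod. apply Rsqr_incr_0_var; [|pose proof (Rabs_pos (fst z)); pose proof (Rabs_pos (snd z)); lra].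
rewrite Rsqr_sqrt by nra. unfold Rsqr.
pose proof (Rabs_pos (fst z)); pose proof (Rabs_pos (snd z)).
rewrite <- (pow2_abs (fst z)), <- (pow2_abs (snd z)). nra.
Qed.

Lemma fst_le_Cmod (z : C) : Rabs (fst z) <= Cmod z.
Proof. eapply Rle_trans; [apply Rmax_l|apply Rmax_Cmod]. Qed.

Lemma snd_le_Cmod (z : C) : Rabs (snd z) <= Cmod z.
Proof. eapply Rle_trans; [apply Rmax_r|apply Rmax_Cmod]. Qed.

Lemma locally_C_Cmod (z : C) (P : C -> Prop) :
  locally (T := C_UniformSpace) z P <->
  exists delta, 0 < delta /\ forall w, Cmod (w - z) < delta -> P w.
Proof.
split.
- intros [d H]. exists d. split; [apply cond_pos|]. intros w Hw. apply H.
  split; simpl; unfold ball; simpl; unfold AbsRing_ball, abs, minus, plus, opp; simpl.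
  + eapply Rle_lt_trans; [|exact Hw]. apply (fst_le_Cmod (w - z)).
  + eapply Rle_lt_trans; [|exact Hw]. apply (snd_le_Cmod (w - z)).
- intros [d [Hd H]]. assert (Hd2 : 0 < d / 2) by lra. exists (mkposreal _ Hd2).
  intros w [H1 H2]. apply H. revert H1 H2.
  unfold ball; simpl; unfold AbsRing_ball, abs, minus, plus, opp; simpl. intros H1 H2.
  eapply Rle_lt_trans; [apply Cmod_le_sum|]. simpl. lra.
Qed.

Lemma locally_C_all (z : C) (P : C -> Prop) :
  (forall w, P w) -> locally (T := C_UniformSpace) z P.
Proof. intros H; apply locally_C_Cmod; exists 1; split; [lra|auto]. Qed.

(* Caratheodory's form of the derivative: the rules reduce to those for continuity. *)
Definition cderiv (f : C -> C) (z l : C) : Prop :=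
  exists phi : C -> C, continuousC phi z /\ phi z = l /\
    locally (T := C_UniformSpace) z (fun w => f w = f z + phi w * (w - z))%C.

Definition hol (f : C -> C) (z : C) : Prop := exists l, cderiv f z l.

Lemma cderiv_eps (f : C -> C) (z l : C) :
  cderiv f z l <->
  forall eps, 0 < eps -> exists delta, 0 < delta /\
    forall w, Cmod (w - z) < delta -> Cmod (f w - f z - l * (w - z)) <= eps * Cmod (w - z).
Proof.
split.
- intros [phi [Hc [Hl He]]] eps Heps. subst l.
  assert (H1 : locally (T := C_UniformSpace) z (fun w => Cmod (phi w - phi z) < eps)).
  { apply (Hc (fun y => Cmod (y - phi z) < eps)%C). apply locally_C_Cmod. exists eps; auto. }
  generalize (filter_and _ _ H1 He). intros H2. apply locally_C_Cmod in H2.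
  destruct H2 as [d [Hd H2]]. exists d; split; auto. intros w Hw.
  destruct (H2 w Hw) as [H3 H4]. rewrite H4.
  replace (f z + phi w * (w - z) - f z - phi z * (w - z))%C with ((phi w - phi z) * (w - z))%C by ring.
  rewrite Cmod_mult. apply Rmult_le_compat_r; [apply Cmod_ge_0|lra].
- intros H.
  (* The difference quotient, completed by [l] at [z]; the epsilon estimate says exactly that this
     is continuous at [z]. *)
  exists (fun w => if excluded_middle_informative (w = z) then l else ((f w - f z) / (w - z))%C).
  assert (Hz : (if excluded_middle_informative (z = z) then l else ((f z - f z) / (z - z))%C) = l)
    by (destruct (excluded_middle_informative (z = z)); congruence).
  split; [|split; [exact Hz|]].
  + intros P HP. rewrite Hz in HP. apply locally_C_Cmod in HP. destruct HP as [e [He HP]].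
    destruct (H (e / 2)) as [d [Hd H1]]; [lra|]. apply locally_C_Cmod. exists d; split; auto.
    intros w Hw. apply HP. destruct (excluded_middle_informative (w = z)) as [E|E].
    * replace (l - l)%C with (RtoC 0) by ring. rewrite Cmod_0; auto.
    * assert (N : (w - z)%C <> 0%C).
      { intros E'. apply E. replace w with (w - z + z)%C by ring. rewrite E'. ring. }
      replace ((f w - f z) / (w - z) - l)%C with ((f w - f z - l * (w - z)) / (w - z))%C by (field; auto).
      rewrite Cmod_div; auto. pose proof (proj1 (Cmod_gt_0 _) N).
      apply Rle_lt_trans with (e / 2); [|lra]. apply (Rmult_le_reg_r (Cmod (w - z))); auto.
      unfold Rdiv. rewrite Rmult_assoc, Rinv_l, Rmult_1_r by lra. apply H1, Hw.
  + apply locally_C_Cmod. exists 1; split; [lra|]. intros w _.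
    destruct (excluded_middle_informative (w = z)) as [E|E]; [subst; ring|].
    field. intros E'. apply E. replace w with (w - z + z)%C by ring. rewrite E'. ring.
Qed.

Lemma cderiv_is_derive (f : C -> C) (z l : C) :
  is_derive (K := C_AbsRing) (V := C_NormedModule) f z l -> cderiv f z l.
Proof.
intros [_ H]. apply cderiv_eps. intros eps Heps.
specialize (H z (fun P HP => HP) (mkposreal _ Heps)).
apply locally_C, locally_C_Cmod in H. destruct H as [d [Hd H]]. exists d; split; auto.
intros w Hw. specialize (H w Hw). simpl in H.
unfold norm, minus, plus, opp, scal, mult in H; simpl in H. unfold abs in H; simpl in H.
replace (f w - f z - l * (w - z))%C with (f w + - f z + - ((w + - z) * l))%C by ring. exact H.
Qed.

Lemma cderiv_continuous f z l :
  cderiv f z l -> continuousC f z.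
Proof.
intros [phi [Hc [Hl He]]].
apply (continuous_ext_loc (T := C_UniformSpace) (U := C_UniformSpace) _ (fun w => f z + phi w * (w - z))%C).
{ revert He; apply filter_imp; intros w E; symmetry; exact E. }
apply continuous_Cplus; [apply continuous_const|].
apply continuous_Cmult; auto. apply continuous_Cminus; [apply continuous_id|apply continuous_const].
Qed.

Lemma hol_continuous f z : hol f z -> continuousC f z.
Proof. intros [l H]; eapply cderiv_continuous; eauto. Qed.

Lemma cderiv_const c z : cderiv (fun _ => c) z 0%C.
Proof.
exists (fun _ => RtoC 0). split; [apply continuous_const|split; auto].
apply locally_C_all. intros w. ring.
Qed.

Lemma cderiv_id z : cderiv (fun w => w) z 1%C.
Proof.
exists (fun _ => RtoC 1). split; [apply continuous_const|split; auto].
apply locally_C_all. intros w. ring.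
Qed.

Lemma cderiv_plus f g z lf lg :
  cderiv f z lf -> cderiv g z lg -> cderiv (fun w => f w + g w)%C z (lf + lg)%C.
Proof.
intros [p [Hp [Hpl Hpe]]] [q [Hq [Hql Hqe]]]. subst.
exists (fun w => p w + q w)%C. split; [apply continuous_Cplus; auto|split; auto].
generalize (filter_and _ _ Hpe Hqe). apply filter_imp. intros w [E1 E2]. rewrite E1, E2. ring.
Qed.

Lemma cderiv_mult f g z lf lg :
  cderiv f z lf -> cderiv g z lg -> cderiv (fun w => f w * g w)%C z (lf * g z + f z * lg)%C.
Proof.
intros [p [Hp [Hpl Hpe]]] Hg. assert (Hcg := cderiv_continuous _ _ _ Hg).
destruct Hg as [q [Hq [Hql Hqe]]]. subst.
exists (fun w => p w * g w + f z * q w)%C. split; [|split; auto].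
{ apply continuous_Cplus; apply continuous_Cmult; auto. apply continuous_const. }
generalize (filter_and _ _ Hpe Hqe). apply filter_imp. intros w [E1 E2]. rewrite E1, E2. ring.
Qed.

Lemma cderiv_comp f g z lf lg :
  cderiv f (g z) lf -> cderiv g z lg -> cderiv (fun w => f (g w)) z (lf * lg)%C.
Proof.
intros [p [Hp [Hpl Hpe]]] Hg. assert (Hcg := cderiv_continuous _ _ _ Hg).
destruct Hg as [q [Hq [Hql Hqe]]]. subst.
exists (fun w => p (g w) * q w)%C. split; [|split; auto].
{ apply continuous_Cmult; auto.
  apply (continuous_comp (U := C_UniformSpace) (V := C_UniformSpace) (W := C_UniformSpace) g p); auto. }
assert (H1 : locally (T := C_UniformSpace) z (fun w => f (g w) = f (g z) + p (g w) * (g w - g z))%C)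
  by exact (Hcg _ Hpe).
generalize (filter_and _ _ H1 Hqe). apply filter_imp. intros w [E1 E2]. rewrite E1.
replace (g w - g z)%C with (q w * (w - z))%C by (rewrite E2; ring). ring.
Qed.

Lemma locally_C_neq_0 (f : C -> C) (z : C) :
  continuousC f z -> f z <> 0%C ->
  locally (T := C_UniformSpace) z (fun w => f w <> 0%C).
Proof.
intros Hc H0. apply (Hc (fun y : C => y <> 0%C)). apply locally_C_Cmod.
exists (Cmod (f z)). split; [apply Cmod_gt_0, H0|].
intros w Hw E. subst w. replace (0 - f z)%C with (- f z)%C in Hw by ring.
rewrite Cmod_opp in Hw. lra.
Qed.

Lemma cderiv_inv f z lf :
  cderiv f z lf -> f z <> 0%C -> cderiv (fun w => / f w)%C z (- lf / (f z * f z))%C.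
Proof.
intros Hf H0. assert (Hcf := cderiv_continuous _ _ _ Hf).
destruct Hf as [p [Hp [Hpl Hpe]]]. subst.
exists (fun w => - p w / (f w * f z))%C. split; [|split; auto].
{ apply continuous_Cmult; [apply continuous_Copp; auto|].
  apply continuous_Cinv; [apply continuous_Cmult; [auto|apply continuous_const]|].
  apply Cmult_neq_0; auto. }
generalize (filter_and _ _ Hpe (locally_C_neq_0 _ _ Hcf H0)). apply filter_imp. intros w [E1 E2].
replace (- p w / (f w * f z) * (w - z))%C with (- (p w * (w - z)) / (f w * f z))%C by (field; auto).
replace (p w * (w - z))%C with (f w - f z)%C by (rewrite E1; ring). field; auto.
Qed.

Lemma cderiv_eq f z l l' : cderiv f z l -> l = l' -> cderiv f z l'.
Proof. intros H <-; exact H. Qed.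

Lemma cderiv_ext f g z l : (forall w, f w = g w) -> cderiv f z l -> cderiv g z l.
Proof.
intros E [p [Hp [Hpl Hpe]]]. exists p; split; [auto|split; auto].
revert Hpe. apply filter_imp. intros w. rewrite !E; auto.
Qed.

Lemma hol_const c z : hol (fun _ => c) z.
Proof. eexists; apply cderiv_const. Qed.
Lemma hol_id z : hol (fun w => w) z.
Proof. eexists; apply cderiv_id. Qed.
Lemma hol_plus f g z : hol f z -> hol g z -> hol (fun w => f w + g w)%C z.
Proof. intros [l H] [m G]; eexists; apply cderiv_plus; eauto. Qed.
Lemma hol_mult f g z : hol f z -> hol g z -> hol (fun w => f w * g w)%C z.
Proof. intros [l H] [m G]; eexists; apply cderiv_mult; eauto. Qed.
Lemma hol_opp f z : hol f z -> hol (fun w => - f w)%C z.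
Proof.
intros [l H]; eexists. apply (cderiv_ext (fun w => RtoC (-1) * f w)%C); [intros; ring|].
apply cderiv_mult; [apply cderiv_const|eauto].
Qed.
Lemma hol_minus f g z : hol f z -> hol g z -> hol (fun w => f w - g w)%C z.
Proof. intros H G; apply hol_plus; [|apply hol_opp]; assumption. Qed.
Lemma hol_inv f z : hol f z -> f z <> 0%C -> hol (fun w => / f w)%C z.
Proof. intros [l H] H0; eexists; apply cderiv_inv; eauto. Qed.
Lemma hol_div f g z : hol f z -> hol g z -> g z <> 0%C -> hol (fun w => f w / g w)%C z.
Proof. intros H G H0; apply hol_mult; [|apply hol_inv]; assumption. Qed.
Lemma hol_comp f g z : hol f (g z) -> hol g z -> hol (fun w => f (g w)) z.
Proof. intros [l H] [m G]; eexists; eapply (cderiv_comp f g); eauto. Qed.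

Lemma is_derive_eps (f : R -> R) (x l : R) :
  is_derive f x l -> forall eps, 0 < eps -> exists delta, 0 < delta /\
    forall y, Rabs (y - x) < delta -> Rabs (f y - f x - l * (y - x)) <= eps * Rabs (y - x).
Proof.
intros [_ H] eps Heps.
destruct (H x (fun P HP => HP) (mkposreal _ Heps)) as [d Hd].
exists d; split; [apply cond_pos|]. intros y Hy. specialize (Hd y Hy).
unfold norm, minus, plus, opp, scal, mult in Hd; simpl in Hd. unfold abs, mult in Hd; simpl in Hd.
replace (f y - f x - l * (y - x)) with (f y + - f x + - ((y + - x) * l)) by ring. exact Hd.
Qed.

(** * The complex exponential *)

Lemma Cexp_plus (z w : C) : Cexp (z + w) = (Cexp z * Cexp w)%C.
Proof.
apply C_ext; simpl; rewrite exp_plus; [rewrite cos_plus|rewrite sin_plus]; ring.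
Qed.

Lemma Cexp_0 : Cexp 0 = 1%C.
Proof. apply C_ext; simpl; rewrite exp_0, ?cos_0, ?sin_0; ring. Qed.

(** By the functional equation the derivative at 0 is enough. There it follows from the real
    derivatives of [exp], [cos] and [sin], the error being split as
    [exp a (cos b - 1) + (exp a - 1 - a)] and [exp a (sin b - b) + (exp a - 1) b]. *)
Lemma cderiv_Cexp_0 : cderiv Cexp 0 1.
Proof.
apply cderiv_eps. intros eps Heps.
(* Each coordinate of the error will be at most [3 e m], so [6 e <= eps] is what counts; [e <= 1]
   gives [exp a <= 2]. *)
set (e := Rmin (eps / 9) 1).
assert (He : 0 < e) by (apply Rmin_glb_lt; lra).
assert (He1 : e <= 1) by apply Rmin_r. assert (He2 : e <= eps / 9) by apply Rmin_l.
destruct (is_derive_eps exp 0 (exp 0)) with (eps := e) as [d1 [Hd1 H1]]; [apply is_derive_exp|auto|].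
destruct (is_derive_eps cos 0 (- sin 0)) with (eps := e) as [d2 [Hd2 H2]]; [apply is_derive_cos|auto|].
destruct (is_derive_eps sin 0 (cos 0)) with (eps := e) as [d3 [Hd3 H3]]; [apply is_derive_sin|auto|].
rewrite exp_0 in H1. rewrite sin_0, cos_0 in H2. rewrite sin_0, cos_0 in H3.
(* The entry [e / 2] turns the first-order estimate of [exp] into [|exp a - 1| <= e]. *)
set (d := Rmin (Rmin d1 (Rmin d2 d3)) (e / 2)).
assert (Hdd : d <= d1 /\ d <= d2 /\ d <= d3 /\ d <= e / 2).
{ unfold d. repeat split.
  - eapply Rle_trans; [apply Rmin_l|apply Rmin_l].
  - eapply Rle_trans; [apply Rmin_l|]. eapply Rle_trans; [apply Rmin_r|apply Rmin_l].
  - eapply Rle_trans; [apply Rmin_l|]. eapply Rle_trans; [apply Rmin_r|apply Rmin_r].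
  - apply Rmin_r. }
assert (Hd : 0 < d) by (unfold d; repeat apply Rmin_glb_lt; lra).
exists d; split; auto. intros [a b] Hw.
replace ((a, b) - 0)%C with ((a, b) : C) in * by (apply C_ext; simpl; ring).
pose proof (fst_le_Cmod (a, b)) as Ha. pose proof (snd_le_Cmod (a, b)) as Hb. simpl in Ha, Hb.
set (m := Cmod (a, b)) in *.
specialize (H1 a). specialize (H2 b). specialize (H3 b).
rewrite !Rminus_0_r in H1, H2, H3.
assert (A1 : Rabs (exp a - 1 - 1 * a) <= e * m).
{ eapply Rle_trans; [apply H1; lra|]. apply Rmult_le_compat_l; lra. }
assert (A2 : Rabs (cos b - 1) <= e * m).
{ eapply Rle_trans; [|apply Rmult_le_compat_l; [lra|exact Hb]].
  replace (cos b - 1) with (cos b - 1 - - 0 * b) by ring. apply H2; lra. }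
assert (A3 : Rabs (sin b - b) <= e * m).
{ eapply Rle_trans; [|apply Rmult_le_compat_l; [lra|exact Hb]].
  replace (sin b - b) with (sin b - 0 - 1 * b) by ring. apply H3; lra. }
clear H1 H2 H3.
assert (A4 : Rabs (exp a - 1) <= e).
{ apply Rabs_le_between in A1. apply Rabs_le_between in Ha. apply Rabs_le. nra. }
assert (Hm : 0 <= m) by apply Cmod_ge_0.
assert (E1 : 0 <= exp a <= 2) by (apply Rabs_le_between in A4; pose proof (exp_pos a); lra).
eapply Rle_trans; [apply Cmod_le_sum|]. rewrite Cexp_0. simpl.
assert (B1 : Rabs (exp a * cos b + - (1) + - (1 * a - 0 * b)) <= 3 * (e * m)).
{ replace (exp a * cos b + - (1) + - (1 * a - 0 * b))
    with (exp a * (cos b - 1) + (exp a - 1 - 1 * a)) by ring.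
  eapply Rle_trans; [apply Rabs_triang|]. rewrite Rabs_mult, (Rabs_pos_eq (exp a)) by lra.
  pose proof (Rabs_pos (cos b - 1)). nra. }
assert (B2 : Rabs (exp a * sin b + - 0 + - (1 * b + 0 * a)) <= 3 * (e * m)).
{ replace (exp a * sin b + - 0 + - (1 * b + 0 * a))
    with (exp a * (sin b - b) + (exp a - 1) * b) by ring.
  eapply Rle_trans; [apply Rabs_triang|]. rewrite !Rabs_mult, (Rabs_pos_eq (exp a)) by lra.
  pose proof (Rabs_pos (sin b - b)). pose proof (Rabs_pos (exp a - 1)). pose proof (Rabs_pos b). nra. }
nra.
Qed.

Lemma cderiv_Cexp z : cderiv Cexp z (Cexp z).
Proof.
apply (cderiv_ext (fun w => Cexp z * Cexp (w + - z))%C).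
{ intros w. rewrite <- Cexp_plus. f_equal. ring. }
eapply cderiv_eq.
- apply cderiv_mult; [apply cderiv_const|].
  apply (cderiv_comp Cexp (fun w => w + - z)%C z 1 (1 + 0)).
  + replace (z + - z)%C with (RtoC 0) by ring. apply cderiv_Cexp_0.
  + apply cderiv_plus; [apply cderiv_id|apply cderiv_const].
- cbv beta. ring.
Qed.

(** * Contour integrals over rectangles *)

Notation is_CInt f a b l := (is_RInt (V := C_R_NormedModule) f a b l).
Definition CInt (f : R -> C) (a b : R) : C := RInt (V := C_R_CompleteNormedModule) f a b.

Lemma norm_C_R (z : C) : norm (K := R_AbsRing) (V := C_R_NormedModule) z = Cmod z.
Proof.
unfold norm; simpl. unfold prod_norm, Cmod, norm; simpl. unfold abs; simpl.
f_equal. rewrite !Rmult_1_r, <- !Rabs_mult, !Rabs_pos_eq by nra. ring.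
Qed.

Lemma CInt_unique f a b l : is_CInt f a b l -> CInt f a b = l.
Proof. apply (is_RInt_unique (V := C_R_CompleteNormedModule)). Qed.

Lemma is_CInt_CInt f a b :
  (forall t, Rmin a b <= t <= Rmax a b -> continuousC f t) -> is_CInt f a b (CInt f a b).
Proof.
intros H. apply (RInt_correct (V := C_R_CompleteNormedModule)).
apply (ex_RInt_continuous (V := C_R_CompleteNormedModule)). exact H.
Qed.

Lemma is_CInt_pair f a b (l1 l2 : R) :
  is_RInt (fun t => fst (f t)) a b l1 -> is_RInt (fun t => snd (f t)) a b l2 ->
  is_CInt f a b (l1, l2).
Proof. intros H1 H2. apply (is_RInt_fct_extend_pair (U := R_NormedModule) (V := R_NormedModule)); assumption. Qed.

Lemma is_CInt_fst f a b l : is_CInt f a b l -> is_RInt (fun t => fst (f t)) a b (fst l).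
Proof. apply (is_RInt_fct_extend_fst (U := R_NormedModule) (V := R_NormedModule)). Qed.

Lemma is_CInt_snd f a b l : is_CInt f a b l -> is_RInt (fun t => snd (f t)) a b (snd l).
Proof. apply (is_RInt_fct_extend_snd (U := R_NormedModule) (V := R_NormedModule)). Qed.

Lemma is_CInt_plus (f g : R -> C) a b (lf lg : C) :
  is_CInt f a b lf -> is_CInt g a b lg -> is_CInt (fun t => f t + g t)%C a b (lf + lg)%C.
Proof. apply (is_RInt_plus (V := C_R_NormedModule)). Qed.

Lemma is_CInt_minus (f g : R -> C) a b (lf lg : C) :
  is_CInt f a b lf -> is_CInt g a b lg -> is_CInt (fun t => f t - g t)%C a b (lf - lg)%C.
Proof. apply (is_RInt_minus (V := C_R_NormedModule)). Qed.

Lemma is_CInt_const (c : C) a b : is_CInt (fun _ => c) a b (RtoC (b - a) * c)%C.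
Proof.
replace (RtoC (b - a) * c)%C with (scal (V := C_R_NormedModule) (b - a) c).
- apply (is_RInt_const (V := C_R_NormedModule)).
- apply C_ext; unfold scal; simpl; unfold prod_scal, scal; simpl; unfold mult; simpl; ring.
Qed.

Lemma is_CInt_Cmult (c : C) (f : R -> C) a b (l : C) : is_CInt f a b l -> is_CInt (fun t => c * f t)%C a b (c * l)%C.
Proof.
intros H. assert (H1 := is_CInt_fst _ _ _ _ H). assert (H2 := is_CInt_snd _ _ _ _ H).
apply is_CInt_pair; simpl.
- apply (is_RInt_minus (V := R_NormedModule)); apply (is_RInt_scal (V := R_NormedModule)); assumption.
- apply (is_RInt_plus (V := R_NormedModule)); apply (is_RInt_scal (V := R_NormedModule)); assumption.
Qed.

Lemma is_CInt_ext (f g : R -> C) a b (l : C) :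
  (forall t, Rmin a b < t < Rmax a b -> f t = g t) -> is_CInt f a b l -> is_CInt g a b l.
Proof. apply (is_RInt_ext (V := C_R_NormedModule)). Qed.

Lemma is_CInt_Cmod_le (f : R -> C) (g : R -> R) a b (l : C) lg :
  a <= b -> (forall t, a <= t <= b -> Cmod (f t) <= g t) ->
  is_CInt f a b l -> is_RInt g a b lg -> Cmod l <= lg.
Proof.
intros Hab H H1 H2. rewrite <- norm_C_R.
apply (norm_RInt_le (V := C_R_NormedModule) f g a b); auto.
intros t Ht. rewrite norm_C_R; auto.
Qed.

Lemma is_CInt_Cmod_le_const (f : R -> C) a b (l : C) M :
  a <= b -> (forall t, a <= t <= b -> Cmod (f t) <= M) ->
  is_CInt f a b l -> Cmod l <= (b - a) * M.
Proof.
intros Hab H H1. rewrite <- norm_C_R.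
apply (norm_RInt_le_const (V := C_R_NormedModule) f a b); auto.
intros t Ht. rewrite norm_C_R; auto.
Qed.

Lemma is_CInt_Chasles (f : R -> C) a b c (l1 l2 : C) :
  is_CInt f a b l1 -> is_CInt f b c l2 -> is_CInt f a c (l1 + l2)%C.
Proof. apply (is_RInt_Chasles (V := C_R_NormedModule)). Qed.

Lemma CInt_Chasles f a b c :
  a <= b -> b <= c -> (forall t, a <= t <= c -> continuousC f t) ->
  CInt f a c = (CInt f a b + CInt f b c)%C.
Proof.
intros H1 H2 H. apply CInt_unique. apply is_CInt_Chasles with b; apply is_CInt_CInt;
 rewrite Rmin_left, Rmax_right by lra; intros; apply H; lra.
Qed.

Lemma CInt_ext f g a b :
  (forall t, Rmin a b < t < Rmax a b -> f t = g t) -> CInt f a b = CInt g a b.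
Proof. apply (RInt_ext (V := C_R_CompleteNormedModule)). Qed.

(** The contour integral along the boundary, counterclockwise; on the vertical sides [dz = i dy]. *)
Definition rect (G : C -> C) (a b c d : R) : C :=
  (CInt (fun x => G (x, c)) a b + Ci * CInt (fun y => G (b, y)) c d
   - CInt (fun x => G (x, d)) a b - Ci * CInt (fun y => G (a, y)) c d)%C.

Lemma continuous_hline (G : C -> C) (x y : R) :
  hol G (x, y) -> continuousC (fun t => G (t, y)) x.
Proof.
intros H. apply (continuous_comp (V := C_UniformSpace) (fun t : R => (t, y)) G);
  [|apply hol_continuous, H].
apply continuous_C_pair; simpl; [apply continuous_id|apply continuous_const].
Qed.

Lemma continuous_vline (G : C -> C) (x y : R) :
  hol G (x, y) -> continuousC (fun t => G (x, t)) y.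
Proof.
intros H. apply (continuous_comp (V := C_UniformSpace) (fun t : R => (x, t)) G);
  [|apply hol_continuous, H].
apply continuous_C_pair; simpl; [apply continuous_const|apply continuous_id].
Qed.

Lemma rect_split_v (G : C -> C) a m b c d :
  a <= m -> m <= b ->
  (forall x, a <= x <= b -> continuousC (fun t => G (t, c)) x) ->
  (forall x, a <= x <= b -> continuousC (fun t => G (t, d)) x) ->
  rect G a b c d = (rect G a m c d + rect G m b c d)%C.
Proof.
intros H1 H2 Hc Hd. unfold rect.
rewrite (CInt_Chasles (fun x : R => G (x, c)) a m b H1 H2 Hc),
  (CInt_Chasles (fun x : R => G (x, d)) a m b H1 H2 Hd). ring.
Qed.

Lemma rect_split_h (G : C -> C) a b c k d :
  c <= k -> k <= d ->
  (forall y, c <= y <= d -> continuousC (fun t => G (a, t)) y) ->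
  (forall y, c <= y <= d -> continuousC (fun t => G (b, t)) y) ->
  rect G a b c d = (rect G a b c k + rect G a b k d)%C.
Proof.
intros H1 H2 Ha Hb. unfold rect.
rewrite (CInt_Chasles (fun y : R => G (a, y)) c k d H1 H2 Ha),
  (CInt_Chasles (fun y : R => G (b, y)) c k d H1 H2 Hb). ring.
Qed.

Lemma rect_bound (G : C -> C) a b c d M1 M2 :
  a <= b -> c <= d ->
  (forall x, a <= x <= b -> continuousC (fun t => G (t, c)) x) ->
  (forall x, a <= x <= b -> continuousC (fun t => G (t, d)) x) ->
  (forall y, c <= y <= d -> continuousC (fun t => G (a, t)) y) ->
  (forall y, c <= y <= d -> continuousC (fun t => G (b, t)) y) ->
  (forall x, a <= x <= b -> Cmod (G (x, c)) <= M1 /\ Cmod (G (x, d)) <= M1) ->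
  (forall y, c <= y <= d -> Cmod (G (a, y)) <= M2 /\ Cmod (G (b, y)) <= M2) ->
  Cmod (rect G a b c d) <= 2 * ((b - a) * M1 + (d - c) * M2).
Proof.
intros Hab Hcd Hc Hd Ha Hb HM1 HM2. unfold rect.
assert (X : forall (f : R -> C) u v M, u <= v -> (forall t, u <= t <= v -> continuousC f t) ->
   (forall t, u <= t <= v -> Cmod (f t) <= M) -> Cmod (CInt f u v) <= (v - u) * M).
{ intros f u v M Huv Hf HfM. apply is_CInt_Cmod_le_const with f; auto. apply is_CInt_CInt.
  rewrite Rmin_left, Rmax_right by lra; auto. }
pose proof (X (fun x : R => G (x, c)) _ _ _ Hab Hc (fun t Ht => proj1 (HM1 t Ht))) as B1.
pose proof (X (fun x : R => G (x, d)) _ _ _ Hab Hd (fun t Ht => proj2 (HM1 t Ht))) as B2.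
pose proof (X (fun y : R => G (a, y)) _ _ _ Hcd Ha (fun t Ht => proj1 (HM2 t Ht))) as B3.
pose proof (X (fun y : R => G (b, y)) _ _ _ Hcd Hb (fun t Ht => proj2 (HM2 t Ht))) as B4.
unfold Cminus. eapply Rle_trans; [apply Cmod_triangle|]. rewrite Cmod_opp.
eapply Rle_trans; [apply Rplus_le_compat_r, Cmod_triangle|]. rewrite Cmod_opp.
eapply Rle_trans; [apply Rplus_le_compat_r, Rplus_le_compat_r, Cmod_triangle|].
rewrite !Cmod_mult, Cmod_Ci. lra.
Qed.

(** * Goursat's theorem by bisection *)

Lemma nested_intervals (u v : nat -> R) :
  (forall n, u n <= u (S n)) -> (forall n, v (S n) <= v n) -> (forall n, u n <= v n) ->
  exists x, forall n, u n <= x <= v n.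
Proof.
intros Hu Hv Huv.
assert (Hum : forall n m, (n <= m)%nat -> u n <= u m).
{ intros n m H; induction H as [|m H IH]; [lra|]. pose proof (Hu m); lra. }
assert (Hvm : forall n m, (n <= m)%nat -> v m <= v n).
{ intros n m H; induction H as [|m H IH]; [lra|]. pose proof (Hv m); lra. }
assert (Hc : forall n m, u n <= v m).
{ intros n m. destruct (le_lt_dec n m) as [H|H].
  - pose proof (Hum n m H). pose proof (Huv m). lra.
  - pose proof (Hvm m n (Nat.lt_le_incl _ _ H)). pose proof (Huv n). lra. }
destruct (completeness (fun r => exists n, r = u n)) as [x [H1 H2]].
- exists (v 0%nat). intros r [n ->]. apply Hc.
- exists (u 0%nat), 0%nat. reflexivity.
- exists x. intros n; split.
  + apply H1. exists n; reflexivity.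
  + apply H2. intros r [m ->]. apply Hc.
Qed.

Section Bisection.
Variables (w h : R) (Q : nat -> R -> R -> Prop).
Hypothesis Hw : 0 <= w.
Hypothesis Hh : 0 <= h.
Hypothesis Q_step : forall n a c,
  Q (S n) a c -> Q (S n) (a + w / 2 ^ S n) c -> Q (S n) a (c + h / 2 ^ S n) ->
  Q (S n) (a + w / 2 ^ S n) (c + h / 2 ^ S n) -> Q n a c.

Lemma bisection_child n a c : ~ Q n a c ->
  exists a' c', ~ Q (S n) a' c' /\ (a' = a \/ a' = a + w / 2 ^ S n) /\
                (c' = c \/ c' = c + h / 2 ^ S n).
Proof.
intros H. apply NNPP. intros N. apply H. apply Q_step; apply NNPP; intros N'; apply N.
- exists a, c; auto.
- exists (a + w / 2 ^ S n), c; auto.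
- exists a, (c + h / 2 ^ S n); auto.
- exists (a + w / 2 ^ S n), (c + h / 2 ^ S n); auto.
Qed.

(** [Q n a c] is meant for the rectangle with lower left corner [(a, c)] and sides [w / 2 ^ n],
    [h / 2 ^ n]. If it fails at the start, it fails on a nested sequence of quarters, which shrinks
    to a point. *)
Lemma bisection a0 c0 : ~ Q 0 a0 c0 ->
  exists (x y : R) (u v : nat -> R), forall n,
    ~ Q n (u n) (v n) /\ u n <= x <= u n + w / 2 ^ n /\ v n <= y <= v n + h / 2 ^ n /\
    a0 <= u n /\ u n + w / 2 ^ n <= a0 + w /\ c0 <= v n /\ v n + h / 2 ^ n <= c0 + h.
Proof.
intros H0.
(* Carrying the proof of failure in the type makes the choice of a failing quarter a total function
   that can be iterated. *)
set (T := {p : nat * (R * R) | ~ Q (fst p) (fst (snd p)) (snd (snd p))}).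
assert (step : forall p : T, {q : T | fst (proj1_sig q) = S (fst (proj1_sig p)) /\
   (fst (snd (proj1_sig q)) = fst (snd (proj1_sig p)) \/
    fst (snd (proj1_sig q)) = fst (snd (proj1_sig p)) + w / 2 ^ S (fst (proj1_sig p))) /\
   (snd (snd (proj1_sig q)) = snd (snd (proj1_sig p)) \/
    snd (snd (proj1_sig q)) = snd (snd (proj1_sig p)) + h / 2 ^ S (fst (proj1_sig p)))}).
{ intros [[n [a c]] Hp]. apply constructive_indefinite_description.
  destruct (bisection_child _ _ _ Hp) as [a' [c' [H1 [H2 H3]]]].
  exists (exist _ (S n, (a', c')) H1). simpl. auto. }
set (s := fix s (n : nat) : T := match n with
   O => exist _ (0%nat, (a0, c0)) H0 | S n => proj1_sig (step (s n)) end).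
set (u := fun n => fst (snd (proj1_sig (s n)))).
set (v := fun n => snd (snd (proj1_sig (s n)))).
assert (Hn : forall n, fst (proj1_sig (s n)) = n).
{ induction n; [reflexivity|]. simpl. destruct (step (s n)) as [q [E E']]. simpl. congruence. }
assert (Hu : forall n, u (S n) = u n \/ u (S n) = u n + w / 2 ^ S n).
{ intros n. unfold u. simpl s. destruct (step (s n)) as [q [E1 [E E2]]]. pose proof E as E'.
  rewrite Hn in E'. exact E'. }
assert (Hv : forall n, v (S n) = v n \/ v (S n) = v n + h / 2 ^ S n).
{ intros n. unfold v. simpl s. destruct (step (s n)) as [q [E1 [E2 E]]]. pose proof E as E'.
  rewrite Hn in E'. exact E'. }
assert (HQ : forall n, ~ Q n (u n) (v n)).
{ intros n. pose proof (proj2_sig (s n)) as H. simpl in H. rewrite Hn in H. exact H. }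
assert (Hhalf : forall r n, r / 2 ^ n = r / 2 ^ S n + r / 2 ^ S n).
{ intros r n. simpl. field. apply pow_nonzero; lra. }
assert (Hpos : forall r n, 0 <= r -> 0 <= r / 2 ^ n).
{ intros r n Hr. apply Rdiv_le_0_compat; [lra|apply pow_lt; lra]. }
assert (Mono : forall n, u n <= u (S n) /\ u (S n) + w / 2 ^ S n <= u n + w / 2 ^ n /\
                         v n <= v (S n) /\ v (S n) + h / 2 ^ S n <= v n + h / 2 ^ n).
{ intros n. rewrite (Hhalf w n), (Hhalf h n).
  pose proof (Hpos w (S n) Hw). pose proof (Hpos h (S n) Hh).
  destruct (Hu n) as [-> | ->]; destruct (Hv n) as [-> | ->]; lra. }
destruct (nested_intervals u (fun n => u n + w / 2 ^ n)) as [x Hx].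
{ intros n; apply Mono. } { intros n; apply Mono. } { intros n; pose proof (Hpos w n Hw); lra. }
destruct (nested_intervals v (fun n => v n + h / 2 ^ n)) as [y Hy].
{ intros n; apply Mono. } { intros n; apply Mono. } { intros n; pose proof (Hpos h n Hh); lra. }
assert (Hin : forall n, a0 <= u n /\ u n + w / 2 ^ n <= a0 + w /\ c0 <= v n /\ v n + h / 2 ^ n <= c0 + h).
{ induction n.
  - unfold u, v; simpl. unfold Rdiv. rewrite Rinv_1. lra.
  - pose proof (Mono n). lra. }
exists x, y, u, v. intros n.
split; [apply HQ|]. split; [apply Hx|]. split; [apply Hy|]. apply Hin.
Qed.
End Bisection.

(** The midpoint rule is exact for affine integrands. *)
Lemma is_CInt_hline_affine (p q : C) a b y :
  is_CInt (fun x => p + q * (x, y))%C a b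
    (RtoC (b - a) * (p + q * (((a + b) / 2)%R, y)))%C.
Proof.
apply is_CInt_pair; simpl.
- replace (((b - a) * (fst p + (fst q * ((a + b) / 2) - snd q * y)) - 0 * (snd p + (fst q * y + snd q * ((a + b) / 2)))))
    with (minus ((fst p - snd q * y) * b + fst q * b ^ 2 / 2) ((fst p - snd q * y) * a + fst q * a ^ 2 / 2))
    by (unfold minus, plus, opp; simpl; field).
  apply (is_RInt_derive (V := R_CompleteNormedModule) (fun x => (fst p - snd q * y) * x + fst q * x ^ 2 / 2)).
  + intros x _. auto_derive; [trivial|field].
  + intros x _. apply continuity_pt_filterlim. reg.
- replace ((b - a) * (snd p + (fst q * y + snd q * ((a + b) / 2))) + 0 * (fst p + (fst q * ((a + b) / 2) - snd q * y)))
    with (minus ((snd p + fst q * y) * b + snd q * b ^ 2 / 2) ((snd p + fst q * y) * a + snd q * a ^ 2 / 2))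
    by (unfold minus, plus, opp; simpl; field).
  apply (is_RInt_derive (V := R_CompleteNormedModule) (fun x => (snd p + fst q * y) * x + snd q * x ^ 2 / 2)).
  + intros x _. auto_derive; [trivial|field].
  + intros x _. apply continuity_pt_filterlim. reg.
Qed.

Lemma is_CInt_vline_affine (p q : C) c d x :
  is_CInt (fun y => p + q * (x, y))%C c d
    (RtoC (d - c) * (p + q * (x, ((c + d) / 2)%R)))%C.
Proof.
(* A vertical line is a rotated horizontal one: [x + i y = i (y - i x)]. *)
generalize (is_CInt_hline_affine p (q * Ci) c d (- x)).
intros H. replace (RtoC (d - c) * (p + q * (x, ((c + d) / 2)%R)))%C
  with (RtoC (d - c) * (p + q * Ci * (((c + d) / 2)%R, (- x)%R)))%C.
- revert H. apply is_CInt_ext. intros t _. apply C_ext; simpl; ring.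
- apply C_ext; simpl; field.
Qed.

(** This lets [goursat] subtract the first-order expansion of [G] at the limit point without
    changing the integral. *)
Lemma rect_affine (p q : C) a b c d : rect (fun z => p + q * z)%C a b c d = 0%C.
Proof.
unfold rect.
rewrite (CInt_unique _ _ _ _ (is_CInt_hline_affine p q a b c)).
rewrite (CInt_unique _ _ _ _ (is_CInt_hline_affine p q a b d)).
rewrite (CInt_unique _ _ _ _ (is_CInt_vline_affine p q c d a)).
rewrite (CInt_unique _ _ _ _ (is_CInt_vline_affine p q c d b)).
apply C_ext; simpl; field.
Qed.

Lemma CInt_minus f g a b :
  (forall t, Rmin a b <= t <= Rmax a b -> continuousC f t) ->
  (forall t, Rmin a b <= t <= Rmax a b -> continuousC g t) ->
  CInt (fun t => f t - g t)%C a b = (CInt f a b - CInt g a b)%C.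
Proof. intros Hf Hg. apply CInt_unique, is_CInt_minus; apply is_CInt_CInt; assumption. Qed.

Definition hol_rect (G : C -> C) (a b c d : R) : Prop :=
  forall x y, a <= x <= b -> c <= y <= d -> hol G (x, y).

(** Regularity on the boundary alone, since around a pole only the boundary is available. *)
Definition hol_frame (G : C -> C) (a b c d : R) : Prop :=
  (forall x, a <= x <= b -> hol G (x, c) /\ hol G (x, d)) /\
  (forall y, c <= y <= d -> hol G (a, y) /\ hol G (b, y)).

Lemma hol_rect_frame G a b c d : a <= b -> c <= d -> hol_rect G a b c d -> hol_frame G a b c d.
Proof. intros Hab Hcd H; split; intros t Ht; split; apply H; lra. Qed.

Lemma hol_frame_minus G H a b c d :
  hol_frame G a b c d -> hol_frame H a b c d -> hol_frame (fun z => G z - H z)%C a b c d.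
Proof.
intros [G1 G2] [H1 H2]. split; intros t Ht; split; apply hol_minus;
  [apply (G1 t Ht)|apply (H1 t Ht)|apply (G1 t Ht)|apply (H1 t Ht)
  |apply (G2 t Ht)|apply (H2 t Ht)|apply (G2 t Ht)|apply (H2 t Ht)].
Qed.

Lemma hol_frame_continuous G a b c d : hol_frame G a b c d ->
  ((forall x, a <= x <= b -> continuousC (fun t : R => G (t, c)) x) /\
   (forall x, a <= x <= b -> continuousC (fun t : R => G (t, d)) x)) /\
  ((forall y, c <= y <= d -> continuousC (fun t : R => G (a, t)) y) /\
   (forall y, c <= y <= d -> continuousC (fun t : R => G (b, t)) y)).
Proof.
intros [H1 H2]. split; split; intros t Ht.
- exact (continuous_hline G t c (proj1 (H1 t Ht))).
- exact (continuous_hline G t d (proj2 (H1 t Ht))).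
- exact (continuous_vline G a t (proj1 (H2 t Ht))).
- exact (continuous_vline G b t (proj2 (H2 t Ht))).
Qed.

Lemma rect_minus (G H : C -> C) a b c d :
  a <= b -> c <= d -> hol_frame G a b c d -> hol_frame H a b c d ->
  rect (fun z => G z - H z)%C a b c d = (rect G a b c d - rect H a b c d)%C.
Proof.
intros Hab Hcd HG HH.
destruct (hol_frame_continuous _ _ _ _ _ HG) as [[G1 G2] [G3 G4]].
destruct (hol_frame_continuous _ _ _ _ _ HH) as [[H1 H2] [H3 H4]].
unfold rect.
rewrite (CInt_minus (fun x : R => G (x, c)) (fun x : R => H (x, c)) a b),
  (CInt_minus (fun x : R => G (x, d)) (fun x : R => H (x, d)) a b),
  (CInt_minus (fun y : R => G (a, y)) (fun y : R => H (a, y)) c d),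
  (CInt_minus (fun y : R => G (b, y)) (fun y : R => H (b, y)) c d);
  try (rewrite Rmin_left, Rmax_right by lra; assumption).
ring.
Qed.

Lemma rect_bound_hol (G : C -> C) a b c d M1 M2 :
  a <= b -> c <= d -> hol_frame G a b c d ->
  (forall x, a <= x <= b -> Cmod (G (x, c)) <= M1 /\ Cmod (G (x, d)) <= M1) ->
  (forall y, c <= y <= d -> Cmod (G (a, y)) <= M2 /\ Cmod (G (b, y)) <= M2) ->
  Cmod (rect G a b c d) <= 2 * ((b - a) * M1 + (d - c) * M2).
Proof.
intros Hab Hcd HG. destruct (hol_frame_continuous _ _ _ _ _ HG) as [[H1 H2] [H3 H4]].
apply rect_bound; assumption.
Qed.

Lemma goursat (G : C -> C) a b c d :
  a <= b -> c <= d -> hol_rect G a b c d -> rect G a b c d = 0%C.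
Proof.
intros Hab Hcd HG.
set (s := (b - a) + (d - c)).
assert (Hs : 0 <= s) by (unfold s; lra).
assert (Main : forall eps, 0 < eps -> Cmod (rect G a b c d) <= eps * s ^ 2).
{ intros eps Heps. apply NNPP. intros N.
  set (w := b - a). set (h := d - c).
  assert (Hw : 0 <= w) by (unfold w; lra). assert (Hh : 0 <= h) by (unfold h; lra).
  assert (Hpow : forall n, 0 < 2 ^ n) by (intros; apply pow_lt; lra).
  (* The target scales like the square of the size, so it passes from the four quarters to the
     whole. The containment premises are part of [Q] because nothing is known of [G] outside the
     given rectangle. *)
  set (Q := fun (n : nat) (u v : R) => a <= u -> u + w / 2 ^ n <= b -> c <= v -> v + h / 2 ^ n <= d ->
     Cmod (rect G u (u + w / 2 ^ n) v (v + h / 2 ^ n)) <= eps * (s / 2 ^ n) ^ 2).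
  destruct (bisection w h Q Hw Hh) with (a0 := a) (c0 := c) as [x [y [u [v H]]]].
  - intros n u v H1 H2 H3 H4 B1 B2 B3 B4.
    assert (Hhalf : forall r, r / 2 ^ n = r / 2 ^ S n + r / 2 ^ S n).
    { intros r. simpl. field. specialize (Hpow n); lra. }
    unfold Q in H1, H2, H3, H4. rewrite (Hhalf w) in *. rewrite (Hhalf h) in *.
    assert (W : 0 <= w / 2 ^ S n) by (apply Rdiv_le_0_compat; auto).
    assert (V : 0 <= h / 2 ^ S n) by (apply Rdiv_le_0_compat; auto).
    set (w' := w / 2 ^ S n) in *. set (h' := h / 2 ^ S n) in *.
    rewrite <- !Rplus_assoc in *.
    specialize (H1 ltac:(lra) ltac:(lra) ltac:(lra) ltac:(lra)).
    specialize (H2 ltac:(lra) ltac:(lra) ltac:(lra) ltac:(lra)).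
    specialize (H3 ltac:(lra) ltac:(lra) ltac:(lra) ltac:(lra)).
    specialize (H4 ltac:(lra) ltac:(lra) ltac:(lra) ltac:(lra)).
    rewrite (rect_split_v G u (u + w') (u + w' + w')); try lra;
      try (intros t Ht; apply continuous_hline, HG; lra).
    rewrite (rect_split_h G u (u + w') v (v + h') (v + h' + h')); try lra;
      try (intros t Ht; apply continuous_vline, HG; lra).
    rewrite (rect_split_h G (u + w') (u + w' + w') v (v + h') (v + h' + h')); try lra;
      try (intros t Ht; apply continuous_vline, HG; lra).
    eapply Rle_trans; [apply Cmod_triangle|].
    eapply Rle_trans; [apply Rplus_le_compat; apply Cmod_triangle|].
    replace (s / 2 ^ n) with (2 * (s / 2 ^ S n)) by (rewrite (Hhalf s); ring).
    nra.
  - intros HQ. apply N. unfold Q in HQ. simpl in HQ. unfold w, h, Rdiv in HQ. rewrite Rinv_1, !Rmult_1_r in HQ.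
    replace (a + (b - a)) with b in HQ by ring. replace (c + (d - c)) with d in HQ by ring.
    simpl. rewrite Rmult_1_r. apply HQ; lra.
  - replace (a + w) with b in H by (unfold w; ring). replace (c + h) with d in H by (unfold h; ring).
    assert (Hxy : a <= x <= b /\ c <= y <= d) by (specialize (H 0%nat); lra).
    destruct (HG x y) as [l Hl]; try tauto.
    (* Half of [eps], because the perimeter is [2 (w' + h')]. In the choice of [n] below, [s + 1]
       avoids dividing by zero for a degenerate rectangle. *)
    destruct (proj1 (cderiv_eps _ _ _) Hl (eps / 2)) as [delta [Hd Hdel]]; [lra|].
    destruct (pow_lt_1_zero (1/2)) with (y := delta / (s + 1)) as [n Hn].
    { rewrite Rabs_pos_eq; lra. } { apply Rdiv_lt_0_compat; lra. }
    specialize (Hn n (le_n n)). specialize (H n).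
    assert (Hsm : s / 2 ^ n < delta).
    { rewrite Rabs_pos_eq in Hn by (apply pow_le; lra).
      replace ((1 / 2) ^ n) with (/ 2 ^ n) in Hn by (rewrite <- pow_inv; f_equal; lra).
      apply Rmult_lt_compat_r with (r := s + 1) in Hn; [|lra].
      unfold Rdiv in Hn at 1. rewrite Rmult_assoc, Rinv_l, Rmult_1_r in Hn by lra.
      unfold Rdiv. assert (0 < / 2 ^ n) by (apply Rinv_0_lt_compat, Hpow). nra. }
    destruct H as [NQ [Hx [Hy [B1 [B2 [B3 B4]]]]]]. apply NQ. intros _ _ _ _.
    assert (W : 0 <= w / 2 ^ n) by (apply Rdiv_le_0_compat; auto).
    assert (V : 0 <= h / 2 ^ n) by (apply Rdiv_le_0_compat; auto).
    assert (Es : s / 2 ^ n = w / 2 ^ n + h / 2 ^ n)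
      by (unfold s, w, h; field; specialize (Hpow n); lra).
    rewrite Es in *. set (w' := w / 2 ^ n) in *. set (h' := h / 2 ^ n) in *.
    set (A := fun z : C => ((G (x, y) - l * (x, y)) + l * z)%C).
    assert (HA : forall z, hol A z).
    { intros z. apply hol_plus; [apply hol_const|apply hol_mult; [apply hol_const|apply hol_id]]. }
    assert (FG : hol_frame G (u n) (u n + w') (v n) (v n + h')).
    { apply hol_rect_frame; try lra. intros p q Hp Hq. apply HG; lra. }
    assert (FA : hol_frame A (u n) (u n + w') (v n) (v n + h')).
    { apply hol_rect_frame; try lra. intros p q _ _. apply HA. }
    assert (E : rect G (u n) (u n + w') (v n) (v n + h')
              = rect (fun z => G z - A z)%C (u n) (u n + w') (v n) (v n + h')).
    { rewrite rect_minus by (auto; lra). unfold A. rewrite rect_affine. ring. }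
    rewrite E.
    assert (Bd : forall p q, u n <= p <= u n + w' -> v n <= q <= v n + h' ->
        Cmod (G (p, q) - A (p, q))%C <= eps / 2 * (w' + h')).
    { intros p q Hp Hq. unfold A.
      replace (G (p, q) - (G (x, y) - l * (x, y) + l * (p, q)))%C
        with (G (p, q) - G (x, y) - l * ((p, q) - (x, y)))%C by ring.
      assert (D : Cmod ((p, q) - (x, y)) <= w' + h').
      { eapply Rle_trans; [apply Cmod_le_sum|]. simpl.
        apply Rplus_le_compat; apply Rabs_le; lra. }
      eapply Rle_trans; [apply Hdel; lra|]. apply Rmult_le_compat_l; lra. }
    eapply Rle_trans.
    + apply rect_bound_hol with (M1 := eps / 2 * (w' + h')) (M2 := eps / 2 * (w' + h')); try lra.
      * apply hol_frame_minus; assumption.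
      * intros t Ht; split; apply Bd; lra.
      * intros t Ht; split; apply Bd; lra.
    + nra. }
apply Cmod_eq_0. apply Rle_antisym; [|apply Cmod_ge_0].
apply Rle_plus_epsilon. intros e He.
eapply Rle_trans; [apply (Main (e / (s ^ 2 + 1)))|].
{ apply Rdiv_lt_0_compat; nra. }
apply Rmult_le_reg_r with (s ^ 2 + 1); [nra|].
unfold Rdiv. replace (e * / (s ^ 2 + 1) * s ^ 2 * (s ^ 2 + 1)) with (e * s ^ 2) by (field; nra).
nra.
Qed.

(** * Residues at simple real poles *)

Lemma den_pos (u r : R) : 0 < r -> 0 < u ^ 2 + r ^ 2.
Proof. intros Hr. pose proof (pow2_ge_0 u). pose proof (pow_lt r 2 Hr). lra. Qed.

Lemma is_RInt_kernel_even (p r a b : R) : 0 < r ->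
  is_RInt (fun x => r / ((x - p) ^ 2 + r ^ 2)) a b (atan ((b - p) / r) - atan ((a - p) / r)).
Proof.
intros Hr. apply (is_RInt_derive (V := R_CompleteNormedModule) (fun x => atan ((x - p) / r))).
- intros x _. auto_derive; [trivial|]. field. pose proof (den_pos (x - p) r Hr). lra.
- intros x _. apply continuity_pt_filterlim. reg. pose proof (den_pos (x - p) r Hr). lra.
Qed.

Lemma is_RInt_kernel_odd (p r s : R) : 0 < r ->
  is_RInt (fun x => (x - p) / ((x - p) ^ 2 + r ^ 2)) (p - s) (p + s) 0.
Proof.
intros Hr.
replace 0 with (minus (ln ((p + s - p) ^ 2 + r ^ 2) / 2) (ln ((p - s - p) ^ 2 + r ^ 2) / 2)).
- apply (is_RInt_derive (V := R_CompleteNormedModule) (fun x => ln ((x - p) ^ 2 + r ^ 2) / 2)).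
  + intros x _. pose proof (den_pos (x - p) r Hr). auto_derive; [simpl in *; lra|]. field. lra.
  + intros x _. apply continuity_pt_filterlim. reg. pose proof (den_pos (x - p) r Hr). lra.
- unfold minus, plus, opp; simpl.
  replace (p + s - p) with s by ring. replace (p - s - p) with (- s) by ring.
  replace (- s * (- s * 1)) with (s * (s * 1)) by ring. ring.
Qed.

Lemma Cminus_eq (z w : C) : (z - w)%C = 0%C -> z = w.
Proof. intros E. replace z with (z - w + w)%C by ring. rewrite E. ring. Qed.

Lemma Cneq_snd (z w : C) : snd z <> snd w -> (z - w)%C <> 0%C.
Proof. intros H E. apply H. apply (f_equal snd) in E. simpl in E. lra. Qed.

(** A side of the square is seen from its centre under the angle [PI / 2], and the logarithmic part
    cancels by symmetry. The equation [s ^ 2 = r ^ 2] covers the upper and the lower side at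
    once. *)
Lemma CInt_inv_hline (p r s : R) : 0 < r -> s ^ 2 = r ^ 2 ->
  CInt (fun x => / ((x, s) - RtoC p))%C (p - r) (p + r) = (0, - (s / r) * (PI / 2)).
Proof.
intros Hr Hs. apply CInt_unique, is_CInt_pair; simpl.
- apply (is_RInt_ext (V := R_NormedModule) (fun x => (x - p) / ((x - p) ^ 2 + r ^ 2)));
    [|apply is_RInt_kernel_odd; auto].
  intros x _. rewrite <- Hs. unfold Rdiv. f_equal; try ring; f_equal; ring.
- apply (is_RInt_ext (V := R_NormedModule) (fun x => - (s / r) * (r / ((x - p) ^ 2 + r ^ 2)))).
  { intros x _. pose proof (den_pos (x - p) r Hr). rewrite <- Hs in *.
    match goal with |- ?u = ?v => change (@eq R u v) end. field. split; simpl in *; lra. }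
  apply (is_RInt_scal (V := R_NormedModule)).
  generalize (is_RInt_kernel_even p r (p - r) (p + r) Hr).
  replace ((p + r - p) / r) with 1 by (field; lra). replace ((p - r - p) / r) with (- (1)) by (field; lra).
  rewrite atan_opp, atan_1. replace (PI / 4 - - (PI / 4)) with (PI / 2) by field. auto.
Qed.

(** Reduced to a horizontal side by the rotation [s + i y = i (y - i s)]. *)
Lemma CInt_inv_vline (p r s : R) : 0 < r -> s ^ 2 = r ^ 2 ->
  CInt (fun y => / (((p + s)%R, y) - RtoC p))%C (- r) r = (s / r * (PI / 2), 0).
Proof.
intros Hr Hs. pose proof (CInt_inv_hline 0 r (- s) Hr ltac:(rewrite <- Hs; ring)) as H.
replace (0 - r) with (- r) in H by ring. replace (0 + r) with r in H by ring.
apply CInt_unique. replace ((s / r * (PI / 2), 0) : C) with (- Ci * (0, (- (- s / r) * (PI / 2))%R))%C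
  by (apply C_ext; simpl; field; lra).
rewrite <- H. apply (is_CInt_ext (fun y => - Ci * / ((y, (- s)%R) - RtoC 0))%C).
- intros y _. assert (0 < s * s + y * y) by nra. apply (C_ext (- Ci * / ((y, (- s)%R) - RtoC 0))%C); simpl; field; nra.
- apply is_CInt_Cmult, is_CInt_CInt. intros y _. apply continuous_Cinv.
  + apply continuous_Cminus; [|apply continuous_const].
    apply continuous_C_pair; simpl; [apply continuous_id|apply continuous_const].
  + apply Cneq_snd. simpl. nra.
Qed.

Lemma rect_inv_square (p r : R) : 0 < r ->
  rect (fun z => / (z - RtoC p))%C (p - r) (p + r) (- r) r = (RtoC (2 * PI) * Ci)%C.
Proof.
intros Hr. unfold rect.
rewrite !CInt_inv_hline, (CInt_inv_vline p r r) by (auto; ring).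
replace (p - r) with (p + - r) by ring. rewrite CInt_inv_vline by (auto; ring).
apply C_ext; simpl; field; lra.
Qed.

Lemma pair_neq_fst (x y u : R) : x <> u -> (x, y) <> RtoC u.
Proof. intros H E; apply (f_equal fst) in E; auto. Qed.

Lemma pair_neq_snd (x y u : R) : y <> 0 -> (x, y) <> RtoC u.
Proof. intros H E; apply (f_equal snd) in E; auto. Qed.

(** The complement of the small square is cut into four rectangles free of the pole, on which
    [goursat] applies. *)
Lemma rect_shrink (G : C -> C) (a b c d p r : R) :
  0 < r -> a <= p - r -> p + r <= b -> c <= - r -> r <= d ->
  (forall x y, a <= x <= b -> c <= y <= d -> (x, y) <> RtoC p -> hol G (x, y)) ->
  rect G a b c d = rect G (p - r) (p + r) (- r) r.
Proof.
intros Hr Ha Hb Hc Hd HG.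
rewrite (rect_split_v G a (p - r) b); try lra;
  try (intros t Ht; apply continuous_hline, HG; first [lra|apply pair_neq_snd; lra]).
rewrite (rect_split_v G (p - r) (p + r) b); try lra;
  try (intros t Ht; apply continuous_hline, HG; first [lra|apply pair_neq_snd; lra]).
rewrite (rect_split_h G (p - r) (p + r) c (- r) d); try lra;
  try (intros t Ht; apply continuous_vline, HG; first [lra|apply pair_neq_fst; lra]).
rewrite (rect_split_h G (p - r) (p + r) (- r) r d); try lra;
  try (intros t Ht; apply continuous_vline, HG; first [lra|apply pair_neq_fst; lra]).
rewrite (goursat G a (p - r)), (goursat G (p + r) b), (goursat G (p - r) (p + r) c), (goursat G (p - r) (p + r) r);
  try lra; try (intros x y Hx Hy; apply HG; first [lra|apply pair_neq_snd; lra|apply pair_neq_fst; lra]).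
ring.
Qed.

(** Near the pole [D z = phi z (z - p)] with the continuous slope [phi], so [N / D] differs from
    [L / (z - p)] by [(N / phi - L) / (z - p)]. On a square of half-side [r] this is at most
    [eps / r], and the perimeter [8 r] leaves [8 eps]. No Laurent expansion is involved. *)
Lemma residue_simple_pole (N D : C -> C) (a b c d p : R) (l : C) :
  a < p < b -> c < 0 < d ->
  hol_rect N a b c d -> hol_rect D a b c d ->
  (forall x y, a <= x <= b -> c <= y <= d -> (x, y) <> RtoC p -> D (x, y) <> 0%C) ->
  D (RtoC p) = 0%C -> cderiv D (RtoC p) l -> l <> 0%C ->
  rect (fun z => N z / D z)%C a b c d = (RtoC (2 * PI) * Ci * (N (RtoC p) / l))%C.
Proof.
intros Hp Hcd HN HD HD0 Dp Dl Hl.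
set (G := fun z => (N z / D z)%C). set (L := (N (RtoC p) / l)%C).
assert (HG : forall x y, a <= x <= b -> c <= y <= d -> (x, y) <> RtoC p -> hol G (x, y)).
{ intros x y Hx Hy H. apply hol_div; auto. }
destruct Dl as [phi [Hphi [Ephi Dphi]]].
assert (Hq : continuousC (fun z => N z / phi z)%C (RtoC p)).
{ apply continuous_Cmult; [apply hol_continuous, (HN p 0); lra|].
  apply continuous_Cinv; [auto|rewrite Ephi; auto]. }
assert (Hphi0 : locally (T := C_UniformSpace) (RtoC p) (fun w => phi w <> 0%C)).
{ apply locally_C_neq_0; auto. rewrite Ephi; auto. }
assert (Main : forall eps, 0 < eps -> Cmod (rect G a b c d - RtoC (2 * PI) * Ci * L) <= 8 * eps).
{ intros eps Heps.
  assert (H1 : locally (T := C_UniformSpace) (RtoC p) (fun w => Cmod (N w / phi w - L) < eps)).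
  { apply (Hq (fun y => Cmod (y - L) < eps)%C). apply locally_C_Cmod. exists eps. unfold L. rewrite <- Ephi; auto. }
  generalize (filter_and _ _ (filter_and _ _ H1 Hphi0) Dphi). intros H2. apply locally_C_Cmod in H2.
  destruct H2 as [dl [Hdl H2]].
  (* The points of the square are within [2 r < dl] of [p]. *)
  set (r := Rmin (Rmin (p - a) (b - p)) (Rmin (Rmin (- c) d) (dl / 3))).
  assert (Hr : 0 < r) by (unfold r; repeat apply Rmin_glb_lt; lra).
  assert (Hrs : r <= p - a /\ r <= b - p /\ r <= - c /\ r <= d /\ r <= dl / 3).
  { unfold r. pose proof (Rmin_l (Rmin (p - a) (b - p)) (Rmin (Rmin (- c) d) (dl / 3))).
    pose proof (Rmin_r (Rmin (p - a) (b - p)) (Rmin (Rmin (- c) d) (dl / 3))).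
    pose proof (Rmin_l (p - a) (b - p)). pose proof (Rmin_r (p - a) (b - p)).
    pose proof (Rmin_l (Rmin (- c) d) (dl / 3)). pose proof (Rmin_r (Rmin (- c) d) (dl / 3)).
    pose proof (Rmin_l (- c) d). pose proof (Rmin_r (- c) d). lra. }
  rewrite (rect_shrink G a b c d p r) by (auto; lra).
  set (K := fun z => (L * / (z - RtoC p))%C).
  assert (HK : forall z, z <> RtoC p -> hol K z).
  { intros z Hz. apply hol_mult; [apply hol_const|]. apply hol_inv.
    - apply hol_minus; [apply hol_id|apply hol_const].
    - intros E. apply Hz, Cminus_eq, E. }
  assert (FG : hol_frame G (p - r) (p + r) (- r) r).
  { split; intros t Ht; split; apply HG; first [lra|apply pair_neq_snd; lra|apply pair_neq_fst; lra]. }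
  assert (FK : hol_frame K (p - r) (p + r) (- r) r).
  { split; intros t Ht; split; apply HK; first [apply pair_neq_snd; lra|apply pair_neq_fst; lra]. }
  assert (EK : rect K (p - r) (p + r) (- r) r = (RtoC (2 * PI) * Ci * L)%C).
  { assert (SP : forall (f : R -> C) u v, (forall t, Rmin u v <= t <= Rmax u v -> continuousC f t) ->
       CInt (fun t => L * f t)%C u v = (L * CInt f u v)%C).
    { intros f u v Hf. apply CInt_unique, is_CInt_Cmult, is_CInt_CInt, Hf. }
    set (I1 := fun z => (/ (z - RtoC p))%C).
    assert (HI : forall z, z <> RtoC p -> hol I1 z).
    { intros z Hz. apply hol_inv.
      - apply hol_minus; [apply hol_id|apply hol_const].
      - intros E. apply Hz, Cminus_eq, E. }
    replace (RtoC (2 * PI) * Ci * L)%C with (L * (RtoC (2 * PI) * Ci))%C by ring.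
    rewrite <- (rect_inv_square p r Hr). unfold rect, K.
    rewrite (SP (fun x => I1 (x, (- r)%R))), (SP (fun x => I1 (x, r))),
      (SP (fun y => I1 ((p - r)%R, y))), (SP (fun y => I1 ((p + r)%R, y))).
    { unfold I1. ring. }
    all: intros t Ht; rewrite Rmin_left, Rmax_right in Ht by lra;
      (apply continuous_vline || apply continuous_hline); apply HI; first [apply pair_neq_snd; lra|apply pair_neq_fst; lra]. }
  rewrite <- EK, <- rect_minus by (auto; lra).
  assert (Bd : forall x y, p - r <= x <= p + r -> - r <= y <= r -> (Rabs (x - p) = r \/ Rabs y = r) ->
     Cmod (G (x, y) - K (x, y)) <= eps / r).
  { intros x y Hx Hy Hxy.
    assert (Hne : (x, y) <> RtoC p).
    { intros E. pose proof (f_equal fst E) as E1. pose proof (f_equal snd E) as E2. simpl in E1, E2. subst.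
      rewrite Rminus_diag, Rabs_R0 in Hxy. lra. }
    assert (Hz : ((x, y) - RtoC p)%C <> 0%C).
    { intros E. apply Hne, Cminus_eq, E. }
    assert (Hm : r <= Cmod ((x, y) - RtoC p)).
    { destruct Hxy as [E|E]; rewrite <- E.
      - apply (fst_le_Cmod ((x, y) - RtoC p)%C).
      - replace y with (snd ((x, y) - RtoC p)%C) at 1 by (simpl; ring). apply snd_le_Cmod. }
    destruct (H2 (x, y)) as [[H3 H4] H5].
    { eapply Rle_lt_trans; [apply Cmod_le_sum|]. simpl.
      apply Rle_lt_trans with (r + r); [|lra]. apply Rplus_le_compat; apply Rabs_le; lra. }
    rewrite Dp in H5.
    replace (G (x, y) - K (x, y))%C with ((N (x, y) / phi (x, y) - L) / ((x, y) - RtoC p))%C.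
    2:{ unfold G, K. rewrite H5. field. auto. }
    rewrite Cmod_div by auto. unfold Rdiv.
    apply Rmult_le_compat; [apply Cmod_ge_0|left; apply Rinv_0_lt_compat; lra|lra|].
    apply Rinv_le_contravar; lra. }
  eapply Rle_trans.
  - apply rect_bound_hol with (M1 := eps / r) (M2 := eps / r); try lra.
    + apply hol_frame_minus; assumption.
    + intros t Ht; split; apply Bd; try lra; right; [rewrite Rabs_Ropp|]; apply Rabs_pos_eq; lra.
    + intros t Ht; split; apply Bd; try lra; left.
      * replace (p - r - p) with (- r) by ring. rewrite Rabs_Ropp; apply Rabs_pos_eq; lra.
      * replace (p + r - p) with r by ring. apply Rabs_pos_eq; lra.
  - right. field. lra. }
assert (E0 : (rect G a b c d - RtoC (2 * PI) * Ci * L)%C = 0%C).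
{ apply Cmod_eq_0. apply Rle_antisym; [|apply Cmod_ge_0].
  apply Rle_plus_epsilon. intros e He. specialize (Main (e / 8)). lra. }
replace (rect G a b c d) with (rect G a b c d - RtoC (2 * PI) * Ci * L + RtoC (2 * PI) * Ci * L)%C by ring.
rewrite E0. ring.
Qed.

Fixpoint Csum (u : nat -> C) (n : nat) : C :=
  match n with O => 0%C | S n => (Csum u n + u n)%C end.

(** Induction on the number of poles, cutting off the rightmost one; [a] and [b] stay quantified
    since the right end moves. *)
Lemma residue_simple_poles (N D : C -> C) (c d : R) (p : nat -> R) (l : nat -> C) (n : nat) :
  forall a b, a <= b -> c < 0 < d ->
  (forall i, (i < n)%nat -> a < p i < b) ->
  (forall i, p i < p (S i)) ->
  hol_rect N a b c d -> hol_rect D a b c d ->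
  (forall x y, a <= x <= b -> c <= y <= d ->
     (forall i, (i < n)%nat -> (x, y) <> RtoC (p i)) -> D (x, y) <> 0%C) ->
  (forall i, (i < n)%nat -> D (RtoC (p i)) = 0%C /\ cderiv D (RtoC (p i)) (l i) /\ l i <> 0%C) ->
  rect (fun z => N z / D z)%C a b c d
    = (RtoC (2 * PI) * Ci * Csum (fun i => N (RtoC (p i)) / l i) n)%C.
Proof.
induction n as [|n IH]; intros a b Hab Hcd Hp Hinc HN HD HD0 Hl; simpl.
- rewrite goursat; [ring|lra|lra|]. intros x y Hx Hy. apply hol_div; auto.
  apply HD0; auto. intros i Hi; lia.
- assert (Hmono : forall i j, (i < j)%nat -> p i < p j).
  { intros i j H; induction H as [|j H IHj]; [apply Hinc|]. pose proof (Hinc j); lra. }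
  (* The cut lies halfway between the last pole and its predecessor, or the left side if there is
     none. *)
  assert (Hm : exists m, a < m < p n /\ forall i, (i < n)%nat -> p i < m).
  { pose proof (Hp n (Nat.lt_succ_diag_r n)). destruct n as [|n'].
    - exists ((a + p 0%nat) / 2). split; [lra|]. intros i Hi; lia.
    - exists ((p n' + p (S n')) / 2). pose proof (Hinc n'). pose proof (Hp n' ltac:(lia)).
      split; [lra|]. intros i Hi. destruct (Nat.eq_dec i n') as [->|Ne]; [lra|].
      pose proof (Hmono i n' ltac:(lia)). lra. }
  destruct Hm as [m [Hm1 Hm2]]. pose proof (Hp n (Nat.lt_succ_diag_r n)) as Hpn.
  rewrite (rect_split_v _ a m b); try lra.
  2,3: intros t Ht; apply (continuous_hline (fun z => N z / D z)%C), hol_div;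
    [apply HN; lra|apply HD; lra|apply HD0; try lra; intros i _; apply pair_neq_snd; lra].
  rewrite (IH a m); try lra.
  + rewrite (residue_simple_pole N D m b c d (p n) (l n)); try lra; try apply Hl; try lia.
    * ring.
    * intros x y Hx Hy; apply HN; lra.
    * intros x y Hx Hy; apply HD; lra.
    * intros x y Hx Hy Hne. apply HD0; try lra. intros i Hi.
      destruct (Nat.eq_dec i n) as [->|Ne]; auto. apply pair_neq_fst. pose proof (Hm2 i ltac:(lia)). lra.
  + intros i Hi. pose proof (Hp i ltac:(lia)). pose proof (Hm2 i Hi). lra.
  + exact Hinc.
  + intros x y Hx Hy; apply HN; lra.
  + intros x y Hx Hy; apply HD; lra.
  + intros x y Hx Hy Hne. apply HD0; try lra. intros i Hi.
    destruct (Nat.eq_dec i n) as [->|Ne]; [apply pair_neq_fst; lra|apply Hne; lia].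
  + intros i Hi; apply Hl; lia.
Qed.

(** * Sinc interpolation *)

(** Real and imaginary parts are given explicitly, so that the modulus is immediate; the exponential
    form, needed for the derivative, is recovered in [Csin_Cexp]. *)
Definition Csin (z : C) : C := (sin (fst z) * cosh (snd z), cos (fst z) * sinh (snd z)).
Definition Ccos (z : C) : C := (cos (fst z) * cosh (snd z), - (sin (fst z) * sinh (snd z))).

Lemma Csin_Cexp z : Csin z = ((Cexp (Ci * z) - Cexp (- (Ci * z))) * / (2 * Ci))%C.
Proof.
destruct z as [x y]. apply C_ext; unfold Csin, Cexp, cosh, sinh; simpl;
 rewrite !Rmult_0_l, !Rmult_1_l, ?Rplus_0_l, ?Rplus_0_r, ?Rminus_0_l, ?Ropp_involutive, ?cos_neg, ?sin_neg; field.
Qed.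

Lemma Ccos_Cexp z : Ccos z = ((Cexp (Ci * z) + Cexp (- (Ci * z))) * / 2)%C.
Proof.
destruct z as [x y]. apply C_ext; unfold Ccos, Cexp, cosh, sinh; simpl;
 rewrite !Rmult_0_l, !Rmult_1_l, ?Rplus_0_l, ?Rplus_0_r, ?Rminus_0_l, ?Ropp_involutive, ?cos_neg, ?sin_neg; field.
Qed.

Lemma Ci_neq_0 : Ci <> 0%C.
Proof. intros E. apply (f_equal snd) in E. simpl in E. lra. Qed.

Lemma cderiv_scale (c z : C) : cderiv (fun w => c * w)%C z c.
Proof. eapply cderiv_eq; [apply cderiv_mult; [apply cderiv_const|apply cderiv_id]|cbv beta; ring]. Qed.

Lemma cderiv_opp f z l : cderiv f z l -> cderiv (fun w => - f w)%C z (- l)%C.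
Proof.
intros H. apply (cderiv_ext (fun w => RtoC (-1) * f w)%C); [intros; ring|].
eapply cderiv_eq; [apply cderiv_mult; [apply cderiv_const|exact H]|cbv beta; ring].
Qed.

Lemma cderiv_Csin z : cderiv Csin z (Ccos z).
Proof.
apply (cderiv_ext (fun w => (Cexp (Ci * w) - Cexp (- (Ci * w))) * / (2 * Ci))%C).
{ intros w; symmetry; apply Csin_Cexp. }
eapply cderiv_eq.
- apply cderiv_mult; [|apply cderiv_const]. apply cderiv_plus.
  + apply (cderiv_comp Cexp (fun w => Ci * w)%C); [apply cderiv_Cexp|apply cderiv_scale].
  + apply cderiv_opp. apply (cderiv_comp Cexp (fun w => - (Ci * w))%C); [apply cderiv_Cexp|].
    apply cderiv_opp, cderiv_scale.
- cbv beta. rewrite Ccos_Cexp. field. apply Ci_neq_0.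
Qed.

Lemma cosh_sqr y : cosh y ^ 2 = 1 + sinh y ^ 2.
Proof.
unfold cosh, sinh. assert (H : exp y * exp (- y) = 1) by (rewrite <- exp_plus, Rplus_opp_r; apply exp_0).
nra.
Qed.

Lemma Cmod_Csin_sqr x y : Cmod (Csin (x, y)) ^ 2 = sin x ^ 2 + sinh y ^ 2.
Proof.
rewrite Cmod2_alt. unfold Csin, Re, Im; simpl fst; simpl snd.
rewrite !Rpow_mult_distr, cosh_sqr.
pose proof (sin2_cos2 x) as H. unfold Rsqr in H. nra.
Qed.

Lemma sinh_pos y : 0 < y -> 0 < sinh y.
Proof. intros H. rewrite <- sinh_0. apply sinh_lt, H. Qed.

Lemma sinh_opp y : sinh (- y) = - sinh y.
Proof. unfold sinh. rewrite Ropp_involutive. field. Qed.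

Lemma cosh_opp y : cosh (- y) = cosh y.
Proof. unfold cosh. rewrite Ropp_involutive. field. Qed.

Lemma sinh_neq_0 y : y <> 0 -> sinh y <> 0.
Proof.
intros H. destruct (Rtotal_order y 0) as [L|[E|L]]; try tauto.
- pose proof (sinh_pos (- y) ltac:(lra)). rewrite sinh_opp in *. lra.
- pose proof (sinh_pos y L). lra.
Qed.

Lemma Csin_eq_0 x y : Csin (x, y) = 0%C -> sin x = 0 /\ y = 0.
Proof.
intros E. pose proof (Cmod_Csin_sqr x y) as H. rewrite E, Cmod_0 in H.
pose proof (pow2_ge_0 (sin x)). pose proof (pow2_ge_0 (sinh y)).
split.
- apply Rsqr_0_uniq. unfold Rsqr. nra.
- apply NNPP; intros N. apply (sinh_neq_0 y N). apply Rsqr_0_uniq. unfold Rsqr. nra.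
Qed.

Lemma Cmod_Csin_ge_sinh x y : Rabs (sinh y) <= Cmod (Csin (x, y)).
Proof.
apply Rsqr_incr_0_var; [|apply Cmod_ge_0]. rewrite <- Rsqr_abs. rewrite !Rsqr_pow2, Cmod_Csin_sqr.
pose proof (pow2_ge_0 (sin x)). lra.
Qed.

Lemma Cmod_Csin_ge_sin x y : Rabs (sin x) <= Cmod (Csin (x, y)).
Proof.
apply Rsqr_incr_0_var; [|apply Cmod_ge_0]. rewrite <- Rsqr_abs. rewrite !Rsqr_pow2, Cmod_Csin_sqr.
pose proof (pow2_ge_0 (sinh y)). lra.
Qed.

Definition grid_sin (h : R) (z : C) : C := Csin (RtoC (PI / h) * z)%C.
(** The index is shifted: [i = 0, ..., 2 P] runs through the grid points from [- P h] to [P h]. *)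
Definition node (h : R) (P i : nat) : R := (INR i - INR P) * h.
Definition kernel_den (h x : R) (z : C) : C := ((z - RtoC x) * grid_sin h z)%C.

Lemma grid_sin_pair h x y : grid_sin h (x, y) = Csin (PI / h * x, PI / h * y).
Proof. unfold grid_sin. f_equal. apply C_ext; simpl; ring. Qed.

Lemma grid_sin_real h x : grid_sin h (RtoC x) = RtoC (sin (PI / h * x)).
Proof.
unfold RtoC at 1. rewrite grid_sin_pair. apply C_ext; simpl; rewrite Rmult_0_r, ?cosh_0, ?sinh_0; ring.
Qed.

Lemma cderiv_grid_sin h z : cderiv (grid_sin h) z (Ccos (RtoC (PI / h) * z) * RtoC (PI / h))%C.
Proof.
apply (cderiv_comp Csin (fun w => RtoC (PI / h) * w)%C); [apply cderiv_Csin|apply cderiv_scale].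
Qed.

Lemma cderiv_kernel_den h x z :
  cderiv (kernel_den h x) z
    (grid_sin h z + (z - RtoC x) * (Ccos (RtoC (PI / h) * z) * RtoC (PI / h)))%C.
Proof.
eapply cderiv_eq.
- apply cderiv_mult; [|apply cderiv_grid_sin].
  apply cderiv_plus; [apply cderiv_id|apply cderiv_const].
- cbv beta. ring.
Qed.

Lemma Ccos_real h x : Ccos (RtoC (PI / h) * RtoC x) = RtoC (cos (PI / h * x)).
Proof.
rewrite <- RtoC_mult. unfold Ccos; simpl. rewrite cosh_0, sinh_0. apply C_ext; simpl; ring.
Qed.

Lemma sin_node h P i : 0 < h -> sin (PI / h * node h P i) = 0.
Proof.
intros Hh. apply sin_eq_0_1. exists (Z.of_nat i - Z.of_nat P)%Z.
rewrite minus_IZR, <- !INR_IZR_INZ. unfold node. field. lra.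
Qed.

Lemma cos_node_neq_0 h P i : 0 < h -> cos (PI / h * node h P i) <> 0.
Proof.
intros Hh E. pose proof (sin2_cos2 (PI / h * node h P i)) as H.
rewrite E, sin_node in H by auto. unfold Rsqr in H. lra.
Qed.

Lemma sin_eq_0_node h P x : 0 < h -> Rabs x < (INR P + 1 / 2) * h -> sin (PI / h * x) = 0 ->
  exists i, (i < 2 * P + 1)%nat /\ x = node h P i.
Proof.
intros Hh Hx H. apply sin_eq_0_0 in H. destruct H as [k Hk].
assert (Ex : x = IZR k * h).
{ apply (Rmult_eq_reg_l (PI / h)).
  - rewrite Hk. field. lra.
  - apply Rgt_not_eq. apply Rdiv_lt_0_compat; [apply PI_RGT_0|lra]. }
apply Rabs_def2 in Hx. rewrite Ex in Hx. destruct Hx as [H1 H2].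
assert (B1 : IZR k < INR P + 1 / 2) by (apply (Rmult_lt_reg_r h); lra).
assert (B2 : - (INR P + 1 / 2) < IZR k) by (apply (Rmult_lt_reg_r h); lra).
rewrite INR_IZR_INZ in B1, B2.
assert (C1 : (k <= Z.of_nat P)%Z).
{ apply Z.lt_succ_r. apply lt_IZR. rewrite succ_IZR. lra. }
assert (C2 : (- Z.of_nat P <= k)%Z).
{ apply Z.lt_succ_r. apply lt_IZR. rewrite succ_IZR, opp_IZR. lra. }
exists (Z.to_nat (k + Z.of_nat P)). split; [lia|].
unfold node. rewrite Ex, !INR_IZR_INZ. rewrite Z2Nat.id by lia. rewrite plus_IZR. ring.
Qed.

Lemma kernel_den_neq_0 h P x u v : 0 < h -> Rabs u <= (INR P + 1 / 2) * h ->
  (u, v) <> RtoC x -> (forall i, (i < 2 * P + 1)%nat -> (u, v) <> RtoC (node h P i)) ->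
  kernel_den h x (u, v) <> 0%C.
Proof.
intros Hh Hu Hx Hn. apply Cmult_neq_0.
- intros E. apply Hx, Cminus_eq, E.
- rewrite grid_sin_pair. intros E. apply Csin_eq_0 in E. destruct E as [E1 E2].
  assert (Hp : PI / h <> 0) by (apply Rgt_not_eq, Rdiv_lt_0_compat; [apply PI_RGT_0|lra]).
  assert (v = 0) by (apply Rmult_integral in E2; tauto). subst v.
  destruct Hu as [Hu|Hu].
  + destruct (sin_eq_0_node h P u Hh Hu E1) as [i [Hi Ei]]. apply (Hn i Hi). rewrite Ei; reflexivity.
  (* On the vertical sides, halfway between grid points, the cosine vanishes, so the sine does
     not. *)
  + assert (E3 : cos (PI / h * u) = 0).
    { assert (Eu : u = (INR P + 1 / 2) * h \/ u = - ((INR P + 1 / 2) * h)).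
      { unfold Rabs in Hu. destruct (Rcase_abs u); lra. }
      apply cos_eq_0_1. destruct Eu as [-> | ->].
      - exists (Z.of_nat P). rewrite <- INR_IZR_INZ. field. lra.
      - exists (- Z.of_nat P - 1)%Z. rewrite minus_IZR, opp_IZR, <- INR_IZR_INZ. field. lra. }
    pose proof (sin2_cos2 (PI / h * u)) as H. rewrite E1, E3 in H. unfold Rsqr in H. lra.
Qed.

Lemma Csum_ext u v n : (forall i, (i < n)%nat -> u i = v i) -> Csum u n = Csum v n.
Proof.
induction n as [|n IH]; intros H; simpl; [reflexivity|].
rewrite IH, H; auto.
Qed.

Lemma Csum_split u n m : Csum u (n + m) = (Csum u n + Csum (fun i => u (n + i)%nat) m)%C.
Proof.
induction m as [|m IH]; [rewrite Nat.add_0_r; simpl; ring|].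
rewrite Nat.add_succ_r. simpl. rewrite IH. ring.
Qed.

Lemma Csum_mult_l c u n : Csum (fun i => c * u i)%C n = (c * Csum u n)%C.
Proof. induction n as [|n IH]; simpl; [ring|]. rewrite IH. ring. Qed.

Lemma Csum_opp u n : Csum (fun i => - u i)%C n = (- Csum u n)%C.
Proof. induction n as [|n IH]; simpl; [ring|]. rewrite IH. ring. Qed.

Lemma Csum_single (u : nat -> C) n j : (j < n)%nat -> (forall i, (i < n)%nat -> i <> j -> u i = 0%C) -> Csum u n = u j.
Proof.
induction n as [|n IH]; intros Hj H; [lia|]. simpl.
destruct (Nat.eq_dec j n) as [->|Ne].
- assert (E : Csum u n = 0%C).
  { assert (Z : forall m, (m <= n)%nat -> Csum u m = 0%C).
    { induction m as [|m IHm]; intros Hm; simpl; [reflexivity|]. rewrite IHm, H by lia. ring. }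
    apply Z; lia. }
  rewrite E. ring.
- rewrite IH by (auto; lia || intros; apply H; lia). rewrite (H n) by lia. ring.
Qed.

(** The poles are the nodes and [x], with residues of different form. The rectangle is cut just left
    and just right of [x], which gives two runs of nodes and the single pole [x]. *)
Lemma rect_kernel (F : C -> C) (h d x : R) (P : nat) :
  0 < h -> 0 < d -> Rabs x < (INR P + 1 / 2) * h ->
  (forall i, (i < 2 * P + 1)%nat -> x <> node h P i) ->
  hol_rect F (- ((INR P + 1 / 2) * h)) ((INR P + 1 / 2) * h) (- d) d ->
  rect (fun z => F z / kernel_den h x z)%C (- ((INR P + 1 / 2) * h)) ((INR P + 1 / 2) * h) (- d) d =
  (RtoC (2 * PI) * Ci *
    (F (RtoC x) / RtoC (sin (PI / h * x)) +
     Csum (fun i => F (RtoC (node h P i)) /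
        (RtoC ((node h P i - x) * (cos (PI / h * node h P i) * (PI / h))))) (2 * P + 1)))%C.
Proof.
intros Hh Hd Hx Hn HF. set (T := (INR P + 1 / 2) * h) in *.
assert (HD : forall z, hol (kernel_den h x) z) by (intros z; eexists; apply cderiv_kernel_den).
(* [k] counts the nodes to the left of [x], as [up r] satisfies [r < up r <= r + 1] and [x] is not a
   node. *)
destruct (archimed (x / h + INR P)) as [A1 A2]. set (k := up (x / h + INR P)) in *.
pose proof (Rabs_def2 _ _ Hx) as [X1 X2].
assert (X3 : - (INR P + 1 / 2) < x / h < INR P + 1 / 2).
{ split; apply (Rmult_lt_reg_r h); auto; unfold Rdiv; rewrite (Rmult_assoc x), Rinv_l, Rmult_1_r by lra;
  fold T; unfold T in *; lra. }
assert (K0 : (0 <= k)%Z). { apply Z.lt_succ_r, lt_IZR. rewrite succ_IZR. lra. }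
assert (K1 : (k <= 2 * Z.of_nat P + 1)%Z).
{ apply Z.lt_succ_r, lt_IZR. rewrite succ_IZR, plus_IZR, mult_IZR, <- INR_IZR_INZ. lra. }
set (i0 := Z.to_nat k). assert (Ei0 : INR i0 = IZR k) by (unfold i0; rewrite INR_IZR_INZ, Z2Nat.id; auto).
assert (Hi0 : (i0 <= 2 * P + 1)%nat) by (unfold i0; lia).
assert (Exh : x = x / h * h) by (field; lra).
assert (Hleft : forall i, (i < i0)%nat -> node h P i < x).
{ intros i Hi. assert (H1 : node h P i <= x).
  { unfold node. rewrite Exh. apply Rmult_le_compat_r; [lra|].
    assert (INR (S i) <= INR i0) by (apply le_INR; lia). rewrite S_INR in *. lra. }
  specialize (Hn i ltac:(lia)). lra. }
assert (Hright : forall i, (i0 <= i)%nat -> x < node h P i).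
{ intros i Hi. unfold node. rewrite Exh. apply Rmult_lt_compat_r; [lra|].
  assert (INR i0 <= INR i) by (apply le_INR; lia). lra. }
assert (Hrange : forall i, (i < 2 * P + 1)%nat -> - T < node h P i < T).
{ intros i Hi. unfold node, T. assert (INR i <= 2 * INR P).
  { replace (2 * INR P) with (INR (2 * P)) by (rewrite mult_INR; reflexivity). apply le_INR; lia. }
  pose proof (pos_INR i). split; [rewrite Ropp_mult_distr_l|]; apply Rmult_lt_compat_r; lra. }
assert (Hinc : forall i, node h P i < node h P (S i)).
{ intros i. unfold node. rewrite S_INR. apply Rmult_lt_compat_r; lra. }
assert (Hmono : forall i j, (i <= j)%nat -> node h P i <= node h P j).
{ intros i j H; induction H as [|j H IHj]; [lra|]. pose proof (Hinc j); lra. }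
assert (M1 : exists m1, - T < m1 < x /\ forall i, (i < i0)%nat -> node h P i < m1).
{ destruct (Nat.eq_dec i0 0) as [E|E].
  - exists ((- T + x) / 2). split; [lra|]. intros i Hi; lia.
  - exists ((node h P (i0 - 1) + x) / 2). pose proof (Hleft (i0 - 1)%nat ltac:(lia)).
    pose proof (Hrange (i0 - 1)%nat ltac:(lia)). split; [lra|].
    intros i Hi. pose proof (Hmono i (i0 - 1)%nat ltac:(lia)). lra. }
assert (M2 : exists m2, x < m2 < T /\ forall i, (i0 <= i)%nat -> (i < 2 * P + 1)%nat -> m2 < node h P i).
{ destruct (Nat.eq_dec i0 (2 * P + 1)) as [E|E].
  - exists ((T + x) / 2). split; [lra|]. intros i Hi; lia.
  - exists ((node h P i0 + x) / 2). pose proof (Hright i0 ltac:(lia)).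
    pose proof (Hrange i0 ltac:(lia)). split; [lra|].
    intros i Hi _. pose proof (Hmono i0 i ltac:(lia)). lra. }
destruct M1 as [m1 [Hm1 Hm1']]. destruct M2 as [m2 [Hm2 Hm2']].
assert (NZ : forall u v, - T <= u <= T -> (u, v) <> RtoC x ->
  (forall i, (i < 2 * P + 1)%nat -> (u, v) <> RtoC (node h P i)) -> kernel_den h x (u, v) <> 0%C).
{ intros u v Hu Hux Hun. apply (kernel_den_neq_0 h P); auto. apply Rabs_le; fold T; lra. }
assert (HG : forall u v, - T <= u <= T -> - d <= v <= d -> v <> 0 -> hol (fun z => F z / kernel_den h x z)%C (u, v)).
{ intros u v Hu Hv Hv0. apply hol_div; auto using pair_neq_snd. }
assert (Dl : forall p, sin (PI / h * p) = 0 ->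
   cderiv (kernel_den h x) (RtoC p) (RtoC ((p - x) * (cos (PI / h * p) * (PI / h))))).
{ intros p Hp. eapply cderiv_eq; [apply cderiv_kernel_den|].
  rewrite grid_sin_real, Hp, Ccos_real, !RtoC_mult, RtoC_minus. ring. }
assert (Hpi : PI / h <> 0) by (apply Rgt_not_eq, Rdiv_lt_0_compat; [apply PI_RGT_0|lra]).
rewrite (rect_split_v _ (- T) m1 T); try lra.
2,3: intros t Ht; apply (continuous_hline (fun z => F z / kernel_den h x z)%C), HG; lra.
rewrite (rect_split_v _ m1 m2 T); try lra.
2,3: intros t Ht; apply (continuous_hline (fun z => F z / kernel_den h x z)%C), HG; lra.
rewrite (residue_simple_poles F (kernel_den h x) (- d) d (node h P)
   (fun i => RtoC ((node h P i - x) * (cos (PI / h * node h P i) * (PI / h)))) i0 (- T) m1).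
- rewrite (residue_simple_pole F (kernel_den h x) m1 m2 (- d) d x (RtoC (sin (PI / h * x)))).
  + rewrite (residue_simple_poles F (kernel_den h x) (- d) d (fun i => node h P (i0 + i))
     (fun i => RtoC ((node h P (i0 + i) - x) * (cos (PI / h * node h P (i0 + i)) * (PI / h))))
     (2 * P + 1 - i0) m2 T).
    * replace (2 * P + 1)%nat with (i0 + (2 * P + 1 - i0))%nat at 2 by lia.
      rewrite Csum_split. ring.
    * lra.
    * lra.
    * intros i Hi. pose proof (Hrange (i0 + i)%nat ltac:(lia)). pose proof (Hm2' (i0 + i)%nat ltac:(lia) ltac:(lia)). lra.
    * intros i. rewrite Nat.add_succ_r. apply Hinc.
    * intros u v Hu Hv; apply HF; lra.
    * intros u v _ _; apply HD.
    * intros u v Hu Hv Hne. apply NZ; [lra|apply pair_neq_fst; lra|].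
      intros i Hi. destruct (le_lt_dec i0 i) as [L|L].
      -- replace i with (i0 + (i - i0))%nat by lia. apply Hne; lia.
      -- apply pair_neq_fst. pose proof (Hleft i L). lra.
    * intros i Hi. split; [|split; [apply Dl, sin_node, Hh|]].
      -- unfold kernel_den. rewrite grid_sin_real, sin_node by auto. ring.
      -- intros E. apply RtoC_inj in E. pose proof (Hright (i0 + i)%nat ltac:(lia)).
         pose proof (cos_node_neq_0 h P (i0 + i) Hh).
         apply Rmult_integral in E. destruct E as [E|E]; [lra|]. apply Rmult_integral in E. tauto.
  + lra.
  + lra.
  + intros u v Hu Hv; apply HF; lra.
  + intros u v _ _; apply HD.
  + intros u v Hu Hv Hne. apply NZ; [lra|exact Hne|].
    intros i Hi. apply pair_neq_fst. destruct (le_lt_dec i0 i) as [L|L].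
    * pose proof (Hm2' i L Hi). lra.
    * pose proof (Hm1' i L). lra.
  + unfold kernel_den. ring.
  + eapply cderiv_eq; [apply cderiv_kernel_den|]. rewrite grid_sin_real. ring.
  + intros E. apply RtoC_inj in E. destruct (sin_eq_0_node h P x Hh Hx E) as [i [Hi Ei]]. apply (Hn i Hi Ei).
- lra.
- lra.
- intros i Hi. pose proof (Hrange i ltac:(lia)). pose proof (Hm1' i Hi). lra.
- exact Hinc.
- intros u v Hu Hv; apply HF; lra.
- intros u v _ _; apply HD.
- intros u v Hu Hv Hne. apply NZ; [lra|apply pair_neq_fst; lra|].
  intros i Hi. destruct (le_lt_dec i0 i) as [L|L].
  + apply pair_neq_fst. pose proof (Hright i L). lra.
  + apply Hne; lia.
- intros i Hi. split; [|split; [apply Dl, sin_node, Hh|]].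
  + unfold kernel_den. rewrite grid_sin_real, sin_node by auto. ring.
  + intros E. apply RtoC_inj in E. pose proof (Hleft i Hi).
    pose proof (cos_node_neq_0 h P i Hh).
    apply Rmult_integral in E. destruct E as [E|E]; [lra|]. apply Rmult_integral in E. tauto.
Qed.

Definition sinc_sum (F : C -> C) (h : R) (P : nat) (x : R) : C :=
  Csum (fun i => F (RtoC (node h P i)) * RtoC (sinc (PI * (x / h - (INR i - INR P)))))%C (2 * P + 1).

Lemma sinc_neq_0 s : s <> 0 -> sinc s = sin s / s.
Proof. intros H. unfold sinc. destruct (Req_EM_T s 0); tauto. Qed.

(** At a grid point both sides vanish, since the sum collapses to its term at [x]. Elsewhere
    [sin (PI x / h)] times the residue at a node is minus the corresponding sinc term. *)
Lemma sinc_interpolation (F : C -> C) (h d x : R) (P : nat) :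
  0 < h -> 0 < d -> Rabs x < (INR P + 1 / 2) * h ->
  hol_rect F (- ((INR P + 1 / 2) * h)) ((INR P + 1 / 2) * h) (- d) d ->
  (F (RtoC x) - sinc_sum F h P x)%C =
  (RtoC (sin (PI / h * x)) * / (RtoC (2 * PI) * Ci) *
   rect (fun z => F z / kernel_den h x z) (- ((INR P + 1 / 2) * h)) ((INR P + 1 / 2) * h) (- d) d)%C.
Proof.
intros Hh Hd Hx HF. pose proof PI_RGT_0 as Hpi.
destruct (Req_dec (sin (PI / h * x)) 0) as [E|E].
- rewrite E. destruct (sin_eq_0_node h P x Hh Hx E) as [j [Hj Ej]].
  unfold sinc_sum. rewrite (Csum_single _ _ j Hj).
  + replace (PI * (x / h - (INR j - INR P))) with 0 by (rewrite Ej; unfold node; field; lra).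
    unfold sinc. destruct (Req_EM_T 0 0) as [_|N]; [|tauto]. rewrite <- Ej. ring.
  + intros i Hi Hij. rewrite sinc_neq_0.
    * replace (sin (PI * (x / h - (INR i - INR P)))) with 0; [unfold Rdiv; rewrite Rmult_0_l; ring|].
      symmetry. apply sin_eq_0_1. exists (Z.of_nat j - Z.of_nat i)%Z.
      rewrite minus_IZR, <- !INR_IZR_INZ, Ej. unfold node. field. lra.
    * rewrite Ej. unfold node. replace ((INR j - INR P) * h / h - (INR i - INR P)) with (INR j - INR i) by (field; lra).
      intros E1. apply Rmult_integral in E1. destruct E1 as [E1|E1]; [lra|].
      apply Hij, INR_eq. lra.
- assert (Hn : forall i, (i < 2 * P + 1)%nat -> x <> node h P i).
  { intros i _ Ex. apply E. rewrite Ex. apply sin_node, Hh. }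
  rewrite (rect_kernel F h d x P Hh Hd Hx Hn HF).
  set (s := sin (PI / h * x)) in *.
  assert (Hs : RtoC s <> 0%C) by (intros E'; apply RtoC_inj in E'; auto).
  assert (H2 : (RtoC (2 * PI) * Ci)%C <> 0%C).
  { apply Cmult_neq_0; [|apply Ci_neq_0]. intros E'. apply RtoC_inj in E'. lra. }
  transitivity (F (RtoC x) + RtoC s * Csum (fun i => F (RtoC (node h P i)) /
        (RtoC ((node h P i - x) * (cos (PI / h * node h P i) * (PI / h))))) (2 * P + 1))%C.
  2:{ field. repeat split; auto; [apply Ci_neq_0|]. intros E'. apply RtoC_inj in E'. lra. }
  unfold Cminus. f_equal. unfold sinc_sum. rewrite <- Csum_opp, <- Csum_mult_l. apply Csum_ext.
  intros i Hi. set (p := node h P i). specialize (Hn i Hi). fold p in Hn.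
  assert (Es : PI * (x / h - (INR i - INR P)) = PI / h * x - PI / h * p).
  { unfold p, node. field. lra. }
  assert (Hc : cos (PI / h * p) <> 0) by (apply cos_node_neq_0, Hh).
  assert (H0 : PI / h * x - PI / h * p <> 0).
  { rewrite <- Rmult_minus_distr_l. apply Rmult_integral_contrapositive. split; [|lra].
    apply Rgt_not_eq, Rdiv_lt_0_compat; lra. }
  assert (Hsinp : sin (PI / h * p) = 0) by (apply sin_node, Hh).
  rewrite Es, sinc_neq_0 by auto. rewrite sin_minus, Hsinp. fold s.
  (* The residue has this cosine in the denominator, the addition formula for the sine has it in the
     numerator; being 1 or -1, it is its own inverse. *)
  assert (Hc1 : cos (PI / h * p) * cos (PI / h * p) = 1).
  { pose proof (sin2_cos2 (PI / h * p)) as H. rewrite Hsinp in H. unfold Rsqr in H. lra. }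
  replace ((s * cos (PI / h * p) - cos (PI / h * x) * 0) / (PI / h * x - PI / h * p))
    with (- (s / ((p - x) * (cos (PI / h * p) * (PI / h))))).
  + unfold Rdiv at 1. unfold Cdiv. rewrite RtoC_opp, RtoC_mult, RtoC_inv; [ring|].
    apply Rmult_integral_contrapositive; split; [lra|].
    apply Rmult_integral_contrapositive; split; [exact Hc|].
    apply Rgt_not_eq, Rdiv_lt_0_compat; lra.
  + replace (s * cos (PI / h * p) - cos (PI / h * x) * 0) with (s / cos (PI / h * p)).
    * field. repeat split; try lra. intros E0; apply H0. rewrite <- Rmult_minus_distr_l.
      replace (x - p) with 0; [ring|]. apply (Rmult_eq_reg_l PI); lra.
    * apply (Rmult_eq_reg_r (cos (PI / h * p))); [|exact Hc].
      unfold Rdiv. rewrite Rmult_assoc, Rinv_l by exact Hc. nra.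
Qed.

(** * The sine integral *)

Lemma continuous_sinc x : continuous sinc x.
Proof.
destruct (Req_dec x 0) as [->|Hx].
- apply continuity_pt_filterlim. intros eps Heps.
  destruct (is_derive_eps sin 0 (cos 0) (is_derive_sin 0) (eps / 2)) as [d [Hd H]]; [lra|].
  exists d; split; [exact Hd|]. intros y [[_ Hy] Hyd]. simpl in *. unfold Rdist in *.
  unfold sinc at 2. destruct (Req_EM_T 0 0) as [_|N]; [|tauto].
  rewrite sinc_neq_0 by auto. specialize (H y Hyd). rewrite sin_0, cos_0, !Rminus_0_r, Rmult_1_l in H.
  replace (sin y / y - 1) with ((sin y - y) / y) by (field; auto).
  unfold Rdiv. rewrite Rabs_mult, Rabs_inv.
  assert (0 < Rabs y) by (apply Rabs_pos_lt; auto).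
  apply Rle_lt_trans with (eps / 2); [|lra].
  apply (Rmult_le_reg_r (Rabs y)); auto. rewrite Rmult_assoc, Rinv_l, Rmult_1_r by lra. exact H.
- apply (continuous_ext_loc _ (fun s => sin s / s)).
  + exists (mkposreal _ (Rabs_pos_lt _ Hx)). intros y Hy. symmetry; apply sinc_neq_0.
    intros ->. unfold ball in Hy; simpl in Hy. unfold AbsRing_ball, abs, minus, plus, opp in Hy; simpl in Hy.
    rewrite Rplus_0_l, Rabs_Ropp in Hy. lra.
  + apply continuity_pt_filterlim. reg.
Qed.

Lemma ex_RInt_sinc a b : ex_RInt sinc a b.
Proof. apply (ex_RInt_continuous (V := R_CompleteNormedModule)). intros; apply continuous_sinc. Qed.

Lemma is_RInt_sinc a b : is_RInt sinc a b (Si b - Si a).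
Proof.
replace (Si b - Si a) with (plus (G := R_NormedModule) (opp (Si a)) (Si b))
  by (unfold plus, opp; simpl; ring).
apply (is_RInt_Chasles (V := R_NormedModule) sinc a 0 b).
- apply (is_RInt_swap (V := R_NormedModule)). apply (RInt_correct (V := R_CompleteNormedModule)), ex_RInt_sinc.
- apply (RInt_correct (V := R_CompleteNormedModule)), ex_RInt_sinc.
Qed.

Lemma is_derive_Si x : is_derive Si x (sinc x).
Proof.
apply (is_derive_RInt (V := R_NormedModule) sinc Si 0).
- apply filter_forall. intros y. apply (RInt_correct (V := R_CompleteNormedModule)), ex_RInt_sinc.
- apply continuous_sinc.
Qed.

Lemma sinc_opp x : sinc (- x) = sinc x.
Proof.
destruct (Req_dec x 0) as [->|H]; [rewrite Ropp_0; reflexivity|].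
rewrite !sinc_neq_0 by lra. rewrite sin_neg. field. auto.
Qed.

Lemma Si_opp x : Si (- x) = - Si x.
Proof.
unfold Si. generalize (is_RInt_comp_opp (V := R_NormedModule) sinc 0 x (Si (- x))).
intros H. assert (H0 : is_RInt sinc (- 0) (- x) (Si (- x))).
{ rewrite Ropp_0. apply (RInt_correct (V := R_CompleteNormedModule)), ex_RInt_sinc. }
specialize (H H0). apply (is_RInt_unique (V := R_CompleteNormedModule)) in H.
assert (E : RInt (fun y => opp (sinc (- y))) 0 x = - RInt sinc 0 x).
{ rewrite <- (RInt_opp (V := R_CompleteNormedModule)) by apply ex_RInt_sinc.
  apply (RInt_ext (V := R_CompleteNormedModule)). intros y _. rewrite sinc_opp. reflexivity. }
exact (eq_trans (eq_sym H) E).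
Qed.

Lemma cos_div_bound x r : 0 < r -> Rabs (cos x / r) <= / r.
Proof.
intros Hr. assert (0 < / r) by (apply Rinv_0_lt_compat, Hr).
unfold Rdiv. rewrite Rabs_mult, (Rabs_pos_eq (/ r)) by lra.
rewrite <- (Rmult_1_l (/ r)) at 2. apply Rmult_le_compat_r; [lra|]. apply Rabs_le, COS_bound.
Qed.

(** By parts, [sin s / s] integrates to boundary terms minus the integral of [cos s / s ^ 2]; the
    bounds [1/a], [1/b] and [1/a - 1/b] add up to [2/a]. *)
Lemma Si_tail a b : 0 < a <= b -> Rabs (Si b - Si a) <= 2 / a.
Proof.
intros [Ha Hab].
assert (H1 : is_RInt (fun s => sinc s + cos s / s ^ 2) a b (- cos b / b - - cos a / a)).
{ apply (is_RInt_ext (V := R_NormedModule) (fun s => sin s / s + cos s / s ^ 2)).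
  { intros s Hs. rewrite Rmin_left in Hs by lra. rewrite sinc_neq_0 by lra. reflexivity. }
  apply (is_RInt_derive (V := R_CompleteNormedModule) (fun s => - cos s / s)).
  - intros s Hs. rewrite Rmin_left in Hs by lra. auto_derive; [lra|]. field. lra.
  - intros s Hs. rewrite Rmin_left in Hs by lra. apply continuity_pt_filterlim. reg; try lra. nra. }
assert (H2 : is_RInt (fun s => cos s / s ^ 2) a b (- cos b / b - - cos a / a - (Si b - Si a))).
{ generalize (is_RInt_minus (V := R_NormedModule) _ _ _ _ _ _ H1 (is_RInt_sinc a b)).
  apply (is_RInt_ext (V := R_NormedModule)). intros s _. unfold minus, plus, opp; simpl. ring. }
assert (H3 : is_RInt (fun s => / s ^ 2) a b (- / b - - / a)).
{ apply (is_RInt_derive (V := R_CompleteNormedModule) (fun s => - / s)).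
  - intros s Hs. rewrite Rmin_left in Hs by lra. auto_derive; [lra|]. field. lra.
  - intros s Hs. rewrite Rmin_left in Hs by lra. apply continuity_pt_filterlim. reg. nra. }
assert (H4 : Rabs (- cos b / b - - cos a / a - (Si b - Si a)) <= - / b - - / a).
{ apply (norm_RInt_le (V := R_NormedModule) (fun s => cos s / s ^ 2) (fun s => / s ^ 2) a b); auto.
  intros s Hs. unfold norm; simpl. apply (cos_div_bound s (s ^ 2)). nra. }
pose proof (cos_div_bound b b ltac:(lra)) as B1. pose proof (cos_div_bound a a ltac:(lra)) as B2.
apply Rabs_le_between in H4. apply Rabs_le_between in B1. apply Rabs_le_between in B2.
apply Rabs_le. unfold Rdiv in *. lra.
Qed.

Lemma is_RInt_J (k h a b : R) : 0 < h ->
  is_RInt (fun x => sinc (PI * (x / h - k))) a b (J k h b - J k h a).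
Proof.
intros Hh. apply (is_RInt_derive (V := R_CompleteNormedModule) (J k h)).
- intros x _. unfold J.
  assert (D : is_derive (fun y => Si (PI * (y / h - k))) x (PI / h * sinc (PI * (x / h - k)))).
  { apply (is_derive_comp (K := R_AbsRing) (V := R_NormedModule) Si (fun y => PI * (y / h - k)) x); [apply is_derive_Si|].
    auto_derive; [trivial|]. field. lra. }
  evar_last.
  + apply (is_derive_scal (fun y => 1 / 2 + 1 / PI * Si (PI * (y / h - k))) x h).
    apply (is_derive_plus (K := R_AbsRing) (V := R_NormedModule) (fun _ => 1 / 2)); [apply is_derive_const|].
    apply (is_derive_scal (fun y => Si (PI * (y / h - k)))), D.
  + unfold plus, zero; simpl. field. pose proof PI_RGT_0; lra.
- intros x _. apply (continuous_comp (fun y => PI * (y / h - k)) sinc); [|apply continuous_sinc].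
  apply continuity_pt_filterlim. reg.
Qed.

Lemma is_CInt_Csum (u : nat -> R -> C) (l : nat -> C) n a b :
  (forall i, (i < n)%nat -> is_CInt (u i) a b (l i)) ->
  is_CInt (fun x => Csum (fun i => u i x) n) a b (Csum l n).
Proof.
induction n as [|n IH]; intros H; simpl.
- generalize (is_CInt_const (RtoC 0) a b). rewrite Cmult_0_r. auto.
- apply is_CInt_plus; auto.
Qed.

Lemma is_CInt_RtoC (f : R -> R) a b l : is_RInt f a b l -> is_CInt (fun x => RtoC (f x)) a b (RtoC l).
Proof.
intros H. apply is_CInt_pair; simpl; [exact H|].
generalize (is_RInt_const (V := R_NormedModule) a b 0). unfold scal; simpl; unfold mult; simpl.
rewrite Rmult_0_r. auto.
Qed.

Lemma is_CInt_sinc_sum F h P a b : 0 < h ->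
  is_CInt (sinc_sum F h P) a b
    (Csum (fun i => F (RtoC (node h P i)) * RtoC (J (INR i - INR P) h b - J (INR i - INR P) h a))%C (2 * P + 1)).
Proof.
intros Hh. unfold sinc_sum. apply (is_CInt_Csum (fun i x => (F (RtoC (node h P i)) *
   RtoC (sinc (PI * (x / h - (INR i - INR P)))))%C)).
intros i _. apply is_CInt_Cmult, is_CInt_RtoC, is_RInt_J, Hh.
Qed.

(** * Dirichlet's integral *)

Lemma Csum_telescope (a : nat -> C) n : Csum (fun i => a i - a (S i))%C n = (a 0%nat - a n)%C.
Proof. induction n as [|n IH]; simpl; [ring|]. rewrite IH. ring. Qed.

Lemma exp_le_mono a b : a <= b -> exp a <= exp b.
Proof. intros [H| ->]; [left; apply exp_increasing, H|lra]. Qed.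

Lemma sinh_ge_half t : 0 <= t -> t / 2 <= sinh t.
Proof.
intros Ht. unfold sinh. pose proof (exp_ineq1_le t).
assert (exp (- t) <= 1) by (rewrite <- exp_0; apply exp_le_mono; lra). lra.
Qed.

Lemma hol_kernel_div (F : C -> C) h x z :
  hol F z -> kernel_den h x z <> 0%C -> hol (fun z => F z / kernel_den h x z)%C z.
Proof. intros HF H0. apply hol_div; auto. eexists; apply cderiv_kernel_den. Qed.

Lemma sin_half_node h P : 0 < h -> Rabs (sin (PI / h * ((INR P + 1 / 2) * h))) = 1.
Proof.
intros Hh. assert (E : cos (PI / h * ((INR P + 1 / 2) * h)) = 0).
{ apply cos_eq_0_1. exists (Z.of_nat P). rewrite <- INR_IZR_INZ. field. lra. }
pose proof (sin2_cos2 (PI / h * ((INR P + 1 / 2) * h))) as H. rewrite E in H.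
apply Rsqr_inj; [apply Rabs_pos|lra|]. rewrite <- Rsqr_abs. unfold Rsqr in *. lra.
Qed.

Lemma Cmod_kernel_den_h h x u v : 0 < h -> v <> 0 ->
  Rabs v * sinh (PI / h * Rabs v) <= Cmod (kernel_den h x (u, v)).
Proof.
intros Hh Hv. unfold kernel_den. rewrite Cmod_mult.
assert (0 < PI / h) by (apply Rdiv_lt_0_compat; [apply PI_RGT_0|lra]).
pose proof (Rabs_pos_lt v Hv).
apply Rmult_le_compat.
- lra.
- left; apply sinh_pos. nra.
- replace v with (snd ((u, v) - RtoC x)%C) at 1 by (simpl; ring). apply snd_le_Cmod.
- rewrite grid_sin_pair. eapply Rle_trans; [|apply Cmod_Csin_ge_sinh].
  unfold Rabs. destruct (Rcase_abs v).
  + replace (PI / h * - v) with (- (PI / h * v)) by ring. rewrite sinh_opp.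
    destruct (Rcase_abs (sinh (PI / h * v))); lra.
  + destruct (Rcase_abs (sinh (PI / h * v))); lra.
Qed.

Lemma Cmod_kernel_den_v h P x u v : 0 < h -> Rabs u = (INR P + 1 / 2) * h ->
  Rabs (u - x) <= Cmod (kernel_den h x (u, v)).
Proof.
intros Hh Hu. unfold kernel_den. rewrite Cmod_mult, <- (Rmult_1_r (Rabs (u - x))).
apply Rmult_le_compat; [apply Rabs_pos|lra| |].
- replace (u - x) with (fst ((u, v) - RtoC x)%C) by (simpl; ring). apply fst_le_Cmod.
- rewrite grid_sin_pair. eapply Rle_trans; [|apply Cmod_Csin_ge_sin].
  rewrite <- (sin_half_node h P Hh), <- Hu. right.
  unfold Rabs at 2. destruct (Rcase_abs u); [|reflexivity].
  replace (PI / h * - u) with (- (PI / h * u)) by ring. rewrite sin_neg, Rabs_Ropp. reflexivity.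
Qed.

Lemma kernel_den_neq_0_h h x u v : 0 < h -> v <> 0 -> kernel_den h x (u, v) <> 0%C.
Proof.
intros Hh Hv. apply Cmod_gt_0. eapply Rlt_le_trans; [|apply Cmod_kernel_den_h; auto].
pose proof (Rabs_pos_lt v Hv). apply Rmult_lt_0_compat; auto. apply sinh_pos.
apply Rmult_lt_0_compat; auto. apply Rdiv_lt_0_compat; [apply PI_RGT_0|lra].
Qed.

Lemma kernel_den_neq_0_v h P x u v : 0 < h -> Rabs u = (INR P + 1 / 2) * h -> u <> x ->
  kernel_den h x (u, v) <> 0%C.
Proof.
intros Hh Hu Hx. apply Cmod_gt_0. eapply Rlt_le_trans; [|apply (Cmod_kernel_den_v h P); auto].
apply Rabs_pos_lt. lra.
Qed.

Lemma Cmod_Cinv_le (z : C) r : 0 < r -> r <= Cmod z -> Cmod (/ z) <= / r.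
Proof.
intros Hr H. rewrite Cmod_inv; [apply Rinv_le_contravar; auto|]. apply Cmod_gt_0; lra.
Qed.

Lemma Cmod_2PI_Ci : Cmod (RtoC (2 * PI) * Ci) = 2 * PI.
Proof. pose proof PI_RGT_0. rewrite Cmod_mult, Cmod_Ci, Cmod_R, Rabs_pos_eq by lra. ring. Qed.

Lemma C2PI_Ci_neq_0 : (RtoC (2 * PI) * Ci)%C <> 0%C.
Proof. apply Cmod_gt_0. rewrite Cmod_2PI_Ci. pose proof PI_RGT_0. lra. Qed.

(** The two terms come from the horizontal and the vertical sides. The linear bound on the
    hyperbolic sine is enough: with [Y] proportional to [P] the first term is of order [1 / P], and
    the second is small with the proportionality factor. *)
Lemma sinc_sum_one_bound (P : nat) (Y x : R) : (1 <= P)%nat -> 0 < Y -> 0 <= x <= 1 ->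
  Cmod (1 - sinc_sum (fun _ => 1%C) 1 P x) <=
    2 * ((2 * (INR P + 1 / 2)) * / (Y * (PI * Y / 2)) + (2 * Y) * / (INR P - 1 / 2)).
Proof.
intros HP HY Hx. pose proof PI_RGT_0 as Hpi. apply le_INR in HP. simpl in HP.
set (T := (INR P + 1 / 2) * 1).
assert (ET : T = INR P + 1 / 2) by (unfold T; ring).
rewrite (sinc_interpolation (fun _ => 1%C) 1 Y x P); try lra.
2:{ rewrite Rabs_pos_eq by lra. lra. }
2:{ intros u v _ _. apply hol_const. }
fold T. rewrite !Cmod_mult, Cmod_inv, Cmod_2PI_Ci by apply C2PI_Ci_neq_0.
assert (E1 : Cmod (RtoC (sin (PI / 1 * x))) <= 1) by (rewrite Cmod_R; apply Rabs_le, SIN_bound).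
assert (E2 : / (2 * PI) <= 1).
{ rewrite <- Rinv_1. pose proof PI2_3_2. apply Rinv_le_contravar; lra. }
assert (E3 : 0 < / (2 * PI)) by (apply Rinv_0_lt_compat; lra).
assert (Hd : Cmod (rect (fun z => 1 / kernel_den 1 x z)%C (- T) T (- Y) Y) <=
   2 * ((T - - T) * / (Y * (PI * Y / 2)) + (Y - - Y) * / (INR P - 1 / 2))).
{ assert (Rv : forall u, u = T \/ u = - T -> Rabs u = (INR P + 1 / 2) * 1).
  { intros u [-> | ->]; rewrite ?Rabs_Ropp; apply Rabs_pos_eq; unfold T; lra. }
  assert (Rd : forall u, u = T \/ u = - T -> INR P - 1 / 2 <= Rabs (u - x)).
  { intros u [-> | ->]; [rewrite Rabs_pos_eq by lra; lra|].
    replace (- T - x) with (- (T + x)) by ring. rewrite Rabs_Ropp, Rabs_pos_eq by lra. lra. }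
  apply rect_bound_hol; try lra.
  - split; intros t Ht; split; apply hol_kernel_div; try apply hol_const;
     try (apply kernel_den_neq_0_h; lra); (apply (kernel_den_neq_0_v 1 P); [lra|apply Rv; auto|lra]).
  - assert (A : forall u v, Rabs v = Y -> Cmod (1 / kernel_den 1 x (u, v)) <= / (Y * (PI * Y / 2))).
    { intros u v Hv. unfold Cdiv. rewrite Cmult_1_l. apply Cmod_Cinv_le; [assert (0 < PI * Y) by (apply Rmult_lt_0_compat; lra); nra|].
      eapply Rle_trans; [|apply Cmod_kernel_den_h; [lra|]].
      - rewrite Hv. apply Rmult_le_compat_l; [lra|]. unfold Rdiv at 2. rewrite Rinv_1, Rmult_1_r.
        apply sinh_ge_half. nra.
      - intros E; rewrite E, Rabs_R0 in Hv; lra. }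
    intros t _; split; apply A; rewrite ?Rabs_Ropp; apply Rabs_pos_eq; lra.
  - assert (A : forall u v, u = T \/ u = - T -> Cmod (1 / kernel_den 1 x (u, v)) <= / (INR P - 1 / 2)).
    { intros u v Hu. unfold Cdiv. rewrite Cmult_1_l. apply Cmod_Cinv_le; [lra|].
      eapply Rle_trans; [|apply (Cmod_kernel_den_v 1 P); [lra|apply Rv; auto]]. apply Rd; auto. }
    intros t _; split; apply A; auto. }
replace (2 * (INR P + 1 / 2)) with (T - - T) by lra. replace (2 * Y) with (Y - - Y) by ring.
eapply Rle_trans; [|exact Hd].
rewrite <- (Rmult_1_l (Cmod (rect _ _ _ _ _))) at 2.
apply Rmult_le_compat_r; [apply Cmod_ge_0|].
pose proof (Cmod_ge_0 (RtoC (sin (PI / 1 * x)))). nra.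
Qed.

(** Integrate the interpolation of 1 over [[0, 1]]. With step 1, moving [x] by 1 has the effect of
    moving the node by 1, so the sum telescopes to its two end terms. *)
Lemma Si_pair_bound (P : nat) (Y : R) : (1 <= P)%nat -> 0 < Y ->
  Rabs (PI - (Si (PI * (INR P + 1)) + Si (PI * INR P))) <=
    PI * (2 * ((2 * (INR P + 1 / 2)) * / (Y * (PI * Y / 2)) + (2 * Y) * / (INR P - 1 / 2))).
Proof.
intros HP HY. pose proof PI_RGT_0 as Hpi.
set (B := 2 * ((2 * (INR P + 1 / 2)) * / (Y * (PI * Y / 2)) + (2 * Y) * / (INR P - 1 / 2))).
assert (H1 := is_CInt_minus _ _ _ _ _ _ (is_CInt_const (RtoC 1) 0 1)
   (is_CInt_sinc_sum (fun _ => 1%C) 1 P 0 1 Rlt_0_1)).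
apply is_CInt_Cmod_le_const with (M := B) in H1; [|lra|intros x Hx; apply sinc_sum_one_bound; auto].
rewrite (Csum_ext _ (fun i => RtoC (Si (PI * (INR P + 1 - INR i)) / PI) - RtoC (Si (PI * (INR P + 1 - INR (S i))) / PI))%C) in H1.
2:{ intros i _. rewrite Cmult_1_l, <- RtoC_minus. f_equal. unfold J. rewrite S_INR.
  replace (1 / 1 - (INR i - INR P)) with (INR P + 1 - INR i) by field.
  replace (0 / 1 - (INR i - INR P)) with (INR P + 1 - (INR i + 1)) by field. field. lra. }
rewrite (Csum_telescope (fun i => RtoC (Si (PI * (INR P + 1 - INR i)) / PI))) in H1.
replace (INR (2 * P + 1)) with (2 * INR P + 1) in H1 by (rewrite plus_INR, mult_INR; simpl; ring).
simpl INR in H1.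
replace (INR P + 1 - 0) with (INR P + 1) in H1 by ring.
replace (PI * (INR P + 1 - (2 * INR P + 1))) with (- (PI * INR P)) in H1 by ring.
rewrite Si_opp, <- RtoC_minus, <- RtoC_mult, <- RtoC_minus, Cmod_R in H1.
replace (PI - (Si (PI * (INR P + 1)) + Si (PI * INR P))) with
  (PI * ((1 - 0) * 1 - (Si (PI * (INR P + 1)) / PI - - Si (PI * INR P) / PI))) by (field; lra).
rewrite Rabs_mult, (Rabs_pos_eq PI) by lra. apply Rmult_le_compat_l; [lra|].
replace ((1 - 0) * B) with B in H1 by ring. exact H1.
Qed.

(* Dirichlet's integral: interpolate the constant 1, and let the rectangle grow with
   height a small multiple of its width. *)
Lemma Si_limit_bound x : 0 < x -> Rabs (Si x - PI / 2) <= 2 / x.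
Proof.
intros Hx. pose proof PI_RGT_0 as Hpi. pose proof PI_4 as Hpi4. pose proof PI2_3_2 as Hpi3.
apply Rle_plus_epsilon. intros e He.
(* The height is [dl P]. The factor [1/256] makes the vertical sides contribute at most [e / 16];
   [P] is then taken large enough for the horizontal sides, for [PI P >= x], and for the gap between
   the two values of [Si]. *)
set (dl := e / 256). assert (Hdl : 0 < dl) by (unfold dl; lra).
destruct (archimed (2 + x + 64 / (dl ^ 2 * e) + 1 / e)) as [A1 _].
set (k := up (2 + x + 64 / (dl ^ 2 * e) + 1 / e)) in *.
assert (Hd2 : 0 < dl ^ 2 * e) by (apply Rmult_lt_0_compat; [apply pow_lt|]; lra).
assert (H64 : 0 < 64 / (dl ^ 2 * e)) by (apply Rdiv_lt_0_compat; lra).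
assert (H1e : 0 < 1 / e) by (apply Rdiv_lt_0_compat; lra).
assert (Hk : (0 <= k)%Z) by (apply le_IZR; lra).
set (P := Z.to_nat k). assert (EP : INR P = IZR k) by (unfold P; rewrite INR_IZR_INZ, Z2Nat.id; auto).
assert (HP1 : (1 <= P)%nat) by (apply INR_le; simpl; lra).
rewrite <- EP in A1.
pose proof (Si_pair_bound P (dl * INR P) HP1 ltac:(nra)) as H1.
assert (S1 : Rabs (Si (PI * INR P) - Si x) <= 2 / x) by (apply Si_tail; nra).
assert (S2 : Rabs (Si (PI * (INR P + 1)) - Si (PI * INR P)) <= 2 / (PI * INR P)) by (apply Si_tail; nra).
assert (S3 : 2 / (PI * INR P) <= e).
{ apply Rmult_le_reg_r with (PI * INR P); [nra|].
  unfold Rdiv. rewrite Rmult_assoc, Rinv_l, Rmult_1_r by nra.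
  assert (1 <= e * INR P); [|nra].
  apply Rle_trans with (e * (1 / e)); [right; field; lra|]. apply Rmult_le_compat_l; lra. }
assert (S4 : PI * (2 * (2 * (INR P + 1 / 2) * / (dl * INR P * (PI * (dl * INR P) / 2))
        + 2 * (dl * INR P) * / (INR P - 1 / 2))) <= e).
{ assert (T1 : 2 * (INR P + 1 / 2) * / (dl * INR P * (PI * (dl * INR P) / 2)) <= e / 16).
  { replace (2 * (INR P + 1 / 2) * / (dl * INR P * (PI * (dl * INR P) / 2)))
      with (4 * (INR P + 1 / 2) / (PI * dl ^ 2 * INR P ^ 2)) by (field; repeat split; lra).
    assert (0 < dl ^ 2 * INR P ^ 2) by (apply Rmult_lt_0_compat; apply pow_lt; lra).
    apply Rmult_le_reg_r with (PI * dl ^ 2 * INR P ^ 2); [nra|].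
    unfold Rdiv at 1. rewrite Rmult_assoc, Rinv_l, Rmult_1_r by nra.
    assert (Q : 64 <= dl ^ 2 * e * INR P).
    { apply Rle_trans with (dl ^ 2 * e * (64 / (dl ^ 2 * e))); [right; field; lra|].
      apply Rmult_le_compat_l; lra. }
    replace (e / 16 * (PI * dl ^ 2 * INR P ^ 2)) with (PI / 16 * (dl ^ 2 * e * INR P) * INR P) by field.
    assert (PI / 16 * 64 <= PI / 16 * (dl ^ 2 * e * INR P)) by (apply Rmult_le_compat_l; lra).
    nra. }
  assert (T2 : 2 * (dl * INR P) * / (INR P - 1 / 2) <= e / 16).
  { apply Rmult_le_reg_r with (INR P - 1 / 2); [lra|]. rewrite Rmult_assoc, Rinv_l, Rmult_1_r by lra.
    unfold dl. nra. }
  nra. }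
apply Rabs_le_between in H1. apply Rabs_le_between in S1. apply Rabs_le_between in S2.
apply Rabs_le. lra.
Qed.

(** Up to 3 the integrand is at most 1; beyond 3, [PI / 2 + 2 / 3 <= 3] by [Si_limit_bound]. *)
Lemma Si_bound x : Rabs (Si x) <= 3.
Proof.
assert (H : forall x, 0 <= x -> Rabs (Si x) <= 3).
{ clear x. intros x Hx. destruct (Rle_dec x 3) as [L|L].
  - assert (B : Rabs (Si x - Si 0) <= (x - 0) * 1).
    { apply (norm_RInt_le_const (V := R_NormedModule) sinc 0 x); [lra| |apply is_RInt_sinc].
      intros t Ht. unfold norm; simpl; unfold abs; simpl.
      destruct (Req_dec t 0) as [->|E].
      - unfold sinc. destruct (Req_EM_T 0 0); [|tauto]. rewrite Rabs_R1; lra.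
      - rewrite sinc_neq_0 by auto. unfold Rdiv. rewrite Rabs_mult, Rabs_inv.
        apply (Rmult_le_reg_r (Rabs t)); [apply Rabs_pos_lt; auto|].
        rewrite Rmult_assoc, Rinv_l, Rmult_1_l, Rmult_1_r by (apply Rabs_no_R0; auto).
        rewrite (Rabs_pos_eq t) by lra. apply Rabs_le. split.
        + pose proof (sin_lt_x t ltac:(lra)). pose proof (SIN_bound t).
          destruct (Rle_dec t 1) as [L1|L1]; [|lra].
          assert (0 <= sin t) by (apply sin_ge_0; pose proof PI2_3_2; lra). lra.
        + left; apply sin_lt_x; lra. }
    replace (Si 0) with 0 in B.
    + rewrite !Rminus_0_r in B. lra.
    + unfold Si. rewrite RInt_point. reflexivity.
  - pose proof (Si_limit_bound x ltac:(lra)) as B. pose proof PI_4. pose proof PI_RGT_0.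
    assert (2 / x <= 2 / 3).
    { apply Rmult_le_reg_r with x; [lra|]. unfold Rdiv at 1. rewrite Rmult_assoc, Rinv_l by lra. lra. }
    apply Rabs_le_between in B. apply Rabs_le. lra. }
destruct (Rle_dec 0 x) as [L|L]; [auto|].
replace x with (- - x) by ring. rewrite Si_opp, Rabs_Ropp. apply H; lra.
Qed.

(** * Integrals depending on a parameter *)

Lemma continuous_slice_1 (f : R -> R -> R) t :
  (forall x t, continuity_2d_pt f x t) -> forall x, continuous (fun u => f u t) x.
Proof.
intros H x. specialize (H x t). apply continuity_pt_filterlim.
intros e He. destruct (H (mkposreal e He)) as [d Hd]. exists d. split; [apply cond_pos|].
intros y [_ Hy]. apply Hd; [exact Hy|]. rewrite Rminus_diag, Rabs_R0. apply cond_pos.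
Qed.

Lemma continuous_slice_2 (f : R -> R -> R) x :
  (forall x t, continuity_2d_pt f x t) -> forall t, continuous (fun v => f x v) t.
Proof.
intros H t. specialize (H x t). apply continuity_pt_filterlim.
intros e He. destruct (H (mkposreal e He)) as [d Hd]. exists d. split; [apply cond_pos|].
intros y [_ Hy]. apply Hd; [|exact Hy]. rewrite Rminus_diag, Rabs_R0. apply cond_pos.
Qed.

Lemma continuity_2d_pt_swap (f : R -> R -> R) :
  (forall x t, continuity_2d_pt f x t) -> forall t x, continuity_2d_pt (fun t x => f x t) t x.
Proof.
intros H t x e. destruct (H x t e) as [d Hd]. exists d. intros u v Hu Hv. apply Hd; assumption.
Qed.

Lemma continuous_RInt_param (f : R -> R -> R) c d :
  (forall x t, continuity_2d_pt f x t) -> forall x, continuous (fun x => RInt (fun t => f x t) c d) x.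
Proof.
intros H x.
assert (Hex : forall y, ex_RInt (f y) c d).
{ intros y. apply (ex_RInt_continuous (V := R_CompleteNormedModule)).
  intros t _. apply continuous_slice_2, H. }
apply continuity_pt_filterlim. intros e He.
assert (He' : 0 < e / (2 * (Rabs (d - c) + 1))).
{ apply Rdiv_lt_0_compat; [lra|]. pose proof (Rabs_pos (d - c)); lra. }
destruct (uniform_continuity_2d f (x - 1) (x + 1) (Rmin c d) (Rmax c d)) with (eps := mkposreal _ He') as [dl Hdl].
{ intros; apply H. }
exists (Rmin dl 1). split; [apply Rmin_glb_lt; [apply cond_pos|lra]|].
intros y [_ Hy]. simpl in *. unfold Rdist in *.
assert (Hy1 : Rabs (y - x) < dl) by (eapply Rlt_le_trans; [exact Hy|apply Rmin_l]).
assert (Hy2 : Rabs (y - x) < 1) by (eapply Rlt_le_trans; [exact Hy|apply Rmin_r]).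
apply Rabs_def2 in Hy2.
assert (B : Rabs (RInt (f y) c d - RInt (f x) c d) <= Rabs (d - c) * (e / (2 * (Rabs (d - c) + 1)))).
{ apply (norm_RInt_le_const_abs (V := R_NormedModule) (fun t => f y t - f x t) c d).
  - intros t Ht. left. apply (Hdl x t y t); try lra.
    rewrite Rminus_diag, Rabs_R0. apply cond_pos.
  - apply (is_RInt_minus (V := R_NormedModule)); apply (RInt_correct (V := R_CompleteNormedModule)), Hex. }
eapply Rle_lt_trans; [exact B|]. pose proof (Rabs_pos (d - c)).
apply Rmult_lt_reg_r with (2 * (Rabs (d - c) + 1)); [lra|].
replace (Rabs (d - c) * (e / (2 * (Rabs (d - c) + 1))) * (2 * (Rabs (d - c) + 1))) with (Rabs (d - c) * e) by (field; lra).
nra.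
Qed.

(** As functions of the upper limit in [x], both iterated integrals have the same derivative and
    vanish at [a]. *)
Lemma RInt_swap_order (f : R -> R -> R) a b c d : a < b ->
  (forall x t, continuity_2d_pt f x t) ->
  RInt (fun x => RInt (fun t => f x t) c d) a b = RInt (fun t => RInt (fun x => f x t) a b) c d.
Proof.
intros Hab H. assert (H' := continuity_2d_pt_swap f H).
set (g := fun s => RInt (fun x => RInt (fun t => f x t) c d) a s - RInt (fun t => RInt (fun x => f x t) a s) c d).
assert (D1 : forall t s, is_derive (fun u => RInt (fun x => f x t) a u) s (f s t)).
{ intros t s. apply (is_derive_RInt (V := R_NormedModule) (fun x => f x t) _ a).
  - apply filter_forall. intros y. apply (RInt_correct (V := R_CompleteNormedModule)), (ex_RInt_continuous (V := R_CompleteNormedModule)).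
    intros u _. apply (continuous_slice_1 f), H.
  - apply (continuous_slice_1 f), H. }
assert (D2 : forall s, is_derive (fun u => RInt (fun t => RInt (fun x => f x t) a u) c d) s (RInt (f s) c d)).
{ intros s. evar_last.
  - apply (is_derive_RInt_param (fun u t => RInt (fun x => f x t) a u) c d s).
    + apply filter_forall. intros y t _. eexists. apply D1.
    + intros t _. apply (continuity_2d_pt_ext f); [|apply H].
      intros u v. symmetry. apply is_derive_unique, D1.
    + apply filter_forall. intros y. apply (ex_RInt_continuous (V := R_CompleteNormedModule)).
      intros t _. apply (continuous_RInt_param (fun t x => f x t)), H'.
  - apply (RInt_ext (V := R_CompleteNormedModule)). intros t _. apply is_derive_unique, D1. }
assert (D3 : forall s, is_derive (fun u => RInt (fun x => RInt (fun t => f x t) c d) a u) s (RInt (f s) c d)).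
{ intros s. apply (is_derive_RInt (V := R_NormedModule) (fun x => RInt (fun t => f x t) c d) _ a).
  - apply filter_forall. intros y. apply (RInt_correct (V := R_CompleteNormedModule)), (ex_RInt_continuous (V := R_CompleteNormedModule)).
    intros u _. apply continuous_RInt_param, H.
  - apply continuous_RInt_param, H. }
assert (E : g a = g b).
{ apply (eq_is_derive (V := R_NormedModule) g a b); [|exact Hab].
  intros t _. unfold g. evar_last.
  - apply (is_derive_minus (K := R_AbsRing) (V := R_NormedModule)); [apply D3|apply D2].
  - unfold minus, plus, opp, zero; simpl; ring. }
unfold g in E. rewrite (RInt_point (V := R_CompleteNormedModule)) in E.
rewrite (RInt_ext (V := R_CompleteNormedModule) (fun t => RInt (fun x => f x t) a a) (fun _ => 0)) in E.
- rewrite (RInt_const (V := R_CompleteNormedModule)) in E.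
  unfold scal, zero in E; simpl in E; unfold mult in E; simpl in E. lra.
- intros t _. apply (RInt_point (V := R_CompleteNormedModule)).
Qed.

Definition continuous2C (K : R -> R -> C) : Prop :=
  forall z : R * R, continuousC (fun z : prod_UniformSpace R_UniformSpace R_UniformSpace => K (fst z) (snd z)) z.

Lemma continuous2C_fst K : continuous2C K -> forall x t, continuity_2d_pt (fun x t => fst (K x t)) x t.
Proof.
intros H x t. apply continuity_2d_pt_filterlim.
exact (continuous_C_fst (fun z : prod_UniformSpace R_UniformSpace R_UniformSpace => K (fst z) (snd z))
  (x, t) (H (x, t))).
Qed.

Lemma continuous2C_snd K : continuous2C K -> forall x t, continuity_2d_pt (fun x t => snd (K x t)) x t.
Proof.
intros H x t. apply continuity_2d_pt_filterlim.
exact (continuous_C_snd (fun z : prod_UniformSpace R_UniformSpace R_UniformSpace => K (fst z) (snd z))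
  (x, t) (H (x, t))).
Qed.

Lemma CInt_pair f a b :
  (forall t, Rmin a b <= t <= Rmax a b -> continuousC f t) ->
  CInt f a b = (RInt (fun t => fst (f t)) a b, RInt (fun t => snd (f t)) a b).
Proof.
intros H. apply CInt_unique, is_CInt_pair; apply (RInt_correct (V := R_CompleteNormedModule)),
 (ex_RInt_continuous (V := R_CompleteNormedModule)); intros t Ht; [apply continuous_C_fst|apply continuous_C_snd]; auto.
Qed.

Lemma continuous2C_slice_2 K : continuous2C K -> forall x t, continuousC (fun t => K x t) t.
Proof.
intros H x t. apply continuous_C_pair.
- apply (continuous_slice_2 (fun x t => fst (K x t))), continuous2C_fst, H.
- apply (continuous_slice_2 (fun x t => snd (K x t))), continuous2C_snd, H.
Qed.

Lemma continuous2C_slice_1 K : continuous2C K -> forall t x, continuousC (fun x => K x t) x.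
Proof.
intros H t x. apply continuous_C_pair.
- apply (continuous_slice_1 (fun x t => fst (K x t)) t), continuous2C_fst, H.
- apply (continuous_slice_1 (fun x t => snd (K x t)) t), continuous2C_snd, H.
Qed.

Lemma continuous_CInt_param K c d : continuous2C K -> forall x, continuousC (fun x => CInt (K x) c d) x.
Proof.
intros H x.
apply (continuous_ext (U := C_UniformSpace) (fun x => (RInt (fun t => fst (K x t)) c d, RInt (fun t => snd (K x t)) c d))).
{ intros y. symmetry. apply CInt_pair. intros t _. apply continuous2C_slice_2, H. }
apply continuous_C_pair; simpl.
- apply (continuous_RInt_param (fun x t => fst (K x t))), continuous2C_fst, H.
- apply (continuous_RInt_param (fun x t => snd (K x t))), continuous2C_snd, H.
Qed.

Lemma continuous2C_swap K : continuous2C K -> continuous2C (fun t x => K x t).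
Proof.
intros H [t x]. apply continuous_C_pair.
- apply (proj1 (continuity_2d_pt_filterlim (fun t x => fst (K x t)) t x)).
  apply (continuity_2d_pt_swap (fun x t => fst (K x t))), continuous2C_fst, H.
- apply (proj1 (continuity_2d_pt_filterlim (fun t x => snd (K x t)) t x)).
  apply (continuity_2d_pt_swap (fun x t => snd (K x t))), continuous2C_snd, H.
Qed.

Lemma CInt_swap_order K a b c d : a < b -> continuous2C K ->
  CInt (fun x => CInt (fun t => K x t) c d) a b = CInt (fun t => CInt (fun x => K x t) a b) c d.
Proof.
intros Hab H.
assert (H' := continuous2C_swap K H).
rewrite (CInt_pair (fun x => CInt (fun t => K x t) c d)) by (intros; apply continuous_CInt_param, H).
rewrite (CInt_pair (fun t => CInt (fun x => K x t) a b)) by (intros; apply (continuous_CInt_param (fun t x => K x t)), H').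
apply f_equal2.
- rewrite (RInt_ext (V := R_CompleteNormedModule) _ (fun x => RInt (fun t => fst (K x t)) c d)).
  + rewrite (RInt_swap_order (fun x t => fst (K x t))) by (auto; apply continuous2C_fst, H).
    apply (RInt_ext (V := R_CompleteNormedModule)). intros t _.
    cbv beta. rewrite CInt_pair; [reflexivity|]. intros; apply continuous2C_slice_1, H.
  + intros x _. cbv beta. rewrite CInt_pair; [reflexivity|]. intros; apply continuous2C_slice_2, H.
- rewrite (RInt_ext (V := R_CompleteNormedModule) _ (fun x => RInt (fun t => snd (K x t)) c d)).
  + rewrite (RInt_swap_order (fun x t => snd (K x t))) by (auto; apply continuous2C_snd, H).
    apply (RInt_ext (V := R_CompleteNormedModule)). intros t _.
    cbv beta. rewrite CInt_pair; [reflexivity|]. intros; apply continuous2C_slice_1, H.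
  + intros x _. cbv beta. rewrite CInt_pair; [reflexivity|]. intros; apply continuous2C_slice_2, H.
Qed.

(** * The discretization error *)

Lemma is_derive_real_line (G : C -> C) x l :
  cderiv G (RtoC x) l -> is_derive (K := R_AbsRing) (V := C_R_NormedModule) (fun x => G (RtoC x)) x l.
Proof.
intros H. split.
- apply is_linear_scal_l.
- intros y Hy. apply (is_filter_lim_locally_unique (K := R_AbsRing) (V := AbsRing_NormedModule R_AbsRing)) in Hy. subst y. intros [e He].
  destruct (proj1 (cderiv_eps _ _ _) H e He) as [d [Hd Hl]].
  exists (mkposreal d Hd). intros y Hy.
  unfold ball in Hy; simpl in Hy. unfold AbsRing_ball, abs, minus, plus, opp in Hy; simpl in Hy.
  specialize (Hl (RtoC y)). rewrite <- RtoC_minus, Cmod_R in Hl. specialize (Hl Hy).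
  rewrite norm_C_R. unfold norm; simpl. unfold abs, minus, plus, opp; simpl.
  replace (G (RtoC y) - G (RtoC x) - l * RtoC (y - x))%C with
    ((G (RtoC y) + - G (RtoC x)) + - scal (V := C_R_NormedModule) (y + - x)%R l)%C in Hl; [exact Hl|].
  unfold Cminus. f_equal. f_equal. apply C_ext; unfold scal; simpl; unfold prod_scal, scal; simpl; unfold mult; simpl; ring.
Qed.

Lemma cderiv_Ccos z : cderiv Ccos z (- Csin z)%C.
Proof.
apply (cderiv_ext (fun w => (Cexp (Ci * w) + Cexp (- (Ci * w))) * / 2)%C).
{ intros w; symmetry; apply Ccos_Cexp. }
eapply cderiv_eq.
- apply cderiv_mult; [|apply cderiv_const]. apply cderiv_plus.
  + apply (cderiv_comp Cexp (fun w => Ci * w)%C); [apply cderiv_Cexp|apply cderiv_scale].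
  + apply (cderiv_comp Cexp (fun w => - (Ci * w))%C); [apply cderiv_Cexp|].
    apply cderiv_opp, cderiv_scale.
- cbv beta. rewrite Csin_Cexp.
  replace (Cexp (- (Ci * z)) * - Ci)%C with (- Ci * Cexp (- (Ci * z)))%C by ring.
  assert (HC : (/ (2 * Ci))%C = (- Ci / 2)%C) by (apply C_ext; simpl; field).
  rewrite HC. field.
Qed.

Lemma Cmod_inv_le_snd (z : C) e : 0 < e -> Rabs (snd z) = e -> Cmod (/ z) <= / e.
Proof. intros He H. apply Cmod_Cinv_le; [auto|]. rewrite <- H. apply snd_le_Cmod. Qed.

(* Integration by parts; the boundary term at [a] vanishes because [a] is a zero of the cosine. *)
Lemma kernel_integral_bound (h t e a b : R) : 0 < h -> e <> 0 -> a <= b -> cos (PI / h * a) = 0 ->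
  Cmod (CInt (fun x => RtoC (sin (PI / h * x)) * / ((t, e) - RtoC x))%C a b) <= h / PI * ((1 + PI) / Rabs e).
Proof.
intros Hh He Hab Hc. pose proof PI_RGT_0 as Hpi.
assert (Hp : 0 < PI / h) by (apply Rdiv_lt_0_compat; lra).
assert (Hae : 0 < Rabs e) by (apply Rabs_pos_lt; auto).
set (G := fun w => (Ccos (RtoC (PI / h) * w) * / ((t, e) - w))%C).
assert (Hz : forall x : R, ((t, e) - RtoC x)%C <> 0%C) by (intros x; apply Cneq_snd; simpl; auto).
assert (DG : forall x, cderiv G (RtoC x) (- (RtoC (PI / h) * (RtoC (sin (PI / h * x)) * / ((t, e) - RtoC x)))
     + RtoC (cos (PI / h * x)) * (/ ((t, e) - RtoC x) * / ((t, e) - RtoC x)))%C).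
{ intros x. eapply cderiv_eq.
  - apply cderiv_mult.
    + apply (cderiv_comp Ccos (fun w => RtoC (PI / h) * w)%C); [apply cderiv_Ccos|apply cderiv_scale].
    + apply (cderiv_inv (fun w => (t, e) - w)%C); [|apply Hz].
      apply cderiv_plus; [apply cderiv_const|apply cderiv_opp, cderiv_id].
  - cbv beta. rewrite Ccos_real. fold (grid_sin h (RtoC x)). rewrite grid_sin_real. field. apply Hz. }
assert (Cont : forall x, continuousC (fun x => / ((t, e) - RtoC x))%C x).
{ intros x. apply continuous_Cinv; [|apply Hz]. apply continuous_Cminus; [apply continuous_const|].
  apply continuous_RtoC, continuous_id. }
assert (Csn : forall x, continuousC (fun x => RtoC (sin (PI / h * x))) x).
{ intros x. apply continuous_RtoC, continuity_pt_filterlim. reg. }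
assert (Ccs : forall x, continuousC (fun x => RtoC (cos (PI / h * x))) x).
{ intros x. apply continuous_RtoC, continuity_pt_filterlim. reg. }
assert (CD : forall x, continuousC (fun x => - (RtoC (PI / h) * (RtoC (sin (PI / h * x)) * / ((t, e) - RtoC x)))
     + RtoC (cos (PI / h * x)) * (/ ((t, e) - RtoC x) * / ((t, e) - RtoC x)))%C x).
{ intros x. apply continuous_Cplus; [apply continuous_Copp|].
  - apply continuous_Cmult; [apply continuous_const|]. apply continuous_Cmult; auto.
  - apply continuous_Cmult; [auto|]. apply continuous_Cmult; auto. }
assert (I1 : is_CInt (fun x => - (RtoC (PI / h) * (RtoC (sin (PI / h * x)) * / ((t, e) - RtoC x)))
     + RtoC (cos (PI / h * x)) * (/ ((t, e) - RtoC x) * / ((t, e) - RtoC x)))%C a b (G (RtoC b) - G (RtoC a))%C).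
{ apply (is_RInt_derive (V := C_R_CompleteNormedModule) (fun x => G (RtoC x))).
  - intros x _. apply is_derive_real_line, DG.
  - intros x _. exact (CD x). }
set (S := CInt (fun x => RtoC (sin (PI / h * x)) * / ((t, e) - RtoC x))%C a b).
assert (I2 : is_CInt (fun x => RtoC (sin (PI / h * x)) * / ((t, e) - RtoC x))%C a b S).
{ apply is_CInt_CInt. intros; apply continuous_Cmult; auto. }
assert (I3 : is_CInt (fun x => RtoC (cos (PI / h * x)) * (/ ((t, e) - RtoC x) * / ((t, e) - RtoC x)))%C a b
    (G (RtoC b) - G (RtoC a) + RtoC (PI / h) * S)%C).
{ generalize (is_CInt_plus _ _ _ _ _ _ I1 (is_CInt_Cmult (RtoC (PI / h)) _ _ _ _ I2)).
  apply is_CInt_ext. intros x _. ring. }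
assert (E1 : G (RtoC a) = 0%C) by (unfold G; rewrite Ccos_real, Hc; ring).
rewrite E1 in I3.
assert (B1 : Cmod (G (RtoC b)) <= / Rabs e).
{ unfold G. rewrite Ccos_real, Cmod_mult, Cmod_R. rewrite <- (Rmult_1_l (/ Rabs e)).
  apply Rmult_le_compat; [apply Rabs_pos|apply Cmod_ge_0|apply Rabs_le, COS_bound|].
  apply Cmod_inv_le_snd; auto. simpl. f_equal. ring. }
assert (B2 : Cmod (G (RtoC b) - 0 + RtoC (PI / h) * S)%C <= PI / Rabs e).
{ apply Rle_trans with (/ Rabs e * (atan ((b - t) / Rabs e) - atan ((a - t) / Rabs e))).
  - refine (is_CInt_Cmod_le _ (fun x => / Rabs e * (Rabs e / ((x - t) ^ 2 + Rabs e ^ 2))) a b _ _ Hab _ I3 _).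
    + intros x _. rewrite !Cmod_mult, Cmod_R. rewrite <- Rmult_1_l.
      apply Rmult_le_compat; [apply Rabs_pos|apply Rmult_le_pos; apply Cmod_ge_0|apply Rabs_le, COS_bound|].
      right. rewrite Cmod_inv by apply Hz. rewrite <- Rinv_mult.
      replace (Cmod ((t, e) - RtoC x) * Cmod ((t, e) - RtoC x)) with ((x - t) ^ 2 + Rabs e ^ 2).
      * field. pose proof (den_pos (x - t) (Rabs e) Hae). lra.
      * replace (Cmod ((t, e) - RtoC x) * Cmod ((t, e) - RtoC x)) with (Cmod ((t, e) - RtoC x) ^ 2) by ring.
        rewrite Cmod2_alt, pow2_abs. unfold Re, Im; simpl. ring.
    + apply (is_RInt_scal (V := R_NormedModule)). apply is_RInt_kernel_even, Hae.
  - pose proof (atan_bound ((b - t) / Rabs e)). pose proof (atan_bound ((a - t) / Rabs e)).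
    unfold Rdiv. rewrite (Rmult_comm PI). apply Rmult_le_compat_l; [left; apply Rinv_0_lt_compat; auto|].
    lra. }
assert (B3 : Cmod (RtoC (PI / h) * S)%C <= (1 + PI) / Rabs e).
{ replace (RtoC (PI / h) * S)%C with ((G (RtoC b) - 0 + RtoC (PI / h) * S) + - G (RtoC b))%C by ring.
  eapply Rle_trans; [apply Cmod_triangle|]. rewrite Cmod_opp.
  unfold Rdiv in *. rewrite Rmult_plus_distr_r. lra. }
rewrite Cmod_mult, Cmod_R, Rabs_pos_eq in B3 by lra.
apply Rmult_le_reg_l with (PI / h); [auto|].
replace (PI / h * (h / PI * ((1 + PI) / Rabs e))) with ((1 + PI) / Rabs e); [exact B3|].
field. repeat split; lra.
Qed.

Section Discretization.
Variables (F : C -> C) (m : R -> R) (h e N1 : R).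
Hypothesis Hh : 0 < h.
Hypothesis He : 0 < e.
Hypothesis HF : forall x y, Rabs y <= e -> hol F (x, y).
Hypothesis Hm : forall x y, Rabs y <= e -> Cmod (F (x, y)) <= m x.
Hypothesis HN : forall T, 0 <= T -> exists I, is_RInt m (- T) T I /\ I <= N1.

(** At [z = t + i s] the contour integrand splits into the kernel, which depends on [x], and [phi],
    which does not; this is why exchanging the integrals helps. *)
Let phi (s t : R) : C := (F (t, s) / grid_sin h (t, s))%C.
Let K (s x t : R) : C := (RtoC (sin (PI / h * x)) * / ((t, s) - RtoC x) * phi s t)%C.

Lemma grid_sin_neq_0 t s : s <> 0 -> grid_sin h (t, s) <> 0%C.
Proof.
intros Hs E. rewrite grid_sin_pair in E. apply Csin_eq_0 in E. destruct E as [_ E].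
apply Rmult_integral in E. destruct E as [E|E]; [|auto].
pose proof (Rdiv_lt_0_compat _ _ PI_RGT_0 Hh). lra.
Qed.

Lemma continuous_phi s t : Rabs s = e -> continuousC (phi s) t.
Proof.
intros Hs. apply (continuous_hline (fun z => F z / grid_sin h z)%C).
apply hol_div; [apply HF; lra|eexists; apply cderiv_grid_sin|].
apply grid_sin_neq_0. intros ->. rewrite Rabs_R0 in Hs. lra.
Qed.

Lemma sinh_gap_pos : 0 < sinh (PI / h * e).
Proof. apply sinh_pos, Rmult_lt_0_compat; auto. apply Rdiv_lt_0_compat; [apply PI_RGT_0|auto]. Qed.

Lemma phi_bound s t : Rabs s = e -> Cmod (phi s t) <= m t * / sinh (PI / h * e).
Proof.
intros Hs. unfold phi, Cdiv. rewrite Cmod_mult.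
apply Rmult_le_compat; try apply Cmod_ge_0.
- apply Hm; lra.
- apply Cmod_Cinv_le; [apply sinh_gap_pos|]. rewrite grid_sin_pair.
  eapply Rle_trans; [|apply Cmod_Csin_ge_sinh]. right. symmetry. rewrite <- Hs.
  unfold Rabs at 2. destruct (Rcase_abs s) as [L|L].
  + replace (PI / h * s) with (- (PI / h * - s)) by ring. rewrite sinh_opp, Rabs_Ropp.
    apply Rabs_pos_eq. left. replace (- s) with e by (rewrite Rabs_left in Hs; lra). apply sinh_gap_pos.
  + apply Rabs_pos_eq. left. replace s with e by (rewrite Rabs_pos_eq in Hs; lra). apply sinh_gap_pos.
Qed.

Lemma continuous2C_K s : Rabs s = e -> continuous2C (K s).
Proof.
intros Hs [x t]. assert (Hs0 : s <> 0) by (intros ->; rewrite Rabs_R0 in Hs; lra).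
unfold K. apply continuous_Cmult; [apply continuous_Cmult|].
- apply continuous_RtoC. apply (continuous_comp (V := R_UniformSpace) fst (fun x => sin (PI / h * x))).
  + apply continuous_fst.
  + apply continuity_pt_filterlim. reg.
- apply continuous_Cinv; [|apply Cneq_snd; simpl; auto].
  apply continuous_Cminus; [|apply continuous_RtoC, continuous_fst].
  apply continuous_C_pair; simpl; [apply continuous_snd|apply continuous_const].
- apply (continuous_comp (V := R_UniformSpace) snd (phi s)); [apply continuous_snd|].
  apply continuous_phi, Hs.
Qed.

(** After the exchange the inner integral is the one of [kernel_integral_bound], whose bound depends
    neither on [t] nor on the length of [[a, b]]; what remains is the integral of the majorant. *)
Lemma horizontal_bound s a b T : Rabs s = e -> a < b -> cos (PI / h * a) = 0 -> 0 <= T ->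
  Cmod (CInt (fun x => CInt (K s x) (- T) T) a b) <=
    h / PI * ((1 + PI) / e) * (N1 * / sinh (PI / h * e)).
Proof.
intros Hs Hab Hc HT. pose proof PI_RGT_0 as Hpi.
assert (Hs0 : s <> 0) by (intros ->; rewrite Rabs_R0 in Hs; lra).
rewrite (CInt_swap_order (K s)) by (auto using continuous2C_K).
destruct (HN T HT) as [I [HI HI1]].
set (B := h / PI * ((1 + PI) / e)).
assert (HB : 0 <= B).
{ unfold B. apply Rmult_le_pos; apply Rdiv_le_0_compat; lra. }
set (kap := fun t => CInt (fun x => RtoC (sin (PI / h * x)) * / ((t, s) - RtoC x))%C a b).
assert (Ek : forall t, CInt (fun x => K s x t) a b = (phi s t * kap t)%C).
{ intros t. apply CInt_unique. unfold K.
  apply (is_CInt_ext (fun x => phi s t * (RtoC (sin (PI / h * x)) * / ((t, s) - RtoC x)))%C); [intros; ring|].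
  apply is_CInt_Cmult, is_CInt_CInt. intros x _. apply continuous_Cmult.
  - apply continuous_RtoC, continuity_pt_filterlim. reg.
  - apply continuous_Cinv; [|apply Cneq_snd; simpl; auto].
    apply continuous_Cminus; [apply continuous_const|apply continuous_RtoC, continuous_id]. }
apply Rle_trans with (/ sinh (PI / h * e) * B * I).
- apply (is_CInt_Cmod_le (fun t => CInt (fun x => K s x t) a b) (fun t => / sinh (PI / h * e) * B * m t) (- T) T).
  + lra.
  + intros t _. rewrite Ek, Cmod_mult.
    replace (/ sinh (PI / h * e) * B * m t) with (m t * / sinh (PI / h * e) * B) by ring.
    apply Rmult_le_compat; try apply Cmod_ge_0; [apply phi_bound, Hs|].
    unfold B, kap. rewrite <- Hs. apply kernel_integral_bound; auto; lra.
  + apply is_CInt_CInt. intros t _.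
    apply (continuous_CInt_param (fun t x => K s x t)).
    apply (continuous2C_swap (K s)), continuous2C_K, Hs.
  + apply (is_RInt_scal (V := R_NormedModule)), HI.
- pose proof (Rinv_0_lt_compat _ sinh_gap_pos).
  replace (B * (N1 * / sinh (PI / h * e))) with (/ sinh (PI / h * e) * B * N1) by ring.
  apply Rmult_le_compat_l; auto. apply Rmult_le_pos; lra.
Qed.

(** The right side bounds the vertical sides: each has length [2 e], and there the sine has modulus
    at least 1 while [|z - x| >= T - |x|], where [T] is the half-width. *)
Lemma interpolation_remainder (P : nat) x : Rabs x < (INR P + 1 / 2) * h ->
  Cmod (F (RtoC x) - sinc_sum F h P x -
    / (RtoC (2 * PI) * Ci) *
      (CInt (K (- e) x) (- ((INR P + 1 / 2) * h)) ((INR P + 1 / 2) * h)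
       - CInt (K e x) (- ((INR P + 1 / 2) * h)) ((INR P + 1 / 2) * h)))
  <= e / PI * ((m ((INR P + 1 / 2) * h) + m (- ((INR P + 1 / 2) * h))) / ((INR P + 1 / 2) * h - Rabs x)).
Proof.
intros Hx. pose proof PI_RGT_0 as Hpi.
rewrite (sinc_interpolation F h e x P Hh He Hx) by (intros u v _ Hv; apply HF, Rabs_le; lra).
set (T := (INR P + 1 / 2) * h) in *.
set (Kd := fun z => (F z / kernel_den h x z)%C).
assert (Side : forall s, Rabs s = e -> CInt (K s x) (- T) T
   = (RtoC (sin (PI / h * x)) * CInt (fun t => Kd (t, s)) (- T) T)%C).
{ intros s Hs. assert (Hs0 : s <> 0) by (intros ->; rewrite Rabs_R0 in Hs; lra).
  apply CInt_unique. apply (is_CInt_ext (fun t => RtoC (sin (PI / h * x)) * Kd (t, s))%C).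
  - intros t _. unfold K, Kd, phi, kernel_den. field. split; [apply grid_sin_neq_0; auto|].
    apply Cneq_snd; simpl; auto.
  - apply is_CInt_Cmult, is_CInt_CInt. intros t _. apply (continuous_hline Kd).
    apply hol_kernel_div; [apply HF; lra|]. apply kernel_den_neq_0_h; auto. }
rewrite (Side (- e)), (Side e) by (rewrite ?Rabs_Ropp; apply Rabs_pos_eq; lra).
unfold rect. fold Kd.
match goal with |- Cmod ?X <= _ => replace X with
  (RtoC (sin (PI / h * x)) * / (RtoC (2 * PI) * Ci) * (Ci * (CInt (fun y => Kd (T, y)) (- e) e - CInt (fun y => Kd ((- T)%R, y)) (- e) e)))%C
  by (unfold Kd; field; split; [apply Ci_neq_0|intros E; apply RtoC_inj in E; lra]) end.
rewrite !Cmod_mult, Cmod_Ci, Cmod_inv, Cmod_2PI_Ci by apply C2PI_Ci_neq_0.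
assert (E1 : Cmod (RtoC (sin (PI / h * x))) <= 1) by (rewrite Cmod_R; apply Rabs_le, SIN_bound).
assert (HV : forall u, Rabs u = T -> u <> x ->
   Cmod (CInt (fun y => Kd (u, y)) (- e) e) <= 2 * e * (m u / (T - Rabs x))).
{ intros u Hu Hux. replace (2 * e) with (e - - e) by ring.
  apply is_CInt_Cmod_le_const with (fun y => Kd (u, y)); [lra| |].
  - intros y Hy. unfold Kd, Cdiv. rewrite Cmod_mult. unfold Rdiv.
    apply Rmult_le_compat; try apply Cmod_ge_0; [apply Hm, Rabs_le; lra|].
    apply Cmod_Cinv_le; [lra|]. eapply Rle_trans; [|apply (Cmod_kernel_den_v h P); auto].
    rewrite <- Hu. apply Rabs_triang_inv.
  - apply is_CInt_CInt. rewrite Rmin_left, Rmax_right by lra. intros y Hy.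
    apply (continuous_vline Kd). apply hol_kernel_div; [apply HF, Rabs_le; lra|].
    apply (kernel_den_neq_0_v h P); auto. }
pose proof (Rabs_pos x) as Hax. pose proof (Rabs_def2 _ _ Hx) as Hx2.
assert (V1 := HV T ltac:(apply Rabs_pos_eq; lra) ltac:(lra)).
assert (V2 := HV (- T) ltac:(rewrite Rabs_Ropp; apply Rabs_pos_eq; lra) ltac:(lra)).
assert (V3 : Cmod (CInt (fun y => Kd (T, y)) (- e) e - CInt (fun y => Kd ((- T)%R, y)) (- e) e)
   <= 2 * e * ((m T + m (- T)) / (T - Rabs x))).
{ unfold Cminus. eapply Rle_trans; [apply Cmod_triangle|]. rewrite Cmod_opp.
  unfold Rdiv in *. rewrite Rmult_plus_distr_r. lra. }
assert (E3 : 0 < / (2 * PI)) by (apply Rinv_0_lt_compat; lra).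
apply Rle_trans with (1 * / (2 * PI) * (1 * (2 * e * ((m T + m (- T)) / (T - Rabs x))))).
- apply Rmult_le_compat.
  + apply Rmult_le_pos; [apply Cmod_ge_0|lra].
  + rewrite Rmult_1_l; apply Cmod_ge_0.
  + apply Rmult_le_compat_r; lra.
  + lra.
- right. field. split; lra.
Qed.

Lemma continuous_sinc_sum P x : continuousC (sinc_sum F h P) x.
Proof.
unfold sinc_sum. induction (2 * P + 1)%nat as [|n IH]; simpl; [apply continuous_const|].
apply continuous_Cplus; [exact IH|]. apply continuous_Cmult; [apply continuous_const|].
apply continuous_RtoC. apply (continuous_comp (fun x => PI * (x / h - (INR n - INR P))) sinc); [|apply continuous_sinc].
apply continuity_pt_filterlim. reg.
Qed.

(** With [2 j + 1] nodes on each side the contour reaches [T = 2 A + h / 2]. Hence [T - |x| >= A] on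
    the whole range of integration, whose length is at most [2 A]: the vertical sides contribute a
    multiple of [m T + m (- T)], which vanishes in the limit. *)
Lemma discretization_partial (j : nat) xi : Rabs xi < (INR j + 1 / 2) * h ->
  Cmod (CInt (fun x => F (RtoC x) - sinc_sum F h (2 * j + 1) x)%C (- ((INR j + 1 / 2) * h)) xi) <=
    / PI * (h / PI * ((1 + PI) / e) * (N1 * / sinh (PI / h * e))) +
    2 * e / PI * (m ((INR (2 * j + 1) + 1 / 2) * h) + m (- ((INR (2 * j + 1) + 1 / 2) * h))).
Proof.
intros Hxi. pose proof PI_RGT_0 as Hpi. pose proof (Rabs_def2 _ _ Hxi) as [X1 X2].
set (A := (INR j + 1 / 2) * h) in *. set (P := (2 * j + 1)%nat). set (T := (INR P + 1 / 2) * h).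
assert (ET : T = 2 * A + h / 2).
{ unfold T, A, P. rewrite plus_INR, mult_INR. simpl. field. }
assert (HA : 0 < A) by (pose proof (Rabs_pos xi); lra).
set (R0 := fun x => (F (RtoC x) - sinc_sum F h P x - / (RtoC (2 * PI) * Ci) * (CInt (K (- e) x) (- T) T - CInt (K e x) (- T) T))%C).
assert (Ae : Rabs (- e) = e) by (rewrite Rabs_Ropp; apply Rabs_pos_eq; lra).
assert (Ae' : Rabs e = e) by (apply Rabs_pos_eq; lra).
assert (CF : forall x, continuousC (fun x => F (RtoC x) - sinc_sum F h P x)%C x).
{ intros x. apply continuous_Cminus; [|apply continuous_sinc_sum].
  apply (continuous_hline F x 0), HF. rewrite Rabs_R0; lra. }
assert (CK : forall s x, Rabs s = e -> continuousC (fun x => CInt (K s x) (- T) T) x).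
{ intros s x Hs. apply continuous_CInt_param, continuous2C_K, Hs. }
set (L := CInt (fun x => F (RtoC x) - sinc_sum F h P x)%C (- A) xi).
set (L1 := CInt (fun x => CInt (K (- e) x) (- T) T) (- A) xi).
set (L2 := CInt (fun x => CInt (K e x) (- T) T) (- A) xi).
assert (IR : is_CInt R0 (- A) xi (L - / (RtoC (2 * PI) * Ci) * (L1 - L2))%C).
{ apply is_CInt_minus; [apply is_CInt_CInt; auto|]. apply is_CInt_Cmult.
  apply is_CInt_minus; apply is_CInt_CInt; intros; apply CK; auto. }
assert (Hc : cos (PI / h * - A) = 0).
{ apply cos_eq_0_1. exists (- Z.of_nat j - 1)%Z. rewrite minus_IZR, opp_IZR, <- INR_IZR_INZ.
  unfold A. field. lra. }
pose proof (horizontal_bound (- e) (- A) xi T Ae ltac:(lra) Hc ltac:(lra)) as B1.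
pose proof (horizontal_bound e (- A) xi T Ae' ltac:(lra) Hc ltac:(lra)) as B2.
fold L1 in B1. fold L2 in B2.
set (M := e / PI * ((m T + m (- T)) / A)).
assert (Hm0 : 0 <= m T + m (- T)).
{ assert (Z : Rabs 0 <= e) by (rewrite Rabs_R0; lra).
  pose proof (Hm T 0 Z). pose proof (Hm (- T) 0 Z).
  pose proof (Cmod_ge_0 (F (T, 0))). pose proof (Cmod_ge_0 (F (- T, 0))). lra. }
assert (B3 : Cmod (L - / (RtoC (2 * PI) * Ci) * (L1 - L2))%C <= (xi - - A) * M).
{ apply is_CInt_Cmod_le_const with R0; [lra| |exact IR].
  intros x Hx. assert (Hax : Rabs x <= A) by (apply Rabs_le; lra).
  eapply Rle_trans; [apply interpolation_remainder; fold T; lra|]. fold T. unfold M.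
  apply Rmult_le_compat_l; [apply Rdiv_le_0_compat; lra|].
  unfold Rdiv. apply Rmult_le_compat_l; [auto|]. apply Rinv_le_contravar; lra. }
assert (HM : (xi - - A) * M <= 2 * e / PI * (m T + m (- T))).
{ apply Rle_trans with (2 * A * M).
  - apply Rmult_le_compat_r; [|lra]. unfold M.
    apply Rmult_le_pos; apply Rdiv_le_0_compat; lra.
  - right. unfold M. field. lra. }
replace L with ((L - / (RtoC (2 * PI) * Ci) * (L1 - L2)) + / (RtoC (2 * PI) * Ci) * (L1 - L2))%C by ring.
eapply Rle_trans; [apply Cmod_triangle|].
rewrite Rplus_comm. apply Rplus_le_compat; [|lra].
rewrite Cmod_mult, Cmod_inv, Cmod_2PI_Ci by apply C2PI_Ci_neq_0.
replace (/ PI) with (/ (2 * PI) * 2) by (field; lra). rewrite Rmult_assoc.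
apply Rmult_le_compat_l; [left; apply Rinv_0_lt_compat; lra|].
unfold Cminus. eapply Rle_trans; [apply Cmod_triangle|]. rewrite Cmod_opp. lra.
Qed.

End Discretization.

(** * The double exponential map in the strip *)

Lemma cosh_ge_1 t : 1 <= cosh t.
Proof. unfold cosh. pose proof (exp_ineq1_le t). pose proof (exp_ineq1_le (- t)). lra. Qed.

Lemma sinh_ge_id t : 0 <= t -> t <= sinh t.
Proof.
intros [Ht|<-]; [|rewrite sinh_0; lra].
destruct (MVT_cor2 sinh cosh 0 t Ht) as [c [E _]].
{ intros c _. apply derivable_pt_lim_sinh. }
rewrite sinh_0 in E. pose proof (cosh_ge_1 c). nra.
Qed.

Lemma cosh_ge_quadratic t : 1 + t ^ 2 / 2 <= cosh t.
Proof.
assert (H : t ^ 2 / 4 <= sinh (t / 2) ^ 2).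
{ replace (t ^ 2 / 4) with ((t / 2) ^ 2) by field.
  destruct (Rle_dec 0 t) as [L|L].
  - apply pow_incr. split; [lra|]. apply sinh_ge_id; lra.
  - replace ((t / 2) ^ 2) with ((- (t / 2)) ^ 2) by ring.
    replace (sinh (t / 2) ^ 2) with (sinh (- (t / 2)) ^ 2) by (rewrite sinh_opp; ring).
    apply pow_incr. split; [lra|]. apply sinh_ge_id; lra. }
replace (cosh t) with (1 + 2 * sinh (t / 2) ^ 2); [lra|].
unfold cosh, sinh. replace (exp t) with (exp (t / 2) * exp (t / 2)) by (rewrite <- exp_plus; f_equal; field).
replace (exp (- t)) with (exp (- (t / 2)) * exp (- (t / 2))) by (rewrite <- exp_plus; f_equal; field).
assert (E : exp (t / 2) * exp (- (t / 2)) = 1) by (rewrite <- exp_plus, Rplus_opp_r; apply exp_0).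
nra.
Qed.

Lemma sin_ge_mul_cos v : 0 <= v <= PI -> v * cos v <= sin v.
Proof.
intros [[Hv|<-] Hv2]; [|rewrite sin_0; lra].
destruct (MVT_cor2 (fun t => sin t - t * cos t) (fun t => t * sin t) 0 v Hv) as [c [E Hc]].
{ intros c _. apply is_derive_Reals. auto_derive; [trivial|ring]. }
rewrite sin_0 in E. assert (0 <= sin c) by (apply sin_ge_0; lra).
assert (0 <= c * sin c * (v - 0)) by (repeat apply Rmult_le_pos; lra). lra.
Qed.

Lemma Rabs_sin_le t : Rabs (sin t) <= Rabs t.
Proof.
assert (H : forall t, 0 <= t -> Rabs (sin t) <= t).
{ clear t. intros t [Ht|<-]; [|rewrite sin_0, Rabs_R0; lra].
  apply Rabs_le. pose proof (SIN_bound t). pose proof (sin_lt_x t Ht). split; [|lra].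
  destruct (Rle_dec t 1); [|lra]. pose proof PI2_3_2.
  assert (0 <= sin t) by (apply sin_ge_0; lra). lra. }
destruct (Rle_dec 0 t) as [L|L].
- rewrite (Rabs_pos_eq t) by lra. auto.
- replace t with (- - t) at 1 by ring. rewrite sin_neg, Rabs_Ropp, (Rabs_left t) by lra. apply H; lra.
Qed.

(** From [tan v >= v] at [v = w / 2] one gets [sin w >= w (1 + cos w) / 2]. It remains to see
    [(PI / 2 + w) (1 + cos w) >= 2], by [cos w >= 1 - w ^ 2 / 2] up to 1 and by [cos w >= 0]
    beyond. *)
Lemma sin_lower w : 0 <= w <= PI / 2 -> w <= (PI / 2 + w) * sin w.
Proof.
intros Hw. pose proof PI2_3_2 as Hpi.
assert (H1 := sin_ge_mul_cos (w / 2) ltac:(lra)).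
assert (H2 : sin w = 2 * sin (w / 2) * cos (w / 2)) by (rewrite <- sin_2a; f_equal; field).
assert (H3 : cos w = 2 * cos (w / 2) * cos (w / 2) - 1) by (rewrite <- cos_2a_cos; f_equal; field).
assert (H4 : 0 <= cos (w / 2)) by (apply cos_ge_0; lra).
assert (H5 : 0 <= cos w) by (apply cos_ge_0; lra).
assert (H6 : w * (1 + cos w) / 2 <= sin w).
{ rewrite H2, H3. nra. }
assert (H7 : 1 - w ^ 2 / 2 <= cos w).
{ replace w with (2 * (w / 2)) at 2 by field. rewrite cos_2a_sin.
  pose proof (Rabs_sin_le (w / 2)) as B. rewrite (Rabs_pos_eq (w / 2)) in B by lra.
  apply Rabs_le_between in B. nra. }
assert (H8 : 2 <= (PI / 2 + w) * (1 + cos w)).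
{ destruct (Rle_dec w 1); [|nra]. nra. }
nra.
Qed.

(* With [w = pi/2 sin y], [c = pi/2 cos y], expand [sin (w + (cosh x - 1) w)]. *)
Lemma sin_mul_cosh_le w c x : 0 <= w <= PI / 2 -> w ^ 2 + c ^ 2 = (PI / 2) ^ 2 ->
  Rabs (sin (w * cosh x)) <= cosh (c * sinh x) * sin w.
Proof.
intros Hw Hc. pose proof (cosh_ge_1 x) as H1. pose proof (cosh_sqr x) as H2.
set (dl := cosh x - 1). assert (Hd : 0 <= dl) by (unfold dl; lra).
assert (Hs : sinh x ^ 2 = dl * (2 + dl)) by (unfold dl; nra).
assert (S0 : 0 <= sin w) by (apply sin_ge_0; lra).
assert (C0 : 0 <= cos w) by (apply cos_ge_0; lra).
replace (w * cosh x) with (w + dl * w) by (unfold dl; ring). rewrite sin_plus.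
assert (A1 : Rabs (sin w * cos (dl * w) + cos w * sin (dl * w)) <= sin w + cos w * (dl * w)).
{ eapply Rle_trans; [apply Rabs_triang|]. rewrite !Rabs_mult, (Rabs_pos_eq (sin w)), (Rabs_pos_eq (cos w)) by auto.
  pose proof (Rabs_sin_le (dl * w)) as B. rewrite (Rabs_pos_eq (dl * w)) in B by (apply Rmult_le_pos; lra).
  assert (Rabs (cos (dl * w)) <= 1) by (apply Rabs_le, COS_bound). nra. }
assert (A2 : cos w <= PI / 2 - w).
{ rewrite <- sin_shift. pose proof (Rabs_sin_le (PI / 2 - w)) as B.
  rewrite (Rabs_pos_eq (PI / 2 - w)) in B by lra. apply Rabs_le_between in B. lra. }
assert (A3 := sin_lower w Hw).
(* Factor [c ^ 2 = (PI / 2 - w) (PI / 2 + w)]: the first factor dominates [cos w], the second gives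
   [w] when multiplied by [sin w]. The terms of first order in [dl] then compare, as
   [sinh x ^ 2 >= 2 dl]. *)
assert (A4 : w * cos w <= c ^ 2 * sin w).
{ replace (c ^ 2) with ((PI / 2 - w) * (PI / 2 + w)) by nra. nra. }
pose proof (cosh_ge_quadratic (c * sinh x)) as A5.
replace ((c * sinh x) ^ 2) with (c ^ 2 * (dl * (2 + dl))) in A5 by (rewrite <- Hs; ring).
assert (A6 : c ^ 2 * (2 * dl) <= c ^ 2 * (dl * (2 + dl))) by (apply Rmult_le_compat_l; nra).
assert (A7 : (1 + c ^ 2 * dl) * sin w <= cosh (c * sinh x) * sin w) by (apply Rmult_le_compat_r; lra).
assert (A8 : dl * (w * cos w) <= dl * (c ^ 2 * sin w)) by (apply Rmult_le_compat_l; lra).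
lra.
Qed.

Definition Ccosh (z : C) : C := ((Cexp z + Cexp (- z)) / 2)%C.
Definition dpsiC (z : C) : C := (RtoC (PI / 2) * Ccosh z * Ccosh (RtoC (PI / 2) * Csinh z))%C.
Definition dpsi (x : R) : R := PI / 2 * cosh x * cosh (PI / 2 * sinh x).

Lemma RtoC_mult_pair (r a b : R) : Cmult (RtoC r) (a, b) = (r * a, r * b).
Proof. apply C_ext; simpl; ring. Qed.

Lemma Csinh_pair x y : Csinh (x, y) = (sinh x * cos y, cosh x * sin y).
Proof. apply C_ext; unfold Csinh, Cexp, sinh, cosh; simpl; rewrite ?cos_neg, ?sin_neg; field. Qed.

Lemma Ccosh_pair x y : Ccosh (x, y) = (cosh x * cos y, sinh x * sin y).
Proof. apply C_ext; unfold Ccosh, Cexp, sinh, cosh; simpl; rewrite ?cos_neg, ?sin_neg; field. Qed.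

Lemma cderiv_Csinh z : cderiv Csinh z (Ccosh z).
Proof.
eapply cderiv_eq.
- apply (cderiv_mult (fun z => Cexp z - Cexp (- z))%C (fun _ => / 2)%C); [|apply cderiv_const].
  apply cderiv_plus; [apply cderiv_Cexp|]. apply cderiv_opp.
  apply (cderiv_comp Cexp (fun w => - w)%C); [apply cderiv_Cexp|apply cderiv_opp, cderiv_id].
- cbv beta. unfold Ccosh. field.
Qed.

Lemma hol_Ccosh z : hol Ccosh z.
Proof.
apply hol_div; [apply hol_plus|apply hol_const|].
- eexists; apply cderiv_Cexp.
- apply (hol_comp Cexp (fun w => - w)%C); [eexists; apply cderiv_Cexp|apply hol_opp, hol_id].
- intros E. apply (f_equal fst) in E. simpl in E. lra.
Qed.

Lemma hol_psiC z : hol psiC z.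
Proof.
apply (hol_comp Csinh (fun z => RtoC (PI / 2) * Csinh z)%C).
- eexists; apply cderiv_Csinh.
- apply hol_mult; [apply hol_const|eexists; apply cderiv_Csinh].
Qed.

Lemma hol_dpsiC z : hol dpsiC z.
Proof.
apply hol_mult; [apply hol_mult; [apply hol_const|apply hol_Ccosh]|].
apply (hol_comp Ccosh (fun z => RtoC (PI / 2) * Csinh z)%C); [apply hol_Ccosh|].
apply hol_mult; [apply hol_const|eexists; apply cderiv_Csinh].
Qed.

Lemma psiC_real x : psiC (RtoC x) = RtoC (psi x).
Proof.
unfold psiC. change (RtoC x) with (x, 0). rewrite Csinh_pair, sin_0, cos_0.
rewrite !Rmult_1_r, !Rmult_0_r, !RtoC_mult_pair, !Rmult_0_r.
rewrite Csinh_pair, sin_0, cos_0. unfold psi. apply C_ext; simpl; ring.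
Qed.

Lemma dpsiC_real x : dpsiC (RtoC x) = RtoC (dpsi x).
Proof.
unfold dpsiC. change (RtoC x) with (x, 0). rewrite Csinh_pair, Ccosh_pair, sin_0, cos_0.
rewrite !Rmult_1_r, !Rmult_0_r, !RtoC_mult_pair, !Rmult_0_r.
rewrite Ccosh_pair, sin_0, cos_0. unfold dpsi. apply C_ext; simpl; ring.
Qed.

Lemma is_derive_psi x : is_derive psi x (dpsi x).
Proof.
unfold psi, dpsi. evar_last.
- apply (is_derive_comp (K := R_AbsRing) (V := R_NormedModule) sinh (fun t => PI / 2 * sinh t)).
  + apply is_derive_Reals, derivable_pt_lim_sinh.
  + apply is_derive_scal, is_derive_Reals, derivable_pt_lim_sinh.
- unfold scal; simpl; unfold mult; simpl. ring.
Qed.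

Lemma one_plus_psiC_sqr z :
  (1 + psiC z * psiC z)%C = (Ccosh (RtoC (PI / 2) * Csinh z) * Ccosh (RtoC (PI / 2) * Csinh z))%C.
Proof.
unfold psiC. set (w := (RtoC (PI / 2) * Csinh z)%C). unfold Csinh, Ccosh.
assert (H : (Cexp w * Cexp (- w))%C = 1%C).
{ rewrite <- Cexp_plus. replace (w + - w)%C with (RtoC 0) by ring. apply Cexp_0. }
rewrite <- H. field.
Qed.

Lemma Cmod_Ccosh_sqr x y : Cmod (Ccosh (x, y)) ^ 2 = sinh x ^ 2 + cos y ^ 2.
Proof.
rewrite Cmod2_alt, Ccosh_pair. unfold Re, Im; simpl fst; simpl snd.
rewrite !Rpow_mult_distr, cosh_sqr. pose proof (sin2_cos2 y) as H. unfold Rsqr in H. nra.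
Qed.

Lemma cosh_pos x : 0 < cosh x.
Proof. pose proof (cosh_ge_1 x); lra. Qed.

Lemma Cmod_Ccosh_le x y : Cmod (Ccosh (x, y)) <= cosh x.
Proof.
apply Rsqr_incr_0_var; [|left; apply cosh_pos]. rewrite !Rsqr_pow2, Cmod_Ccosh_sqr, cosh_sqr.
pose proof (COS_bound y). nra.
Qed.

Lemma cosh_ge_half_exp u : exp (Rabs u) / 2 <= cosh u.
Proof.
unfold cosh, Rabs. pose proof (exp_pos u). pose proof (exp_pos (- u)). destruct (Rcase_abs u); lra.
Qed.

Lemma Rabs_sinh x : Rabs (sinh x) = sinh (Rabs x).
Proof.
unfold Rabs at 2. destruct (Rcase_abs x) as [L|L].
- rewrite sinh_opp. apply Rabs_left. pose proof (sinh_pos (- x) ltac:(lra)). rewrite sinh_opp in *. lra.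
- apply Rabs_pos_eq. destruct L as [L| ->]; [left; apply sinh_pos; lra|rewrite sinh_0; lra].
Qed.

(** The squared modulus of [cosh (u + i v)] is [sinh u ^ 2 + cos v ^ 2]. It dominates
    [(cos w * cosh u) ^ 2] exactly when [sin v ^ 2 <= (sin w * cosh u) ^ 2], which is
    [sin_mul_cosh_le]. *)
Lemma cosh_psi_lower_nonneg e x y : 0 <= y <= e -> e < PI / 2 ->
  cos (PI / 2 * sin e) / 2 * exp (PI / 2 * cos e * Rabs (sinh x)) <=
  Cmod (Ccosh (RtoC (PI / 2) * Csinh (x, y))).
Proof.
intros Hy He. pose proof PI_RGT_0 as Hpi.
rewrite Csinh_pair, RtoC_mult_pair.
replace (PI / 2 * (sinh x * cos y)) with (PI / 2 * cos y * sinh x) by ring.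
replace (PI / 2 * (cosh x * sin y)) with (PI / 2 * sin y * cosh x) by ring.
set (w := PI / 2 * sin y). set (c := PI / 2 * cos y).
assert (Sy : 0 <= sin y) by (apply sin_ge_0; lra).
assert (Sy1 : sin y <= sin e) by (apply sin_incr_1; lra).
assert (Se1 : sin e <= 1) by apply SIN_bound.
assert (Hw : 0 <= w <= PI / 2) by (unfold w; split; [apply Rmult_le_pos; lra|nra]).
assert (Hwe : w <= PI / 2 * sin e) by (unfold w; apply Rmult_le_compat_l; lra).
assert (Cy : cos e <= cos y) by (apply cos_decr_1; lra).
assert (Ce : 0 < cos e) by (apply cos_gt_0; lra).
assert (Hwc : w ^ 2 + c ^ 2 = (PI / 2) ^ 2).
{ unfold w, c. pose proof (sin2_cos2 y) as H. unfold Rsqr in H.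
  replace ((PI / 2 * sin y) ^ 2 + (PI / 2 * cos y) ^ 2) with ((PI / 2) ^ 2 * (sin y * sin y + cos y * cos y)) by ring.
  rewrite H. ring. }
pose proof (sin_mul_cosh_le w c x Hw Hwc) as Key.
assert (Cw0 : 0 <= cos w) by (apply cos_ge_0; lra).
assert (Cwe : cos (PI / 2 * sin e) <= cos w) by (apply cos_decr_1; nra).
assert (Cwe0 : 0 <= cos (PI / 2 * sin e)) by (apply cos_ge_0; nra).
apply Rle_trans with (cos w * cosh (c * sinh x)).
- apply Rle_trans with (cos (PI / 2 * sin e) * cosh (c * sinh x)).
  + unfold Rdiv at 1. rewrite Rmult_assoc. apply Rmult_le_compat_l; [auto|].
    eapply Rle_trans; [|apply cosh_ge_half_exp].
    rewrite Rmult_comm. apply Rmult_le_compat_r; [lra|]. apply exp_le_mono.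
    rewrite Rabs_mult, (Rabs_pos_eq c) by (unfold c; nra).
    apply Rmult_le_compat_r; [apply Rabs_pos|]. unfold c. apply Rmult_le_compat_l; lra.
  + apply Rmult_le_compat_r; [left; apply cosh_pos|auto].
- apply Rsqr_incr_0_var; [|apply Cmod_ge_0]. rewrite !Rsqr_pow2, Cmod_Ccosh_sqr, Rpow_mult_distr.
  assert (K2 : sin (w * cosh x) ^ 2 <= (cosh (c * sinh x) * sin w) ^ 2).
  { rewrite <- (pow2_abs (sin (w * cosh x))). apply pow_incr. split; [apply Rabs_pos|exact Key]. }
  rewrite Rpow_mult_distr in K2. rewrite (cosh_sqr (c * sinh x)) in *.
  pose proof (sin2_cos2 w) as H1. pose proof (sin2_cos2 (w * cosh x)) as H2. unfold Rsqr in H1, H2.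
  nra.
Qed.

Lemma cosh_psi_lower e x y : Rabs y <= e -> e < PI / 2 ->
  cos (PI / 2 * sin e) / 2 * exp (PI / 2 * cos e * Rabs (sinh x)) <=
  Cmod (Ccosh (RtoC (PI / 2) * Csinh (x, y))).
Proof.
intros Hy He.
assert (E : Cmod (Ccosh (RtoC (PI / 2) * Csinh (x, y))) = Cmod (Ccosh (RtoC (PI / 2) * Csinh (x, Rabs y)))).
{ unfold Rabs. destruct (Rcase_abs y); [|reflexivity].
  apply Rsqr_inj; try apply Cmod_ge_0. rewrite !Rsqr_pow2, !Csinh_pair, cos_neg, sin_neg.
  rewrite !RtoC_mult_pair, !Cmod_Ccosh_sqr.
  replace (PI / 2 * (cosh x * - sin y)) with (- (PI / 2 * (cosh x * sin y))) by ring.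
  rewrite cos_neg. reflexivity. }
rewrite E. apply cosh_psi_lower_nonneg; auto. split; [apply Rabs_pos|exact Hy].
Qed.

Definition F_de (f : C -> C) (z : C) : C := (f (psiC z) * dpsiC z)%C.

Lemma Rpower_pos a b : 0 < Rpower a b.
Proof. apply exp_pos. Qed.

(* [|1 + psi^2| = |cosh(pi/2 sinh z)|^2], and [psi'] contributes one factor [cosh(pi/2 sinh z)]. *)
Lemma F_de_bound (f : C -> C) (K g e x y : R) : 0 < K -> 0 < g -> Rabs y <= e -> e < PI / 2 ->
  Cmod (f (psiC (x, y))) <= K * Rpower (Cmod (1 + psiC (x, y) * psiC (x, y))%C) (- (g + 1) / 2) ->
  Cmod (F_de f (x, y)) <=
   K * (PI / 2) * Rpower (2 / cos (PI / 2 * sin e)) g * (cosh x * exp (- (g * (PI / 2) * cos e) * Rabs (sinh x))).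
Proof.
intros HK Hg Hy He Hf. pose proof PI_RGT_0 as Hpi.
assert (He0 : 0 <= e) by (pose proof (Rabs_pos y); lra).
set (W := Cmod (Ccosh (RtoC (PI / 2) * Csinh (x, y)))).
pose proof (cosh_psi_lower e x y Hy He) as HW. fold W in HW.
set (cw := cos (PI / 2 * sin e)) in *.
assert (Hcw : 0 < cw).
{ unfold cw. pose proof (sin_ge_0 e He0 ltac:(lra)).
  assert (sin e < 1).
  { rewrite <- sin_PI2. apply sin_increasing_1; lra. }
  apply cos_gt_0; nra. }
set (X := exp (PI / 2 * cos e * Rabs (sinh x))) in *.
assert (HX : 0 < X) by apply exp_pos.
assert (HW0 : 0 < W) by nra.
rewrite one_plus_psiC_sqr, Cmod_mult in Hf. fold W in Hf.
assert (E1 : Rpower (W * W) (- (g + 1) / 2) = Rpower W (- g) * / W).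
{ unfold Rpower. rewrite ln_mult by auto. rewrite <- (exp_ln W HW0) at 4. rewrite <- exp_Ropp, <- exp_plus.
  f_equal. field. }
rewrite E1 in Hf.
unfold F_de. rewrite Cmod_mult. unfold dpsiC. rewrite !Cmod_mult. fold W.
rewrite Cmod_R, (Rabs_pos_eq (PI / 2)) by lra.
pose proof (Cmod_Ccosh_le x y) as Hc. pose proof (Cmod_ge_0 (Ccosh (x, y))) as Hc0.
assert (P1 : Rpower W (- g) <= Rpower (2 / cw) g * exp (- (g * (PI / 2) * cos e) * Rabs (sinh x))).
{ unfold Rpower. rewrite <- exp_plus. apply exp_le_mono.
  assert (L : ln (cw / 2 * X) <= ln W) by (apply ln_le; nra).
  rewrite ln_mult in L by lra. unfold X in L. rewrite ln_exp in L.
  assert (E2 : ln (cw / 2) = - ln (2 / cw)).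
  { rewrite <- ln_Rinv by (apply Rdiv_lt_0_compat; lra). f_equal. field. lra. }
  rewrite E2 in L. nra. }
apply Rle_trans with (K * (Rpower W (- g) * / W) * (PI / 2 * cosh x * W)).
- apply Rmult_le_compat; [apply Cmod_ge_0| |exact Hf|].
  + apply Rmult_le_pos; [apply Rmult_le_pos|]; lra.
  + apply Rmult_le_compat_r; [lra|]. apply Rmult_le_compat_l; lra.
- replace (K * (Rpower W (- g) * / W) * (PI / 2 * cosh x * W)) with (K * (PI / 2) * cosh x * Rpower W (- g))
    by (field; lra).
  replace (K * (PI / 2) * Rpower (2 / cw) g * (cosh x * exp (- (g * (PI / 2) * cos e) * Rabs (sinh x))))
   with (K * (PI / 2) * cosh x * (Rpower (2 / cw) g * exp (- (g * (PI / 2) * cos e) * Rabs (sinh x)))) by ring.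
  apply Rmult_le_compat_l; [|exact P1]. pose proof (cosh_pos x). apply Rmult_le_pos; [apply Rmult_le_pos|]; lra.
Qed.

(** * Majorants and tails *)

(** For [x >= 0] this is the derivative of [- c0 / a * exp (- a * sinh x)], so its integrals are
    explicit. *)
Definition de_majorant (c0 a x : R) : R := c0 * (cosh x * exp (- a * Rabs (sinh x))).

Lemma sinh_nonneg x : 0 <= x -> 0 <= sinh x.
Proof. intros H; pose proof (sinh_ge_id x H); lra. Qed.

Lemma is_RInt_majorant_right c0 a T : 0 < a -> 0 <= T ->
  is_RInt (de_majorant c0 a) 0 T (c0 / a * (1 - exp (- a * sinh T))).
Proof.
intros Ha HT.
apply (is_RInt_ext (V := R_NormedModule) (fun x => c0 * (cosh x * exp (- a * sinh x)))).
{ intros x Hx. rewrite Rmin_left, Rmax_right in Hx by lra. unfold de_majorant.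
  rewrite Rabs_pos_eq; [reflexivity|apply sinh_nonneg; lra]. }
replace (c0 / a * (1 - exp (- a * sinh T))) with
  (minus (G := R_AbelianGroup) (- (c0 / a) * exp (- a * sinh T)) (- (c0 / a) * exp (- a * sinh 0))).
2:{ unfold minus, plus, opp; simpl. rewrite sinh_0, Rmult_0_r, exp_0. ring. }
apply (is_RInt_derive (V := R_CompleteNormedModule) (fun x => - (c0 / a) * exp (- a * sinh x))).
- intros x _. evar_last.
  + apply is_derive_scal. apply (is_derive_comp (K := R_AbsRing) (V := R_NormedModule) exp (fun x => - a * sinh x)).
    * apply is_derive_exp.
    * apply is_derive_scal, is_derive_Reals, derivable_pt_lim_sinh.
  + unfold scal; simpl; unfold mult; simpl. field. lra.
- intros x _. apply continuity_pt_filterlim. unfold cosh, sinh. reg.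
Qed.

Lemma is_RInt_majorant_left c0 a T : 0 < a -> 0 <= T ->
  is_RInt (de_majorant c0 a) (- T) 0 (c0 / a * (1 - exp (- a * sinh T))).
Proof.
intros Ha HT. pose proof (is_RInt_majorant_right c0 a T Ha HT) as H.
apply (is_RInt_swap (V := R_NormedModule)) in H.
rewrite <- (Ropp_involutive T), <- Ropp_0 in H.
apply (is_RInt_comp_opp (V := R_NormedModule)) in H.
replace (c0 / a * (1 - exp (- a * sinh T))) with
  (opp (G := R_AbelianGroup) (opp (G := R_AbelianGroup) (c0 / a * (1 - exp (- a * sinh T)))))
 by (unfold opp; simpl; ring).
rewrite Ropp_involutive in H.
generalize (is_RInt_opp (V := R_NormedModule) _ _ _ _ H).
apply (is_RInt_ext (V := R_NormedModule)). intros x _. unfold opp; simpl. rewrite Ropp_involutive.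
unfold de_majorant. rewrite cosh_opp, sinh_opp, Rabs_Ropp. reflexivity.
Qed.

Lemma exp_neg_le t : 0 < t -> exp (- t) <= / t.
Proof.
intros Ht. rewrite exp_Ropp. apply Rinv_le_contravar; [auto|]. pose proof (exp_ineq1_le t). lra.
Qed.

Lemma exp_neg_le_sqr t : 0 < t -> exp (- t) <= 4 / t ^ 2.
Proof.
intros Ht. replace (- t) with (- (t / 2) + - (t / 2)) by field. rewrite exp_plus.
pose proof (exp_neg_le (t / 2) ltac:(lra)) as H. pose proof (exp_pos (- (t / 2))).
replace (4 / t ^ 2) with (/ (t / 2) * / (t / 2)) by (field; lra).
apply Rmult_le_compat; lra.
Qed.

(** Far from sharp; a rate [1 / |x|] suffices to make the vertical sides of the contour
    disappear. *)
Lemma de_majorant_decay c0 a x : 0 <= c0 -> 0 < a -> 1 <= Rabs x ->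
  de_majorant c0 a x <= c0 * 8 / a ^ 2 / Rabs x.
Proof.
intros Hc Ha Hx. unfold de_majorant. rewrite Rabs_sinh. set (y := Rabs x) in *.
replace (cosh x) with (cosh y) by (unfold y, Rabs; destruct (Rcase_abs x); [apply cosh_opp|reflexivity]).
pose proof (sinh_ge_id y ltac:(lra)) as Hs. set (s := sinh y) in *.
assert (H1 : cosh y <= 1 + s).
{ apply Rsqr_incr_0_var; [|lra]. rewrite !Rsqr_pow2, cosh_sqr. fold s. nra. }
pose proof (exp_neg_le_sqr (a * s) ltac:(nra)) as H2.
replace (- a * s) with (- (a * s)) by ring.
apply Rle_trans with (c0 * ((1 + s) * (4 / (a * s) ^ 2))).
- apply Rmult_le_compat_l; [auto|]. apply Rmult_le_compat; auto; [left; apply cosh_pos|left; apply exp_pos].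
- unfold Rdiv. rewrite !Rmult_assoc. apply Rmult_le_compat_l; [auto|].
  replace ((1 + s) * (4 * / (a * s) ^ 2)) with (4 * / a ^ 2 * ((1 + s) * / s ^ 2)) by (field; lra).
  replace (8 * (/ a ^ 2 * / y)) with (4 * / a ^ 2 * (2 * / y)) by (field; lra).
  apply Rmult_le_compat_l.
  + apply Rmult_le_pos; [lra|]. left; apply Rinv_0_lt_compat, pow_lt; auto.
  + apply Rle_trans with (2 * / s).
    * apply Rmult_le_reg_r with (s ^ 2); [nra|].
      replace ((1 + s) * / s ^ 2 * s ^ 2) with (1 + s) by (field; lra).
      replace (2 * / s * s ^ 2) with (2 * s) by (field; lra). lra.
    * apply Rmult_le_compat_l; [lra|]. apply Rinv_le_contravar; lra.
Qed.

(** * Sums of the majorant over the grid, and truncation *)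

Lemma sinh_increment x h : (1 - exp (- h)) * cosh (x + h) <= sinh (x + h) - sinh x.
Proof.
unfold cosh, sinh. rewrite Ropp_plus_distr, !exp_plus, !exp_Ropp.
pose proof (exp_pos x). pose proof (exp_pos h).
set (E := exp x) in *. set (H' := exp h) in *.
assert (Hp : 0 <= / E * (1 - / H') ^ 2 / 2).
{ apply Rdiv_le_0_compat; [|lra]. apply Rmult_le_pos; [left; apply Rinv_0_lt_compat; auto|apply pow2_ge_0]. }
replace ((E * H' - / E * / H') / 2 - (E - / E) / 2) with
  ((1 - / H') * ((E * H' + / E * / H') / 2) + / E * (1 - / H') ^ 2 / 2) by (field; lra).
lra.
Qed.

(** For small [a] the majorant is not monotone on [x >= 0], so its sum is not compared with its
    integral directly. Instead [exp u - 1 >= u] bounds the decrement of [exp (- a * sinh x)] from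
    below, and [1 - exp (- h) >= h / (1 + h)] costs the factor [1 + h]. *)
Lemma majorant_step a h x : 0 < a -> 0 < h ->
  h * (cosh (x + h) * exp (- a * sinh (x + h))) <=
  (1 + h) / a * (exp (- a * sinh x) - exp (- a * sinh (x + h))).
Proof.
intros Ha Hh. pose proof (sinh_increment x h) as H1. pose proof (cosh_pos (x + h)) as H2.
assert (H3 : h <= (1 + h) * (1 - exp (- h))).
{ pose proof (exp_ineq1_le h). rewrite exp_Ropp.
  assert (/ exp h <= / (1 + h)) by (apply Rinv_le_contravar; lra).
  assert ((1 + h) * / (1 + h) = 1) by (field; lra). nra. }
set (S1 := sinh (x + h)) in *. set (S0 := sinh x) in *.
pose proof (exp_pos (- a * S1)) as H4.
replace (exp (- a * S0)) with (exp (- a * S1) * exp (a * (S1 - S0))) by (rewrite <- exp_plus; f_equal; ring).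
pose proof (exp_ineq1_le (a * (S1 - S0))) as H5.
apply Rle_trans with ((1 + h) / a * (exp (- a * S1) * (a * (S1 - S0)))).
- replace ((1 + h) / a * (exp (- a * S1) * (a * (S1 - S0)))) with
    ((1 + h) * (S1 - S0) * exp (- a * S1)) by (field; lra).
  rewrite <- Rmult_assoc. apply Rmult_le_compat_r; [lra|].
  apply Rle_trans with ((1 + h) * (1 - exp (- h)) * cosh (x + h)).
  + apply Rmult_le_compat_r; lra.
  + rewrite Rmult_assoc. apply Rmult_le_compat_l; lra.
- apply Rmult_le_compat_l; [apply Rdiv_le_0_compat; lra|]. nra.
Qed.

Lemma Cmod_Csum_telescope (u : nat -> C) (a : nat -> R) n :
  (forall i, (i < n)%nat -> Cmod (u i) <= a i - a (S i)) -> Cmod (Csum u n) <= a 0%nat - a n.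
Proof.
induction n as [|n IH]; intros H; simpl; [rewrite Cmod_0; lra|].
eapply Rle_trans; [apply Cmod_triangle|].
pose proof (H n (Nat.lt_succ_diag_r n)). specialize (IH (fun i Hi => H i (Nat.lt_lt_succ_r _ _ Hi))). lra.
Qed.

(* Minus a primitive of the majorant, up to the factor [1 + h] lost in [majorant_step]. *)
Definition tail_bound (c0 a h x : R) : R := c0 * (1 + h) / a * exp (- a * sinh x).

(** The weights are kept abstract because they are bounded in two ways: by [3/2 h] in the
    truncation, and by a small multiple of [h] when [J] is evaluated far to the left of the
    nodes. *)
Lemma tail_right (Fv : nat -> C) (Jv : nat -> R) c0 a h B N r :
  0 <= c0 -> 0 < a -> 0 < h -> 0 <= B ->
  (forall i, (i < r)%nat -> Cmod (Fv i) <= de_majorant c0 a (INR (N + 1 + i) * h)) ->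
  (forall i, (i < r)%nat -> Rabs (Jv i) <= B * h) ->
  Cmod (Csum (fun i => Fv i * RtoC (Jv i))%C r) <= B * tail_bound c0 a h (INR N * h).
Proof.
intros Hc Ha Hh HB HF HJ.
eapply Rle_trans.
- apply (Cmod_Csum_telescope _ (fun i => B * tail_bound c0 a h (INR (N + i) * h))).
  intros i Hi. rewrite Cmod_mult, Cmod_R.
  apply Rle_trans with (de_majorant c0 a (INR (N + 1 + i) * h) * (B * h)).
  + apply Rmult_le_compat; auto using Cmod_ge_0, Rabs_pos.
  + pose proof (majorant_step a h (INR (N + i) * h) Ha Hh) as Hst.
    replace (INR (N + S i) * h) with (INR (N + i) * h + h) by (rewrite Nat.add_succ_r, S_INR; ring).
    replace (INR (N + 1 + i) * h) with (INR (N + i) * h + h)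
      by (replace (N + 1 + i)%nat with (S (N + i)) by lia; rewrite S_INR; ring).
    set (x := INR (N + i) * h) in *. unfold de_majorant, tail_bound.
    assert (Hx : 0 <= x + h) by (unfold x; pose proof (pos_INR (N + i)); nra).
    rewrite Rabs_pos_eq by (apply sinh_nonneg, Hx).
    apply Rmult_le_compat_l with (r := B * c0) in Hst; [|apply Rmult_le_pos; auto].
    unfold Rdiv in *. lra.
- rewrite Nat.add_0_r.
  assert (0 <= B * tail_bound c0 a h (INR (N + r) * h)).
  { apply Rmult_le_pos; [auto|]. unfold tail_bound. apply Rmult_le_pos; [|left; apply exp_pos].
    apply Rdiv_le_0_compat; [apply Rmult_le_pos; lra|auto]. }
  lra.
Qed.

Lemma Csum_rev u n : Csum u n = Csum (fun i => u (n - 1 - i)%nat) n.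
Proof.
induction n as [|n IH]; [reflexivity|].
change (Csum u (S n)) with (Csum u n + u n)%C.
transitivity (Csum (fun i => u (S n - 1 - i)%nat) (1 + n)); [|reflexivity].
rewrite Csum_split, IH. simpl Csum at 2.
rewrite (Csum_ext (fun i => u (S n - 1 - (1 + i))%nat) (fun i => u (n - 1 - i)%nat)).
- simpl Csum at 2. replace (n - 0 - 0)%nat with n by lia. ring.
- intros i Hi. f_equal. lia.
Qed.

Lemma J_bound k h x : 0 < h -> Rabs (J k h x) <= 3 / 2 * h.
Proof.
intros Hh. pose proof PI2_3_2 as Hpi. unfold J. rewrite Rabs_mult, (Rabs_pos_eq h), Rmult_comm by lra.
apply Rmult_le_compat_r; [lra|]. pose proof (Si_bound (PI * (x / h - k))) as B.
apply Rabs_le_between in B.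
assert (H1 : 0 < 1 / PI) by (apply Rdiv_lt_0_compat; lra).
assert (H2 : 1 / PI * 3 <= 1).
{ apply Rmult_le_reg_r with PI; [lra|]. unfold Rdiv. rewrite Rmult_1_l, (Rmult_comm (/ PI)), Rmult_assoc, Rinv_l by lra. lra. }
apply Rabs_le. nra.
Qed.

(** To the left of the node the constant [1/2] in [J] is cancelled by the limit [- PI / 2] of [Si],
    so only the error of [Si_limit_bound] remains. *)
Lemma J_decay k h x : 0 < h -> x < k * h -> Rabs (J k h x) <= / (k - x / h) * h.
Proof.
intros Hh Hx. pose proof PI2_3_2 as Hpi.
assert (Hs : 0 < k - x / h).
{ apply Rmult_lt_reg_r with h; [auto|]. rewrite Rmult_minus_distr_r. unfold Rdiv.
  rewrite (Rmult_assoc x), Rinv_l by lra. lra. }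
unfold J. replace (PI * (x / h - k)) with (- (PI * (k - x / h))) by ring. rewrite Si_opp.
set (s := k - x / h) in *.
pose proof (Si_limit_bound (PI * s) ltac:(nra)) as B.
rewrite Rabs_mult, (Rabs_pos_eq h), Rmult_comm by lra. apply Rmult_le_compat_r; [lra|].
replace (1 / 2 + 1 / PI * - Si (PI * s)) with (- (1 / PI * (Si (PI * s) - PI / 2))) by (field; lra).
rewrite Rabs_Ropp, Rabs_mult, Rabs_pos_eq by (apply Rdiv_le_0_compat; lra).
apply Rle_trans with (1 / PI * (2 / (PI * s))).
- apply Rmult_le_compat_l; [apply Rdiv_le_0_compat; lra|exact B].
- replace (1 / PI * (2 / (PI * s))) with (2 / PI ^ 2 * / s) by (field; lra).
  rewrite <- (Rmult_1_l (/ s)) at 2. apply Rmult_le_compat_r; [left; apply Rinv_0_lt_compat; auto|].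
  apply Rmult_le_reg_r with (PI ^ 2); [nra|]. unfold Rdiv. rewrite Rmult_assoc, Rinv_l by nra. nra.
Qed.

Lemma Csum_three_parts u P M N : (M <= P)%nat -> (N <= P)%nat ->
  Csum u (2 * P + 1) = (Csum u (P - M) + Csum (fun i => u (P - M + i)%nat) (M + N + 1)
     + Csum (fun i => u (P + N + 1 + i)%nat) (P - N))%C.
Proof.
intros HM HN. replace (2 * P + 1)%nat with ((P - M + (M + N + 1)) + (P - N))%nat by lia.
rewrite Csum_split, (Csum_split u (P - M) (M + N + 1)). f_equal.
apply Csum_ext. intros i _. f_equal. lia.
Qed.

Lemma sumZ_Csum (g : Z -> C) (M N : nat) :
  sumZ g (- Z.of_nat M) (Z.of_nat N) = Csum (fun i => g (Z.of_nat i - Z.of_nat M)%Z) (M + N + 1).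
Proof.
unfold sumZ. replace (Z.to_nat (Z.of_nat N - - Z.of_nat M + 1)) with (M + N + 1)%nat by lia.
generalize (M + N + 1)%nat as n. intros n.
assert (H : forall l (a : C), fold_right Cplus a l = (fold_right Cplus 0 l + a)%C).
{ induction l as [|c l IH]; intros a; simpl; [ring|]. rewrite IH. ring. }
induction n as [|n IH]; [reflexivity|].
rewrite seq_S, map_app, fold_right_app, H, IH. simpl.
replace (- Z.of_nat M + Z.of_nat n)%Z with (Z.of_nat n - Z.of_nat M)%Z by lia. ring.
Qed.

Section Tails.
Variables (F : C -> C) (c1 a1 c2 a2 h : R).
Hypothesis Hc1 : 0 <= c1.
Hypothesis Hc2 : 0 <= c2.
Hypothesis Ha1 : 0 < a1.
Hypothesis Ha2 : 0 < a2.
Hypothesis Hh : 0 < h.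
Hypothesis HF1 : forall x, x < 0 -> Cmod (F (RtoC x)) <= de_majorant c1 a1 x.
Hypothesis HF2 : forall x, 0 <= x -> Cmod (F (RtoC x)) <= de_majorant c2 a2 x.

Lemma de_majorant_even c0 a x : de_majorant c0 a (- x) = de_majorant c0 a x.
Proof. unfold de_majorant. rewrite cosh_opp, sinh_opp, Rabs_Ropp. reflexivity. Qed.

Lemma node_sum_right (Jv : nat -> R) B P N r : 0 <= B ->
  (forall i, (i < r)%nat -> Rabs (Jv (P + N + 1 + i)%nat) <= B * h) ->
  Cmod (Csum (fun i => F (RtoC (node h P (P + N + 1 + i))) * RtoC (Jv (P + N + 1 + i)%nat))%C r)
    <= B * tail_bound c2 a2 h (INR N * h).
Proof.
intros HB HJ. apply (tail_right (fun i => F (RtoC (node h P (P + N + 1 + i)))) (fun i => Jv (P + N + 1 + i)%nat)); auto.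
intros i _. replace (node h P (P + N + 1 + i)) with (INR (N + 1 + i) * h).
- apply HF2. apply Rmult_le_pos; [apply pos_INR|lra].
- unfold node. rewrite <- !Nat.add_assoc, (plus_INR P). ring.
Qed.

(** The equation [s + r + M = P] places the block on the grid points from [- (M + r) h] to
    [- (M + 1) h]; read backwards and reflected it is a right tail. *)
Lemma node_sum_left (Jv : nat -> R) B P M s r : 0 <= B -> (s + r + M = P)%nat ->
  (forall i, (i < r)%nat -> Rabs (Jv (s + i)%nat) <= B * h) ->
  Cmod (Csum (fun i => F (RtoC (node h P (s + i))) * RtoC (Jv (s + i)%nat))%C r)
    <= B * tail_bound c1 a1 h (INR M * h).
Proof.
intros HB HP HJ. rewrite Csum_rev.
apply (tail_right (fun i => F (RtoC (node h P (s + (r - 1 - i))))) (fun i => Jv (s + (r - 1 - i))%nat)); auto.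
- intros i Hi. replace (node h P (s + (r - 1 - i))) with (- (INR (M + 1 + i) * h)).
  + rewrite <- de_majorant_even. apply HF1.
    assert (0 < INR (M + 1 + i)) by (apply lt_0_INR; lia). nra.
  + unfold node. replace P with ((s + (r - 1 - i)) + (M + 1 + i))%nat by lia.
    rewrite (plus_INR (s + (r - 1 - i))). ring.
- intros i Hi. apply HJ. lia.
Qed.

Definition J_sum (P : nat) (x : R) : C :=
  Csum (fun i => F (RtoC (node h P i)) * RtoC (J (INR i - INR P) h x))%C (2 * P + 1).

Lemma truncation_bound (P M N : nat) x : (M <= P)%nat -> (N <= P)%nat ->
  Cmod (J_sum P x - sumZ (fun k => F (RtoC (IZR k * h)) * RtoC (J (IZR k) h x))%C (- Z.of_nat M) (Z.of_nat N))
   <= 3 / 2 * (tail_bound c1 a1 h (INR M * h) + tail_bound c2 a2 h (INR N * h)).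
Proof.
intros HM HN. unfold J_sum. rewrite (Csum_three_parts _ P M N HM HN), sumZ_Csum.
rewrite (Csum_ext (fun i => F (RtoC (IZR (Z.of_nat i - Z.of_nat M) * h)) * _)%C
   (fun i => F (RtoC (node h P (P - M + i))) * RtoC (J (INR (P - M + i) - INR P) h x))%C).
2:{ intros i _. assert (E : IZR (Z.of_nat i - Z.of_nat M) = INR (P - M + i) - INR P).
  { rewrite minus_IZR, <- !INR_IZR_INZ, plus_INR, minus_INR by lia. ring. }
  rewrite E. unfold node. reflexivity. }
pose proof (node_sum_left (fun i => J (INR i - INR P) h x) (3 / 2) P M 0 (P - M) ltac:(lra) ltac:(lia)
  (fun i _ => J_bound _ h x Hh)) as B1.
pose proof (node_sum_right (fun i => J (INR i - INR P) h x) (3 / 2) P N (P - N) ltac:(lra)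
  (fun i _ => J_bound _ h x Hh)) as B2.
simpl Nat.add in B1. cbv beta in B1, B2.
match goal with |- Cmod (?X + ?Y + ?Z - ?Y') <= _ => replace (X + Y + Z - Y')%C with (X + Z)%C by ring end.
eapply Rle_trans; [apply Cmod_triangle|]. lra.
Qed.

Lemma tail_bound_le_inv c0 a x : 0 <= c0 -> 0 < a -> 0 < x ->
  tail_bound c0 a h x <= c0 * (1 + h) / a ^ 2 / x.
Proof.
intros Hc Ha Hx. unfold tail_bound. pose proof (sinh_ge_id x ltac:(lra)).
assert (H1 : exp (- a * sinh x) <= / (a * x)).
{ eapply Rle_trans; [|apply exp_neg_le; nra]. apply exp_le_mono. nra. }
apply Rle_trans with (c0 * (1 + h) / a * / (a * x)).
- apply Rmult_le_compat_l; [|exact H1]. apply Rdiv_le_0_compat; [apply Rmult_le_pos; lra|auto].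
- right. field. lra.
Qed.

(** Split at [q], about half of [j]. Nodes left of [- q h] carry little mass of [F], and the uniform
    bound on [J] suffices; the others are at least [j h / 2] to the right of the evaluation point,
    where [J_decay] gives [2 h / j]. *)
Lemma J_sum_left_end : exists C0, 0 <= C0 /\ forall j, (2 <= j)%nat ->
  Cmod (J_sum (2 * j + 1) (- ((INR j + 1 / 2) * h))) <= C0 / INR j.
Proof.
set (S0 := tail_bound c1 a1 h 0 + de_majorant c2 a2 0 * h + tail_bound c2 a2 h 0).
set (L0 := 3 / 2 * (c1 * (1 + h) / a1 ^ 2 / h)).
assert (TB : forall c0 a x, 0 <= c0 -> 0 < a -> 0 <= tail_bound c0 a h x).
{ intros c0 a x Hc Ha. apply Rmult_le_pos; [|left; apply exp_pos].
  apply Rdiv_le_0_compat; [apply Rmult_le_pos; lra|auto]. }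
assert (HS : 0 <= S0).
{ unfold S0. pose proof (TB c1 a1 0 Hc1 Ha1). pose proof (TB c2 a2 0 Hc2 Ha2).
  assert (0 <= de_majorant c2 a2 0 * h); [|lra]. apply Rmult_le_pos; [|lra].
  apply Rmult_le_pos; [auto|]. apply Rmult_le_pos; left; [apply cosh_pos|apply exp_pos]. }
assert (HT : 0 <= c1 * (1 + h) / a1 ^ 2 / h).
{ apply Rdiv_le_0_compat; [apply Rdiv_le_0_compat; [apply Rmult_le_pos; lra|apply pow_lt; auto]|auto]. }
assert (HL : 0 <= L0).
{ unfold L0. lra. }
exists (S0 * 2 + L0 * 4). split; [lra|]. intros j Hj.
set (P := (2 * j + 1)%nat). set (q := (j / 2)%nat).
assert (Hq : (2 * q <= j /\ j < 2 * q + 2)%nat).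
{ pose proof (Nat.div_mod j 2 ltac:(lia)). pose proof (Nat.mod_upper_bound j 2 ltac:(lia)). unfold q. lia. }
assert (HjR : 2 <= INR j) by (apply (le_INR 2); exact Hj).
assert (HqR : INR j / 4 <= INR q).
{ assert (INR j <= INR (4 * q)) by (apply le_INR; lia). rewrite mult_INR in *. simpl in *. lra. }
set (x := - ((INR j + 1 / 2) * h)).
assert (HJ : forall i, (P - q <= i)%nat -> Rabs (J (INR i - INR P) h x) <= 2 / INR j * h).
{ intros i Hi. assert (Hi2 : INR P - INR q <= INR i).
  { rewrite <- minus_INR by (unfold P; lia). apply le_INR, Hi. }
  assert (Hq2 : INR q <= INR j / 2).
  { assert (INR (2 * q) <= INR j) by (apply le_INR; lia). rewrite mult_INR in *. simpl in *. lra. }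
  assert (Hk : INR j / 2 <= INR i - INR P - x / h).
  { unfold x. replace (- ((INR j + 1 / 2) * h) / h) with (- (INR j + 1 / 2)) by (field; lra). lra. }
  eapply Rle_trans; [apply J_decay; auto|].
  - unfold x in *. replace (- ((INR j + 1 / 2) * h) / h) with (- (INR j + 1 / 2)) in Hk by (field; lra). nra.
  - apply Rmult_le_compat_r; [lra|]. replace (2 / INR j) with (/ (INR j / 2)) by (field; lra).
    apply Rinv_le_contravar; lra. }
assert (Hj2 : 0 <= 2 / INR j) by (apply Rdiv_le_0_compat; lra).
unfold J_sum. rewrite (Csum_three_parts _ P q 0) by (unfold P; lia).
(* The node 0 is separated because only the majorant for [x >= 0] covers it. *)
replace (q + 0 + 1)%nat with (q + 1)%nat by lia. rewrite (Csum_split _ q 1). fold x.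
pose proof (node_sum_left (fun i => J (INR i - INR P) h x) (3 / 2) P q 0 (P - q) ltac:(lra) ltac:(unfold P; lia)
  (fun i _ => J_bound _ h x Hh)) as B1.
pose proof (node_sum_left (fun i => J (INR i - INR P) h x) (2 / INR j) P 0 (P - q) q Hj2 ltac:(unfold P; lia)
  (fun i _ => HJ (P - q + i)%nat ltac:(lia))) as B2.
pose proof (node_sum_right (fun i => J (INR i - INR P) h x) (2 / INR j) P 0 (P - 0) Hj2
  (fun i _ => HJ (P + 0 + 1 + i)%nat ltac:(lia))) as B3.
cbv beta in B1, B2, B3. simpl INR in B2, B3. rewrite Rmult_0_l in B2, B3.
assert (B4 : Cmod (F (RtoC (node h P (P - q + (q + 0)))) * RtoC (J (INR (P - q + (q + 0)) - INR P) h x))%C <= de_majorant c2 a2 0 * (2 / INR j * h)).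
{ rewrite Cmod_mult, Cmod_R. replace (node h P (P - q + (q + 0))) with 0.
  - apply Rmult_le_compat; auto using Cmod_ge_0, Rabs_pos; [apply HF2; lra|apply HJ; lia].
  - unfold node. replace (P - q + (q + 0))%nat with P by (unfold P; lia). ring. }
assert (B5 : tail_bound c1 a1 h (INR q * h) <= c1 * (1 + h) / a1 ^ 2 / h * (4 / INR j)).
{ eapply Rle_trans; [apply tail_bound_le_inv; auto|].
  - apply Rmult_lt_0_compat; lra.
  - replace (c1 * (1 + h) / a1 ^ 2 / (INR q * h)) with (c1 * (1 + h) / a1 ^ 2 / h * / INR q) by (field; repeat split; lra).
    apply Rmult_le_compat_l; [exact HT|].
    replace (4 / INR j) with (/ (INR j / 4)) by (field; lra). apply Rinv_le_contravar; lra. }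
match goal with |- context [Csum ?u 1] => replace (Csum u 1) with (u 0%nat) by (simpl; ring) end.
cbv beta.
eapply Rle_trans; [apply Cmod_triangle|].
eapply Rle_trans; [apply Rplus_le_compat_r, Cmod_triangle|].
eapply Rle_trans; [apply Rplus_le_compat_r, Rplus_le_compat_l, Cmod_triangle|].
apply Rle_trans with (L0 * (4 / INR j) + (2 / INR j * tail_bound c1 a1 h 0 + de_majorant c2 a2 0 * (2 / INR j * h)) + 2 / INR j * tail_bound c2 a2 h 0).
- apply Rplus_le_compat; [apply Rplus_le_compat; [|apply Rplus_le_compat]|]; auto.
  + eapply Rle_trans; [exact B1|]. unfold L0. rewrite Rmult_assoc. apply Rmult_le_compat_l; [lra|exact B5].
- right. unfold S0. field. lra.
Qed.

End Tails.

(** * The improper integral *)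

Lemma Cminus_swap_Cmod (u v : C) : Cmod (u - v) = Cmod (v - u).
Proof. rewrite <- Cmod_opp. f_equal. ring. Qed.

Section Improper.
Variables (g : R -> C) (c0 a : R).
Hypothesis Hc : 0 <= c0.
Hypothesis Ha : 0 < a.
Hypothesis Hg : forall x, continuousC g x.
Hypothesis Hb : forall x, x < 0 -> Cmod (g x) <= de_majorant c0 a x.

Lemma CInt_left_tail b b' : b <= b' -> b' < 0 ->
  Cmod (CInt g b b') <= c0 / a * exp (- a * sinh (- b')).
Proof.
intros H1 H2.
pose proof (is_RInt_majorant_left c0 a (- b) Ha ltac:(lra)) as I1.
pose proof (is_RInt_majorant_left c0 a (- b') Ha ltac:(lra)) as I2.
rewrite Ropp_involutive in I1, I2.
apply (is_RInt_swap (V := R_NormedModule)) in I2.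
pose proof (is_RInt_Chasles (V := R_NormedModule) _ _ _ _ _ _ I1 I2) as I3.
eapply Rle_trans.
- apply (is_CInt_Cmod_le g (de_majorant c0 a) b b' _ _ H1).
  + intros t Ht. apply Hb; lra.
  + apply is_CInt_CInt. intros; apply Hg.
  + exact I3.
- unfold plus, opp; simpl.
  assert (0 <= c0 / a * exp (- a * sinh (- b))).
  { apply Rmult_le_pos; [apply Rdiv_le_0_compat; auto|left; apply exp_pos]. }
  lra.
Qed.

Lemma CInt_Chasles_any u v w : CInt g u w = (CInt g u v + CInt g v w)%C.
Proof. apply CInt_unique, is_CInt_Chasles with v; apply is_CInt_CInt; intros; apply Hg. Qed.

(** Cauchy's criterion from the explicit primitive of the majorant. The rate in the second half is
    what remains of it when the limit is replaced by an integral from [- A]. *)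
Lemma improper_integral xi : exists I : C,
  filterlim (fun b => CInt g b xi) (Rbar_locally m_infty) (locally (T := C_UniformSpace) I) /\
  forall A, 0 < A -> Cmod (I - CInt g (- A) xi) <= c0 / a * exp (- a * sinh A).
Proof.
assert (Tail : forall A b, 0 < A -> b <= - A ->
  Cmod (CInt g b xi - CInt g (- A) xi) <= c0 / a * exp (- a * sinh A)).
{ intros A b HA Hb'. rewrite (CInt_Chasles_any b (- A) xi).
  replace (CInt g b (- A) + CInt g (- A) xi - CInt g (- A) xi)%C with (CInt g b (- A)) by ring.
  replace A with (- - A) at 2 by ring. apply CInt_left_tail; lra. }
assert (Small : forall A, 0 < A -> c0 / a * exp (- a * sinh A) <= c0 / a ^ 2 / A).
{ intros A HA. pose proof (sinh_ge_id A ltac:(lra)).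
  assert (H1 : exp (- a * sinh A) <= / (a * A)).
  { eapply Rle_trans; [|apply exp_neg_le; nra]. apply exp_le_mono. nra. }
  apply Rle_trans with (c0 / a * / (a * A)).
  - apply Rmult_le_compat_l; [|exact H1]. apply Rdiv_le_0_compat; auto.
  - right. field. lra. }
destruct (proj1 (filterlim_locally_cauchy (U := C_R_CompleteNormedModule) (F := Rbar_locally m_infty)
   (fun b => CInt g b xi))) as [I HI].
(* Two tails beyond [A] together stay below [eps]; the added 1 makes this strict. *)
- intros eps. set (A := 2 * (c0 / a ^ 2) / eps + 1).
  assert (Hca : 0 <= c0 / a ^ 2) by (apply Rdiv_le_0_compat; [auto|apply pow_lt; auto]).
  assert (HA : 0 < A). { unfold A. assert (0 <= 2 * (c0 / a ^ 2) / eps) by (apply Rdiv_le_0_compat; [lra|apply cond_pos]). lra. }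
  assert (HS : 2 * (c0 / a * exp (- a * sinh A)) < eps).
  { eapply Rle_lt_trans; [apply Rmult_le_compat_l; [lra|apply Small, HA]|].
    apply Rmult_lt_reg_r with A; [auto|]. replace (2 * (c0 / a ^ 2 / A) * A) with (2 * (c0 / a ^ 2)) by (field; lra).
    unfold A. pose proof (cond_pos eps). replace (eps * (2 * (c0 / a ^ 2) / eps + 1)) with (2 * (c0 / a ^ 2) + eps) by (field; lra).
    lra. }
  exists (fun b => b < - A). split; [exists (- A); auto|].
  intros u v Hu Hv. apply C_NormedModule_mixin_compat1.
  change (Cmod (CInt g v xi - CInt g u xi) < eps).
  replace (CInt g v xi - CInt g u xi)%C with ((CInt g v xi - CInt g (- A) xi) + (CInt g (- A) xi - CInt g u xi))%C by ring.
  eapply Rle_lt_trans; [apply Cmod_triangle|]. rewrite (Cminus_swap_Cmod (CInt g (- A) xi)).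
  pose proof (Tail A u HA ltac:(lra)). pose proof (Tail A v HA ltac:(lra)). lra.
- exists I. split; [exact HI|]. intros A HA. apply Rle_plus_epsilon. intros e He.
  assert (H1 : Rbar_locally m_infty (fun b => Cmod (CInt g b xi - I) < e)).
  { apply (HI (fun y : C => Cmod (y - I) < e)). apply locally_C_Cmod. exists e; auto. }
  destruct H1 as [B HB]. set (b := Rmin (- A) (B - 1)).
  assert (Hb1 : b <= - A) by apply Rmin_l. assert (Hb2 : b < B) by (pose proof (Rmin_r (- A) (B - 1)); unfold b; lra).
  specialize (HB b Hb2). pose proof (Tail A b HA Hb1) as HT.
  replace (I - CInt g (- A) xi)%C with ((CInt g b xi - CInt g (- A) xi) + (I - CInt g b xi))%C by ring.
  eapply Rle_trans; [apply Cmod_triangle|]. rewrite (Cminus_swap_Cmod I). lra.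
Qed.

End Improper.

Lemma psi_incr x y : x < y -> psi x < psi y.
Proof.
intros H. unfold psi. apply sinh_lt, Rmult_lt_compat_l; [pose proof PI_RGT_0; lra|]. apply sinh_lt, H.
Qed.

Lemma psi_psi_inv x : psi (psi_inv x) = x.
Proof.
pose proof PI_RGT_0. unfold psi, psi_inv.
(* [arsinh] is convertible to the library function [arcsinh]. *)
change (arsinh (2 / PI * arsinh x)) with (arcsinh (2 / PI * arsinh x)). rewrite sinh_arcsinh.
replace (PI / 2 * (2 / PI * arsinh x)) with (arsinh x) by (field; lra).
apply sinh_arcsinh.
Qed.

Lemma is_CInt_psi (f : C -> C) a b :
  (forall t, continuousC (fun t => f (RtoC t)) t) ->
  is_CInt (fun t => f (RtoC t)) (psi a) (psi b) (CInt (fun x => F_de f (RtoC x)) a b).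
Proof.
intros Hf.
assert (Cd : forall x, continuous dpsi x).
{ intros x. apply continuity_pt_filterlim. unfold dpsi, cosh, sinh. reg. }
assert (E : CInt (fun x => F_de f (RtoC x)) a b = CInt (fun t => f (RtoC t)) (psi a) (psi b)).
{ pose proof (is_RInt_comp (V := C_R_CompleteNormedModule) (fun t => f (RtoC t)) psi dpsi a b
    (fun x _ => Hf (psi x)) (fun x _ => conj (is_derive_psi x) (Cd x))) as Hc.
  apply (is_RInt_unique (V := C_R_CompleteNormedModule)) in Hc. etransitivity; [|exact Hc].
  apply CInt_ext. intros x _. unfold F_de. rewrite psiC_real, dpsiC_real.
  apply C_ext; unfold scal; simpl; unfold prod_scal, scal; simpl; unfold mult; simpl; ring. }
rewrite E. apply is_CInt_CInt. intros; apply Hf.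
Qed.

(** * Explicit constants *)

Lemma exp_ge_e_mul t : exp 1 * t <= exp t.
Proof.
replace t with (1 + (t - 1)) at 2 by ring. rewrite exp_plus.
apply Rmult_le_compat_l; [left; apply exp_pos|]. pose proof (exp_ineq1_le (t - 1)). lra.
Qed.

Lemma e_ge_2 : 2 <= exp 1.
Proof. pose proof (exp_ineq1_le 1). lra. Qed.

(** An equality at [L = 1], hence the case split. With [t = L - 1]: for [t >= 2/3] the term [e x t]
    alone suffices, where [x = exp t]; for smaller [t] one uses [x (1 - t) <= 1]. *)
Lemma truncation_aux L : 1 <= L -> exp L * (L + 1) <= 2 * exp 1 * (L + exp L * (L - 1)).
Proof.
intros HL. set (t := L - 1). replace L with (1 + t) by (unfold t; ring). assert (Ht : 0 <= t) by (unfold t; lra).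
rewrite exp_plus. pose proof e_ge_2 as He. pose proof (exp_pos t) as Hp. set (x := exp t) in *. set (e := exp 1) in *.
replace (1 + t - 1) with t by ring.
assert (Hxt : 0 <= x * t) by (apply Rmult_le_pos; lra).
assert (Hext : 2 * (x * t) <= e * x * t) by (rewrite Rmult_assoc; apply Rmult_le_compat_r; lra).
assert (Key : x * (t + 2) <= 2 * ((1 + t) + e * x * t)).
{ destruct (Rle_dec (2 / 3) t) as [L1|L1].
  - assert (x * (t + 2) <= x * (4 * t)) by (apply Rmult_le_compat_l; lra).
    lra.
  - assert (Hx : x * (1 - t) <= 1).
    { pose proof (exp_ineq1_le (- t)) as E1. rewrite exp_Ropp in E1. fold x in E1.
      apply Rle_trans with (x * / x); [apply Rmult_le_compat_l; lra|right; field; lra]. }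
    nra. }
assert (0 < e) by lra. nra.
Qed.

(** Used with [y = d n] and [m = PI mu / 4]. Since [PI y = m exp L], the exponent times [L] equals
    [m (L + exp L (L - 1))], and [exp t >= e t] reduces the claim to [truncation_aux]. *)
Lemma truncation_const (m y d L : R) : 0 < m -> 1 <= L -> y = m * exp L / PI -> 0 < d <= y ->
  3 / 2 * (y + d * L) <= L * exp (m + PI * y - PI * y / L).
Proof.
intros Hm HL Hy Hd. pose proof PI2_3_2 as Hpi.
pose proof (truncation_aux L HL) as H1. pose proof (exp_ge_e_mul (m + PI * y - PI * y / L)) as H2.
pose proof (exp_pos L) as HE. pose proof e_ge_2 as He. set (e := exp 1) in *. set (E := exp L) in *.
assert (HX : L * (m + PI * y - PI * y / L) = m * (L + E * (L - 1))) by (rewrite Hy; field; lra).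
assert (H3 : e * (m * (L + E * (L - 1))) <= L * exp (m + PI * y - PI * y / L)).
{ rewrite <- HX. replace (e * (L * (m + PI * y - PI * y / L))) with (L * (e * (m + PI * y - PI * y / L))) by ring.
  apply Rmult_le_compat_l; lra. }
eapply Rle_trans; [|exact H3].
assert (H4 : 3 / 2 * (y + d * L) <= 3 / 2 * (y * (1 + L))) by nra.
eapply Rle_trans; [exact H4|].
assert (H5 : 3 / 2 * (y * (1 + L)) <= m * (E * (L + 1)) / 2).
{ assert (3 * y <= m * E).
  { assert (Hy' : y * PI = m * E) by (rewrite Hy; field; lra).
    rewrite <- Hy'. nra. }
  nra. }
nra.
Qed.

Lemma Rpower_le_exponent Q g nu : 1 <= Q -> g <= nu -> Rpower Q g <= Rpower Q nu.
Proof. intros [HQ| <-] Hg; [apply Rle_Rpower; lra|unfold Rpower; rewrite ln_1, !Rmult_0_r; lra]. Qed.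

(** From [sinh T >= (exp T - 1) / 2]: the part [exp T] gives [exp (- PI y)], and the 1 gives the
    factor [exp (PI g / 4)] of the final constant. *)
Lemma tail_bound_param (K g mu nu h T y : R) :
  0 < K -> 0 < mu -> mu <= g <= nu -> 0 < h -> 0 <= T -> 4 * y <= g * exp T ->
  tail_bound (K * (PI / 2) * Rpower 2 g) (g * (PI / 2)) h T <=
   K * Rpower 2 nu * (1 + h) / mu * (exp (PI * g / 4) * exp (- (PI * y))).
Proof.
intros HK Hmu Hg Hh HT Hy. pose proof PI_RGT_0 as Hpi. unfold tail_bound.
replace (K * (PI / 2) * Rpower 2 g * (1 + h) / (g * (PI / 2))) with (K * (1 + h) * (Rpower 2 g * / g)) by (field; lra).
replace (K * Rpower 2 nu * (1 + h) / mu) with (K * (1 + h) * (Rpower 2 nu * / mu)) by (field; lra).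
pose proof (exp_pos (g * ln 2)) as Hp. fold (Rpower 2 g) in Hp.
assert (0 < / g) by (apply Rinv_0_lt_compat; lra).
apply Rmult_le_compat.
- apply Rmult_le_pos; [apply Rmult_le_pos; lra|]. apply Rmult_le_pos; lra.
- left; apply exp_pos.
- apply Rmult_le_compat_l; [apply Rmult_le_pos; lra|].
  apply Rmult_le_compat; try lra; [apply Rpower_le_exponent; lra|apply Rinv_le_contravar; lra].
- rewrite <- exp_plus. apply exp_le_mono. unfold sinh.
  assert (exp (- T) <= 1) by (rewrite <- exp_0; apply exp_le_mono; lra).
  assert (H1 : g * exp (- T) <= g * 1) by (apply Rmult_le_compat_l; lra).
  assert (H2 : PI * (4 * y) <= PI * (g * exp T - g * exp (- T) + g)) by (apply Rmult_le_compat_l; lra).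
  lra.
Qed.

Lemma truncation_total (K al be d L nn h M N : R) :
  0 < K -> 0 < al -> 0 < be -> 0 < d -> 1 <= nn -> 1 <= L -> h = L / nn ->
  exp L = 4 * d * nn / Rmin al be ->
  0 <= M * h -> 0 <= N * h ->
  4 * (d * nn) <= al * exp (M * h) -> 4 * (d * nn) <= be * exp (N * h) ->
  3 / 2 * (tail_bound (K * (PI / 2) * Rpower 2 al) (al * (PI / 2)) h (M * h)
         + tail_bound (K * (PI / 2) * Rpower 2 be) (be * (PI / 2)) h (N * h)) <=
  Rpower 2 (Rmax al be + 1) * K / (Rmin al be * d) * exp (PI * (al + be) / 4)
    * (exp (- (PI * d * nn / L)) * L / nn).
Proof.
intros HK Hal Hbe Hd Hn HL Eh EL HM HN HM1 HN1. pose proof PI_RGT_0 as Hpi.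
set (mu := Rmin al be) in *. set (nu := Rmax al be) in *.
assert (Hmu : 0 < mu) by (apply Rmin_glb_lt; auto).
assert (Hmal : mu <= al) by apply Rmin_l. assert (Hmbe : mu <= be) by apply Rmin_r.
assert (Hnal : al <= nu) by apply Rmax_l. assert (Hnbe : be <= nu) by apply Rmax_r.
assert (Hh : 0 < h) by (rewrite Eh; apply Rdiv_lt_0_compat; lra).
pose proof (tail_bound_param K al mu nu h (M * h) (d * nn) HK Hmu ltac:(lra) Hh HM HM1) as B1.
pose proof (tail_bound_param K be mu nu h (N * h) (d * nn) HK Hmu ltac:(lra) Hh HN HN1) as B2.
set (m := PI * mu / 4).
assert (Key : 3 / 2 * (d * nn + d * L) <= L * exp (m + PI * (d * nn) - PI * (d * nn) / L)).
{ apply truncation_const; auto.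
  - unfold m. apply Rdiv_lt_0_compat; [apply Rmult_lt_0_compat|]; lra.
  - rewrite EL. unfold m. field. lra.
  - nra. }
replace (m + PI * (d * nn) - PI * (d * nn) / L) with (m + (PI * (d * nn) + - (PI * d * nn / L))) in Key by (field; lra).
rewrite !exp_plus in Key.
set (ea := exp (PI * al / 4)) in *. set (eb := exp (PI * be / 4)) in *.
replace (exp (PI * (al + be) / 4)) with (ea * eb) by (unfold ea, eb; rewrite <- exp_plus; f_equal; field).
rewrite Rpower_plus, Rpower_1 by lra.
set (R2 := Rpower 2 nu) in *. assert (HR2 : 0 < R2) by apply exp_pos.
assert (Hea : exp m <= ea) by (unfold ea, m; apply exp_le_mono; nra).
assert (Heb : exp m <= eb) by (unfold eb, m; apply exp_le_mono; nra).
set (em := exp m) in *. assert (Hem : 0 < em) by apply exp_pos.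
set (q := exp (- (PI * d * nn / L))) in *.
(* Both [ea] and [eb] are at least [em]. This turns the sum over the two tails into the product in
   the constant, and the 2 is the extra power of 2 there. *)
assert (Hab : em * (ea + eb) <= 2 * (ea * eb)) by nra.
set (p := exp (- (PI * (d * nn)))) in *. assert (Hp : 0 < p) by apply exp_pos.
replace (exp (PI * (d * nn))) with (/ p) in Key by (unfold p; rewrite exp_Ropp, Rinv_inv; reflexivity).
apply Rle_trans with (K * R2 / mu * p * (3 / 2 * (1 + h) * (ea + eb))).
{ replace (K * R2 / mu * p * (3 / 2 * (1 + h) * (ea + eb))) with
   (3 / 2 * (K * R2 * (1 + h) / mu * (ea * p) + K * R2 * (1 + h) / mu * (eb * p))) by (field; lra).
  lra. }
assert (Key2 : 3 / 2 * (1 + h) * p <= em * q * h / d).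
{ apply Rmult_le_reg_r with (d * nn / p); [apply Rdiv_lt_0_compat; nra|].
  replace (em * q * h / d * (d * nn / p)) with (L * (em * (/ p * q))) by (rewrite Eh; field; lra).
  replace (3 / 2 * (1 + h) * p * (d * nn / p)) with (3 / 2 * (d * nn + d * L)) by (rewrite Eh; field; lra).
  exact Key. }
replace (K * R2 / mu * p * (3 / 2 * (1 + h) * (ea + eb))) with (K * R2 / mu * (ea + eb) * (3 / 2 * (1 + h) * p)) by (field; lra).
assert (Hea0 : 0 < ea) by apply exp_pos. assert (Heb0 : 0 < eb) by apply exp_pos.
assert (Hq : 0 < q) by apply exp_pos.
apply Rle_trans with (K * R2 / mu * (ea + eb) * (em * q * h / d)).
- apply Rmult_le_compat_l; [|exact Key2]. apply Rmult_le_pos; [|lra]. apply Rdiv_le_0_compat; [nra|auto].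
- replace (R2 * 2 * K / (mu * d) * (ea * eb) * (q * L / nn)) with (K * R2 / mu * q * h / d * (2 * (ea * eb)))
    by (rewrite Eh; field; lra).
  replace (K * R2 / mu * (ea + eb) * (em * q * h / d)) with (K * R2 / mu * q * h / d * (em * (ea + eb))) by (field; lra).
  apply Rmult_le_compat_l; [|exact Hab].
  repeat apply Rmult_le_pos; try lra; left; apply Rinv_0_lt_compat; auto.
Qed.

(** The first term of [discretization_partial] at height [e], with the integral of the majorant
    estimated in [is_RInt_mj]. *)
Definition disc_bound (K mu nu h e : R) : R :=
  / PI * (h / PI * ((1 + PI) / e) *
    (2 * K * Rpower (2 / cos (PI / 2 * sin e)) nu / (mu * cos e) * / sinh (PI / h * e))).

Lemma cos_psi_pos e : 0 <= e -> e < PI / 2 -> 0 < cos (PI / 2 * sin e).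
Proof.
intros H0 H1. pose proof (sin_ge_0 e H0 ltac:(lra)).
assert (sin e < 1) by (rewrite <- sin_PI2; apply sin_increasing_1; lra).
apply cos_gt_0; nra.
Qed.

Lemma disc_bound_continuous K mu nu h e : 0 < mu -> 0 < h -> 0 < e < PI / 2 ->
  continuous (disc_bound K mu nu h) e.
Proof.
intros Hmu Hh He. pose proof PI_RGT_0 as Hpi.
assert (H1 : 0 < cos (PI / 2 * sin e)) by (apply cos_psi_pos; lra).
assert (H2 : 0 < cos e) by (apply cos_gt_0; lra).
assert (H3 : 0 < sinh (PI / h * e)).
{ apply sinh_pos, Rmult_lt_0_compat; [apply Rdiv_lt_0_compat; lra|lra]. }
apply (ex_derive_continuous (V := R_NormedModule)). unfold disc_bound, Rpower, sinh in *.
auto_derive. repeat split; try lra.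
- apply Rdiv_lt_0_compat; lra.
- apply Rmult_integral_contrapositive; lra.
Qed.

Lemma disc_bound_le (K al be d L nn h : R) :
  0 < K -> 0 < al -> 0 < be -> 0 < d -> d < PI / 2 -> 0 < nn -> 1 <= L -> h = L / nn ->
  exp L = 4 * d * nn / Rmin al be ->
  disc_bound K (Rmin al be) (Rmax al be) h d <=
  Rpower 2 (Rmax al be + 1) * K / (Rmin al be * d) *
   (1 / ((1 - exp (- (PI * Rmin al be * exp 1 / 2))) * Rpower (cos (PI / 2 * sin d)) (Rmax al be) * cos d))
    * (exp (- (PI * d * nn / L)) * L / nn).
Proof.
intros HK Hal Hbe Hd Hd2 Hn HL Eh EL. pose proof PI2_3_2 as Hpi.
set (mu := Rmin al be) in *. set (nu := Rmax al be) in *.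
assert (Hmu : 0 < mu) by (apply Rmin_glb_lt; auto).
assert (Hh : 0 < h) by (rewrite Eh; apply Rdiv_lt_0_compat; lra).
unfold disc_bound.
assert (Hcw : 0 < cos (PI / 2 * sin d)) by (apply cos_psi_pos; lra).
set (cw := cos (PI / 2 * sin d)) in *.
assert (Hcd : 0 < cos d) by (apply cos_gt_0; lra).
assert (E1 : Rpower (2 / cw) nu = Rpower 2 nu * / Rpower cw nu).
{ unfold Rpower. rewrite <- exp_Ropp, <- exp_plus. unfold Rdiv.
  rewrite ln_mult, ln_Rinv by (try apply Rinv_0_lt_compat; lra). f_equal. ring. }
rewrite E1, Rpower_plus, Rpower_1 by lra.
set (R2 := Rpower 2 nu). assert (HR2 : 0 < R2) by apply exp_pos.
set (Rc := Rpower cw nu). assert (HRc : 0 < Rc) by apply exp_pos.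
set (s := PI / h * d).
assert (Hs : 0 < s) by (unfold s; apply Rmult_lt_0_compat; [apply Rdiv_lt_0_compat; lra|lra]).
assert (Es : PI * d * nn / L = s) by (unfold s; rewrite Eh; field; lra).
rewrite Es.
(* Here [2 s = 2 PI d n / L = PI mu exp L / (2 L)], and [exp L >= exp 1 * L]; this is the origin of
   the exponent [PI mu e / 2]. *)
assert (Hs2 : PI * mu * exp 1 / 2 <= 2 * s).
{ rewrite <- Es. pose proof (exp_ge_e_mul L) as HeL. rewrite EL in HeL.
  apply Rmult_le_reg_r with (L / mu); [apply Rdiv_lt_0_compat; lra|].
  replace (2 * (PI * d * nn / L) * (L / mu)) with (PI / 2 * (4 * d * nn / mu)) by (field; lra).
  replace (PI * mu * exp 1 / 2 * (L / mu)) with (PI / 2 * (exp 1 * L)) by (field; lra).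
  apply Rmult_le_compat_l; lra. }
assert (Hx1 : exp (- (2 * s)) <= exp (- (PI * mu * exp 1 / 2))) by (apply exp_le_mono; lra).
assert (Hx2 : exp (- (PI * mu * exp 1 / 2)) < 1).
{ apply Rlt_le_trans with (exp 0); [apply exp_increasing|rewrite exp_0; lra]. pose proof e_ge_2.
  assert (0 < PI * mu * exp 1 / 2); [|lra]. apply Rdiv_lt_0_compat; [|lra].
  apply Rmult_lt_0_compat; [apply Rmult_lt_0_compat|]; lra. }
set (X := exp (- (PI * mu * exp 1 / 2))) in *.
assert (Esh : / sinh s = 2 * exp (- s) * / (1 - exp (- (2 * s)))).
{ unfold sinh. replace (exp (- (2 * s))) with (exp (- s) * exp (- s)) by (rewrite <- exp_plus; f_equal; ring).
  assert (E : exp s * exp (- s) = 1) by (rewrite <- exp_plus, Rplus_opp_r; apply exp_0).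
  assert (L1 : exp (- s) < 1) by (rewrite <- exp_0; apply exp_increasing; lra).
  pose proof (exp_pos (- s)) as L2.
  assert (E2 : exp s = / exp (- s)) by (rewrite exp_Ropp, Rinv_inv; reflexivity).
  rewrite E2. field. repeat split; nra. }
rewrite Esh.
assert (HY : / (1 - exp (- (2 * s))) <= / (1 - X)) by (apply Rinv_le_contravar; lra).
set (Y := / (1 - exp (- (2 * s)))) in *. set (q := exp (- s)). assert (Hq : 0 < q) by apply exp_pos.
replace (/ PI * (h / PI * ((1 + PI) / d) * (2 * K * (R2 * / Rc) / (mu * cos d) * (2 * q * Y))))
  with (2 * K * R2 * q * h / (Rc * mu * cos d * d) * (2 * (1 + PI) / PI ^ 2 * Y)) by (field; repeat split; lra).
replace (R2 * 2 * K / (mu * d) * (1 / ((1 - X) * Rc * cos d)) * (q * L / nn))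
  with (2 * K * R2 * q * h / (Rc * mu * cos d * d) * (1 * / (1 - X))) by (rewrite Eh; field; repeat split; lra).
apply Rmult_le_compat_l.
- apply Rdiv_le_0_compat; [|repeat apply Rmult_lt_0_compat; auto].
  repeat apply Rmult_le_pos; lra.
- apply Rmult_le_compat; [|left; apply Rinv_0_lt_compat; lra| |exact HY].
  + apply Rdiv_le_0_compat; [lra|nra].
  (* The numerical slack that makes the constant fit: [2 (1 + PI) <= PI ^ 2]. *)
  + apply Rmult_le_reg_r with (PI ^ 2); [nra|]. unfold Rdiv. rewrite Rmult_assoc, Rinv_l by nra. nra.
Qed.

(** * The total error on a narrower strip *)

Lemma Csum_minus (u v : nat -> C) n : Csum (fun i => u i - v i)%C n = (Csum u n - Csum v n)%C.
Proof. induction n as [|n IH]; simpl; [ring|]. rewrite IH. ring. Qed.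

Lemma le_of_inv_nat_error X D0 C0 j0 : (1 <= j0)%nat -> 0 <= C0 ->
  (forall j, (j0 <= j)%nat -> X <= D0 + C0 / INR j) -> X <= D0.
Proof.
intros Hj0 HC H. apply Rle_plus_epsilon. intros e He.
destruct (INR_unbounded (C0 / e)) as [k Hk].
specialize (H (j0 + k)%nat ltac:(lia)).
assert (Hp : 1 <= INR (j0 + k)) by (apply (le_INR 1); lia).
assert (Hkk : INR k <= INR (j0 + k)) by (apply le_INR; lia).
assert (C0 / INR (j0 + k) <= e); [|lra].
apply Rmult_le_reg_r with (INR (j0 + k)); [lra|]. unfold Rdiv at 1. rewrite Rmult_assoc, Rinv_l, Rmult_1_r by lra.
apply Rle_trans with (e * (C0 / e)); [right; field; lra|]. apply Rmult_le_compat_l; lra.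
Qed.

Section FixedHeight.
Variables (f : C -> C) (K al be d : R).
Hypothesis HK : 0 < K.
Hypothesis Hal : 0 < al.
Hypothesis Hbe : 0 < be.
Hypothesis Hd : d < PI / 2.
Hypothesis Hhol : analytic_on_psi_strip d f.
Hypothesis Hf1 : forall z : C, in_strip d z -> Re z < 0 ->
  Cmod (f (psiC z)) <= K * Rpower (Cmod (1 + psiC z * psiC z)%C) (- (al + 1) / 2).
Hypothesis Hf2 : forall z : C, in_strip d z -> 0 <= Re z ->
  Cmod (f (psiC z)) <= K * Rpower (Cmod (1 + psiC z * psiC z)%C) (- (be + 1) / 2).

Lemma hol_f_psiC x y : Rabs y < d -> hol f (psiC (x, y)).
Proof. intros Hy. destruct (Hhol (x, y) Hy) as [l Hl]. exists l. apply cderiv_is_derive, Hl. Qed.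

Lemma hol_F_de x y : Rabs y < d -> hol (F_de f) (x, y).
Proof.
intros Hy. apply hol_mult; [|apply hol_dpsiC].
apply (hol_comp f psiC); [apply hol_f_psiC, Hy|apply hol_psiC].
Qed.

(** Coefficient and rate of the majorant on [|Im z| <= e]. At [e = 0] they become the constants
    [c1], [c2] of the real line, which the truncation uses. *)
Let cc (e g : R) := K * (PI / 2) * Rpower (2 / cos (PI / 2 * sin e)) g.
Let aa (e g : R) := g * (PI / 2) * cos e.

Lemma F_de_left e x y : Rabs y <= e -> e < d -> x < 0 ->
  Cmod (F_de f (x, y)) <= de_majorant (cc e al) (aa e al) x.
Proof.
intros Hy He Hx. apply F_de_bound; auto; [lra|]. apply Hf1; [|exact Hx]. unfold in_strip; simpl. lra.
Qed.

Lemma F_de_right e x y : Rabs y <= e -> e < d -> 0 <= x ->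
  Cmod (F_de f (x, y)) <= de_majorant (cc e be) (aa e be) x.
Proof.
intros Hy He Hx. apply F_de_bound; auto; [lra|]. apply Hf2; [|exact Hx]. unfold in_strip; simpl. lra.
Qed.

Lemma continuous_f_real t : 0 < d -> continuousC (fun t => f (RtoC t)) t.
Proof.
intros Hd0. rewrite <- (psi_psi_inv t). apply (continuous_hline f (psi (psi_inv t)) 0).
change (hol f (RtoC (psi (psi_inv t)))). rewrite <- psiC_real. apply hol_f_psiC. rewrite Rabs_R0. exact Hd0.
Qed.

Lemma continuous_F_de_real x : 0 < d -> continuousC (fun x => F_de f (RtoC x)) x.
Proof. intros Hd0. apply (continuous_hline (F_de f) x 0), hol_F_de. rewrite Rabs_R0. exact Hd0. Qed.

Let c1 := K * (PI / 2) * Rpower 2 al.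
Let c2 := K * (PI / 2) * Rpower 2 be.

Lemma cc_0 g : cc 0 g = K * (PI / 2) * Rpower 2 g.
Proof. unfold cc. rewrite sin_0, Rmult_0_r, cos_0. unfold Rdiv at 2. rewrite Rinv_1, Rmult_1_r. reflexivity. Qed.

Lemma aa_0 g : aa 0 g = g * (PI / 2).
Proof. unfold aa. rewrite cos_0. ring. Qed.

Lemma F_de_real_left x : 0 < d -> x < 0 -> Cmod (F_de f (RtoC x)) <= de_majorant c1 (al * (PI / 2)) x.
Proof.
intros Hd0 Hx. unfold c1. rewrite <- cc_0, <- aa_0. apply F_de_left; auto. rewrite Rabs_R0; lra.
Qed.

Lemma F_de_real_right x : 0 < d -> 0 <= x -> Cmod (F_de f (RtoC x)) <= de_majorant c2 (be * (PI / 2)) x.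
Proof.
intros Hd0 Hx. unfold c2. rewrite <- cc_0, <- aa_0. apply F_de_right; auto. rewrite Rabs_R0; lra.
Qed.

Let mj (e x : R) := if Rlt_dec x 0 then de_majorant (cc e al) (aa e al) x else de_majorant (cc e be) (aa e be) x.

Lemma cc_pos e g : 0 < cc e g.
Proof.
pose proof PI_RGT_0. unfold cc. apply Rmult_lt_0_compat; [apply Rmult_lt_0_compat; lra|apply exp_pos].
Qed.

Lemma aa_pos e g : 0 < e -> e < d -> 0 < g -> 0 < aa e g.
Proof.
intros He He' Hg. pose proof PI_RGT_0. unfold aa.
apply Rmult_lt_0_compat; [apply Rmult_lt_0_compat; lra|apply cos_gt_0; lra].
Qed.

(** The quotient is the integral of the majorant over a half-line. As
    [2 / cos (PI / 2 * sin e) >= 1], its power grows with the exponent, so [al] and [be] are both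
    covered by [nu] above and [mu] below. *)
Lemma cc_div_aa_le e g : 0 < e -> e < d -> Rmin al be <= g <= Rmax al be ->
  cc e g / aa e g <= K * Rpower (2 / cos (PI / 2 * sin e)) (Rmax al be) / (Rmin al be * cos e).
Proof.
intros He He' Hg. pose proof PI_RGT_0.
assert (Hmu : 0 < Rmin al be) by (apply Rmin_glb_lt; auto).
assert (Hce : 0 < cos e) by (apply cos_gt_0; lra).
assert (Hcw : 0 < cos (PI / 2 * sin e)) by (apply cos_psi_pos; lra).
assert (HQ : 1 <= 2 / cos (PI / 2 * sin e)).
{ apply Rmult_le_reg_r with (cos (PI / 2 * sin e)); [auto|]. pose proof (COS_bound (PI / 2 * sin e)).
  replace (2 / cos (PI / 2 * sin e) * cos (PI / 2 * sin e)) with 2 by (field; lra). lra. }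
unfold cc, aa. set (Q := 2 / cos (PI / 2 * sin e)) in *.
replace (K * (PI / 2) * Rpower Q g / (g * (PI / 2) * cos e)) with (K * / cos e * (Rpower Q g * / g)) by (field; lra).
replace (K * Rpower Q (Rmax al be) / (Rmin al be * cos e)) with (K * / cos e * (Rpower Q (Rmax al be) * / Rmin al be)) by (field; lra).
pose proof (Rpower_pos Q g).
apply Rmult_le_compat_l; [apply Rmult_le_pos; [lra|left; apply Rinv_0_lt_compat; auto]|].
apply Rmult_le_compat; [lra|left; apply Rinv_0_lt_compat; lra|apply Rpower_le_exponent; lra|apply Rinv_le_contravar; lra].
Qed.

Lemma is_RInt_mj e T : 0 < e -> e < d -> 0 <= T ->
  exists I, is_RInt (mj e) (- T) T I /\
    I <= 2 * K * Rpower (2 / cos (PI / 2 * sin e)) (Rmax al be) / (Rmin al be * cos e).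
Proof.
intros He He' HT.
assert (A1 := aa_pos e al He He' Hal). assert (A2 := aa_pos e be He He' Hbe).
exists (cc e al / aa e al * (1 - exp (- aa e al * sinh T)) + cc e be / aa e be * (1 - exp (- aa e be * sinh T))).
split.
- apply (is_RInt_Chasles (V := R_NormedModule)) with 0.
  + apply (is_RInt_ext (V := R_NormedModule) (de_majorant (cc e al) (aa e al))); [|apply is_RInt_majorant_left; auto].
    intros x Hx. rewrite Rmin_left, Rmax_right in Hx by lra. unfold mj. destruct (Rlt_dec x 0); [reflexivity|lra].
  + apply (is_RInt_ext (V := R_NormedModule) (de_majorant (cc e be) (aa e be))); [|apply is_RInt_majorant_right; auto].
    intros x Hx. rewrite Rmin_left, Rmax_right in Hx by lra. unfold mj. destruct (Rlt_dec x 0); [lra|reflexivity].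
- assert (B1 := cc_div_aa_le e al He He' (conj (Rmin_l al be) (Rmax_l al be))).
  assert (B2 := cc_div_aa_le e be He He' (conj (Rmin_r al be) (Rmax_r al be))).
  assert (D : forall g, 0 < aa e g -> cc e g / aa e g * (1 - exp (- aa e g * sinh T)) <= cc e g / aa e g).
  { intros g Hg. rewrite <- Rmult_1_r. apply Rmult_le_compat_l; [apply Rdiv_le_0_compat; [left; apply cc_pos|auto]|].
    pose proof (exp_pos (- aa e g * sinh T)). lra. }
  pose proof (D al A1). pose proof (D be A2). unfold Rdiv in *. lra.
Qed.

Lemma mj_decay e x : 0 < e -> e < d -> 1 <= Rabs x ->
  mj e x <= (cc e al * 8 / aa e al ^ 2 + cc e be * 8 / aa e be ^ 2) / Rabs x.
Proof.
intros He He' Hx. pose proof (aa_pos e al He He' Hal) as A1. pose proof (aa_pos e be He He' Hbe) as A2.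
pose proof (cc_pos e al) as C1. pose proof (cc_pos e be) as C2.
assert (P1 : 0 <= cc e al * 8 / aa e al ^ 2) by (apply Rdiv_le_0_compat; [lra|apply pow_lt; auto]).
assert (P2 : 0 <= cc e be * 8 / aa e be ^ 2) by (apply Rdiv_le_0_compat; [lra|apply pow_lt; auto]).
assert (Hi : 0 <= / Rabs x) by (left; apply Rinv_0_lt_compat; lra).
unfold mj. destruct (Rlt_dec x 0).
- eapply Rle_trans; [apply de_majorant_decay; auto; lra|]. apply Rmult_le_compat_r; lra.
- eapply Rle_trans; [apply de_majorant_decay; auto; lra|]. apply Rmult_le_compat_r; lra.
Qed.

(** Four errors are added: the integral left of [- A], the discretization on [[- A, xi]], the sum of
    the [J] at [- A], and the truncation from [P] to [M], [N]. As [A] grows with [j], everything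
    outside the two displayed terms is of order [1 / j]. *)
Lemma fixed_height_bound (e h xi : R) (M N : nat) (I : C) :
  0 < e -> e < d -> 0 < h ->
  (forall A, 0 < A -> Cmod (I - CInt (fun x => F_de f (RtoC x)) (- A) xi)
      <= c1 / (al * (PI / 2)) * exp (- (al * (PI / 2)) * sinh A)) ->
  Cmod (I - sumZ (fun k => F_de f (RtoC (IZR k * h)) * RtoC (J (IZR k) h xi))%C (- Z.of_nat M) (Z.of_nat N)) <=
   disc_bound K (Rmin al be) (Rmax al be) h e +
   3 / 2 * (tail_bound c1 (al * (PI / 2)) h (INR M * h) + tail_bound c2 (be * (PI / 2)) h (INR N * h)).
Proof.
intros He He' Hh HI. pose proof PI2_3_2 as Hpi. assert (Hd0 : 0 < d) by lra.
set (S := sumZ _ _ _).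
set (a1 := al * (PI / 2)) in *. set (a2 := be * (PI / 2)) in *.
assert (Ha1 : 0 < a1) by (apply Rmult_lt_0_compat; lra). assert (Ha2 : 0 < a2) by (apply Rmult_lt_0_compat; lra).
assert (Hc1 : 0 < c1) by (unfold c1; rewrite <- cc_0; apply cc_pos).
assert (Hc2 : 0 < c2) by (unfold c2; rewrite <- cc_0; apply cc_pos).
destruct (J_sum_left_end (F_de f) c1 a1 c2 a2 h ltac:(lra) ltac:(lra) Ha1 Ha2 Hh
   (fun x => F_de_real_left x Hd0) (fun x => F_de_real_right x Hd0)) as [CJ [HCJ HJ]].
set (CM := cc e al * 8 / aa e al ^ 2 + cc e be * 8 / aa e be ^ 2).
assert (HCM : 0 <= CM).
{ unfold CM. pose proof (cc_pos e al). pose proof (cc_pos e be).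
  pose proof (aa_pos e al He He' Hal). pose proof (aa_pos e be He He' Hbe).
  apply Rplus_le_le_0_compat; (apply Rdiv_le_0_compat; [lra|apply pow_lt; auto]). }
assert (HCI : 0 <= c1 / a1 ^ 2 / h) by (apply Rdiv_le_0_compat; [apply Rdiv_le_0_compat; [lra|apply pow_lt; auto]|auto]).
assert (HCV : 0 <= 2 * e / PI * (2 * (CM / h))).
{ apply Rmult_le_pos; [apply Rdiv_le_0_compat; lra|]. apply Rmult_le_pos; [lra|apply Rdiv_le_0_compat; auto]. }
(* From this index on [M] and [N] are at most [P], [xi] lies inside [[- A, A]], and [T >= 1] as
   [mj_decay] requires. *)
destruct (INR_unbounded (2 + 1 / h + Rabs xi / h + INR M + INR N)) as [j0 Hj0].
assert (H1h : 0 < 1 / h) by (apply Rdiv_lt_0_compat; lra).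
assert (Hxh : 0 <= Rabs xi / h) by (apply Rdiv_le_0_compat; [apply Rabs_pos|auto]).
pose proof (pos_INR M) as HMr. pose proof (pos_INR N) as HNr.
apply (le_of_inv_nat_error _ _ (c1 / a1 ^ 2 / h + 2 * e / PI * (2 * (CM / h)) + CJ) j0); [|lra|].
{ apply INR_le. simpl. lra. }
intros j Hj. apply le_INR in Hj.
set (P := (2 * j + 1)%nat). set (A := (INR j + 1 / 2) * h).
assert (EP : INR P = 2 * INR j + 1) by (unfold P; rewrite plus_INR, mult_INR; reflexivity).
assert (HMP : (M <= P)%nat) by (apply INR_le; lra).
assert (HNP : (N <= P)%nat) by (apply INR_le; lra).
assert (Hj2 : (2 <= j)%nat) by (apply INR_le; simpl; lra).
assert (Hjh : 1 + Rabs xi <= INR j * h).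
{ apply Rle_trans with ((1 / h + Rabs xi / h) * h); [right; field; lra|]. apply Rmult_le_compat_r; lra. }
assert (HxiA : Rabs xi < A) by (unfold A; lra).
assert (HjA : INR j * h <= A) by (unfold A; nra).
pose proof (Rabs_pos xi) as Hxi0.
pose proof (HI A ltac:(lra)) as B1.
pose proof (discretization_partial (F_de f) (mj e) h e _ Hh He
   (fun x y Hy => hol_F_de x y (Rle_lt_trans _ _ _ Hy He'))
   (* The proof term branches on the same [Rlt_dec] as [mj], so each case has the expected
      majorant. *)
   (fun x y Hy => match Rlt_dec x 0 as s return Cmod (F_de f (x, y)) <= (if s then _ else _) with
      | left Hx => F_de_left e x y Hy He' Hx | right Hx => F_de_right e x y Hy He' (Rnot_lt_le _ _ Hx) end)
   (fun T HT => is_RInt_mj e T He He' HT) j xi HxiA) as B2.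
fold (disc_bound K (Rmin al be) (Rmax al be) h e) in B2. fold P A in B2.
set (T := (INR P + 1 / 2) * h) in *.
assert (HT : INR j * h <= T) by (unfold T; rewrite EP; apply Rmult_le_compat_r; lra).
pose proof (HJ j Hj2) as B3. fold P A in B3.
pose proof (truncation_bound (F_de f) c1 a1 c2 a2 h ltac:(lra) ltac:(lra) Ha1 Ha2 Hh
   (fun x => F_de_real_left x Hd0) (fun x => F_de_real_right x Hd0) P M N xi HMP HNP) as B4.
fold S in B4.
assert (Hjpos : 0 < INR j) by lra.
assert (B1' : c1 / a1 * exp (- a1 * sinh A) <= c1 / a1 ^ 2 / h / INR j).
{ assert (H1 : exp (- a1 * sinh A) <= / (a1 * (INR j * h))).
  { pose proof (sinh_ge_id A ltac:(lra)). assert (0 < a1 * (INR j * h)) by (apply Rmult_lt_0_compat; lra).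
    eapply Rle_trans; [|apply exp_neg_le; auto]. apply exp_le_mono. nra. }
  apply Rle_trans with (c1 / a1 * / (a1 * (INR j * h))).
  - apply Rmult_le_compat_l; [apply Rdiv_le_0_compat; lra|exact H1].
  - right. field. repeat split; lra. }
assert (B2' : mj e T + mj e (- T) <= 2 * (CM / h) / INR j).
{ assert (Q : CM / T <= CM / h / INR j).
  { replace (CM / h / INR j) with (CM * / (INR j * h)) by (field; split; lra).
    apply Rmult_le_compat_l; [auto|]. apply Rinv_le_contravar; lra. }
  assert (R1 : Rabs T = T) by (apply Rabs_pos_eq; lra).
  assert (R2 : Rabs (- T) = T) by (rewrite Rabs_Ropp; exact R1).
  pose proof (mj_decay e T He He' ltac:(lra)) as M1. pose proof (mj_decay e (- T) He He' ltac:(lra)) as M2.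
  rewrite R1 in M1. rewrite R2 in M2. fold CM in M1, M2. unfold Rdiv in *. lra. }
assert (B2'' : 2 * e / PI * (mj e T + mj e (- T)) <= 2 * e / PI * (2 * (CM / h)) / INR j).
{ unfold Rdiv at 2. rewrite Rmult_assoc. apply Rmult_le_compat_l; [apply Rdiv_le_0_compat; lra|exact B2']. }
assert (E : CInt (fun x => F_de f (RtoC x) - sinc_sum (F_de f) h P x)%C (- A) xi
   = (CInt (fun x => F_de f (RtoC x)) (- A) xi - (J_sum (F_de f) h P xi - J_sum (F_de f) h P (- A)))%C).
{ apply CInt_unique, is_CInt_minus.
  - apply is_CInt_CInt. intros; apply continuous_F_de_real, Hd0.
  - unfold J_sum. rewrite <- Csum_minus.
    rewrite (Csum_ext _ (fun i => F_de f (RtoC (node h P i)) * RtoC (J (INR i - INR P) h xi - J (INR i - INR P) h (- A)))%C).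
    + apply is_CInt_sinc_sum, Hh.
    + intros i _. rewrite RtoC_minus. ring. }
rewrite E in B2.
replace (I - S)%C with ((I - CInt (fun x => F_de f (RtoC x)) (- A) xi)
   + (CInt (fun x => F_de f (RtoC x)) (- A) xi - (J_sum (F_de f) h P xi - J_sum (F_de f) h P (- A)))
   + - J_sum (F_de f) h P (- A) + (J_sum (F_de f) h P xi - S))%C by ring.
eapply Rle_trans; [apply Cmod_triangle|].
eapply Rle_trans; [apply Rplus_le_compat_r, Cmod_triangle|].
eapply Rle_trans; [apply Rplus_le_compat_r, Rplus_le_compat_r, Cmod_triangle|].
rewrite Cmod_opp.
replace ((c1 / a1 ^ 2 / h + 2 * e / PI * (2 * (CM / h)) + CJ) / INR j) with
  (c1 / a1 ^ 2 / h / INR j + 2 * e / PI * (2 * (CM / h)) / INR j + CJ / INR j) by (field; repeat split; lra).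
lra.
Qed.

End FixedHeight.

(** * Index bounds and conclusion *)

Lemma arsinh_nonneg x : 0 <= x -> 0 <= arsinh x.
Proof.
intros Hx. unfold arsinh. rewrite <- ln_1. apply ln_le; [lra|].
assert (1 <= sqrt (x ^ 2 + 1)); [|lra]. rewrite <- sqrt_1 at 1. apply sqrt_le_1_alt. nra.
Qed.

Lemma x_gamma_nonneg g : 0 < g -> 0 <= x_gamma g.
Proof.
intros Hg. pose proof PI_RGT_0. unfold x_gamma. destruct (Rlt_dec _ _); apply arsinh_nonneg; [|lra].
apply Rdiv_le_0_compat; [apply sqrt_pos|nra].
Qed.

Lemma Int_part_le r : IZR (Int_part r) <= r.
Proof. apply base_Int_part. Qed.

(** Rounding the shift down keeps the index large enough: [exp (- shift * h) >= a / b]. So the side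
    with the faster decay, though it has fewer nodes, ends with a tail no larger in the exponent. *)
Lemma shifted_index_bound a b n L h : 0 < a -> 0 < b -> 0 < h -> INR n * h = L ->
  a * exp L <= b * exp (IZR (Z.of_nat n - Int_part (ln (b / a) / h)) * h).
Proof.
intros Ha Hb Hh HL. rewrite minus_IZR, <- INR_IZR_INZ, Rmult_minus_distr_r, HL.
assert (H1 : IZR (Int_part (ln (b / a) / h)) * h <= ln (b / a)).
{ apply Rle_trans with (ln (b / a) / h * h); [|right; field; lra].
  apply Rmult_le_compat_r; [lra|apply Int_part_le]. }
assert (Hba : 0 < b / a) by (apply Rdiv_lt_0_compat; auto).
apply Rle_trans with (b * exp (L - ln (b / a))).
- unfold Rminus. rewrite exp_plus, exp_Ropp, exp_ln by auto. right. field. lra.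
- apply Rmult_le_compat_l; [lra|]. apply exp_le_mono. lra.
Qed.

Lemma index_bounds al be d n L : 0 < al -> 0 < be -> 0 < h_step d (Rmin al be) n ->
  INR n * h_step d (Rmin al be) n = L ->
  Rmin al be * exp L <= al * exp (IZR (M_idx al be d n) * h_step d (Rmin al be) n) /\
  Rmin al be * exp L <= be * exp (IZR (N_idx al be d n) * h_step d (Rmin al be) n).
Proof.
intros Hal Hbe Hh HL. unfold M_idx, N_idx. set (h := h_step d (Rmin al be) n) in *.
destruct (Rle_dec al be) as [Hab|Hab].
- rewrite <- INR_IZR_INZ, HL. rewrite (Rmin_left al be Hab). split; [lra|].
  apply shifted_index_bound; auto.
- rewrite <- INR_IZR_INZ, HL. rewrite (Rmin_right al be) by lra. split; [|lra].
  apply shifted_index_bound; auto.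
Qed.

(** For the passage to height [d]: nothing is known of [f] on the lines [|Im z| = d], but the bound
    is continuous there. *)
Lemma le_of_continuous_from_left (g : R -> R) X d : 0 < d -> continuous g d ->
  (forall e, 0 < e < d -> X <= g e) -> X <= g d.
Proof.
intros Hd Hc H. apply Rle_plus_epsilon. intros eps He.
destruct (Hc (fun y => Rabs (y - g d) < eps)) as [dl Hdl].
{ exists (mkposreal eps He). intros y Hy. exact Hy. }
set (e := d - Rmin (dl / 2) (d / 2)).
pose proof (cond_pos dl) as Hp. pose proof (Rmin_l (dl / 2) (d / 2)) as M1. pose proof (Rmin_r (dl / 2) (d / 2)) as M2.
assert (M3 : 0 < Rmin (dl / 2) (d / 2)) by (apply Rmin_glb_lt; lra).
specialize (H e ltac:(unfold e; lra)).
assert (B : Rabs (g e - g d) < eps).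
{ apply Hdl. unfold ball; simpl. unfold AbsRing_ball, abs, minus, plus, opp; simpl.
  unfold e. apply Rabs_lt_between. lra. }
apply Rabs_lt_between in B. lra.
Qed.

Lemma approx_F_de f h M N tau :
  approx f h M N tau = sumZ (fun k => F_de f (RtoC (IZR k * h)) * RtoC (J (IZR k) h (psi_inv tau)))%C (- M) N.
Proof.
unfold approx, sumZ. f_equal. apply map_ext. intros i. unfold F_de. rewrite psiC_real, dpsiC_real.
rewrite (is_derive_unique _ _ _ (is_derive_psi _)), RtoC_mult. ring.
Qed.

Theorem theorem12 (d K al be : R) (f : C -> C) (n : nat) :
  0 < d -> d < PI / 2 ->
  analytic_on_psi_strip d f ->
  0 < K -> 0 < al -> 0 < be ->
  (forall z : C, in_strip d z -> Re z < 0 ->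
     Cmod (f (psiC z)) <= K * Rpower (Cmod (1 + psiC z * psiC z)%C) (- (al + 1) / 2)) ->
  (forall z : C, in_strip d z -> 0 <= Re z ->
     Cmod (f (psiC z)) <= K * Rpower (Cmod (1 + psiC z * psiC z)%C) (- (be + 1) / 2)) ->
  (1 <= n)%nat ->
  let mu := Rmin al be in
  let nu := Rmax al be in
  let h := h_step d mu n in
  let M := M_idx al be d n in
  let N := N_idx al be d n in
  INR n >= nu * exp 1 / (4 * d) ->
  IZR M * h >= x_gamma (al / 2) ->
  IZR N * h >= x_gamma (be / 2) ->
  forall tau : R,
    exists I : C,
      is_RInt_gen (V := C_R_CompleteNormedModule) (fun t : R => f (RtoC t))
        (Rbar_locally m_infty) (at_point tau) I /\
      Cmod (I - approx f h M N tau)%C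
        <= const_C1 K al be d *
           (exp (- (PI * d * INR n / ln (4 * d * INR n / mu))) * ln (4 * d * INR n / mu) / INR n).
Proof.
intros Hd Hd2 Hhol HK Hal Hbe Hf1 Hf2 Hn mu nu h M N Hn1 HM HN tau.
pose proof PI2_3_2 as Hpi.
set (xi := psi_inv tau).
destruct (improper_integral (fun x => F_de f (RtoC x)) (K * (PI / 2) * Rpower 2 al) (al * (PI / 2))) with (xi := xi)
  as [I [HI1 HI2]].
{ apply Rmult_le_pos; [apply Rmult_le_pos; lra|left; apply exp_pos]. }
{ apply Rmult_lt_0_compat; lra. }
{ intros x. apply continuous_F_de_real with d; auto. }
{ intros x Hx. apply F_de_real_left with d; auto. }
exists I. split.
- assert (Hc : forall t, continuousC (fun t => f (RtoC t)) t) by (intros t; apply continuous_f_real with d; auto).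
  (* The substitution turns lower limits [a] into [psi_inv a]; as [psi] is increasing and
     [psi (psi_inv a) = a], the condition [a < psi b0] means [psi_inv a < b0]. *)
  intros Q HQ. destruct (HI1 Q HQ) as [b0 Hb0].
  exists (fun a => a < psi b0) (fun b => b = tau).
  + exists (psi b0). auto.
  + reflexivity.
  + intros a b Ha ->. simpl.
    exists (CInt (fun x => F_de f (RtoC x)) (psi_inv a) xi). split.
    * pose proof (is_CInt_psi f (psi_inv a) xi Hc) as H. unfold xi in H. rewrite !psi_psi_inv in H. exact H.
    * apply Hb0. destruct (Rlt_or_le (psi_inv a) b0) as [L|[L|L]]; [exact L| |].
      -- apply psi_incr in L. rewrite psi_psi_inv in L. lra.
      -- rewrite L, psi_psi_inv in Ha. lra.
- set (L := ln (4 * d * INR n / mu)).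
  assert (Hmu : 0 < mu) by (apply Rmin_glb_lt; auto).
  assert (Hmunu : mu <= nu) by (eapply Rle_trans; [apply Rmin_l|apply Rmax_l]).
  assert (HnR : 1 <= INR n) by (apply (le_INR 1); exact Hn).
  (* The lower bound on [n] says [4 d n >= nu e >= mu e], that is [L >= 1]. *)
  assert (Harg : exp 1 <= 4 * d * INR n / mu).
  { apply Rmult_le_reg_r with mu; [auto|]. unfold Rdiv. rewrite Rmult_assoc, Rinv_l, Rmult_1_r by lra.
    apply Rle_trans with (4 * d * (nu * exp 1 / (4 * d))).
    - replace (4 * d * (nu * exp 1 / (4 * d))) with (nu * exp 1) by (field; lra).
      pose proof e_ge_2. nra.
    - apply Rmult_le_compat_l; lra. }
  assert (Harg0 : 0 < 4 * d * INR n / mu) by (pose proof e_ge_2; lra).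
  assert (HL : 1 <= L) by (unfold L; rewrite <- (ln_exp 1); apply ln_le; [apply exp_pos|exact Harg]).
  assert (EL : exp L = 4 * d * INR n / mu) by (apply exp_ln, Harg0).
  assert (Eh : h = L / INR n) by reflexivity.
  assert (Hh : 0 < h) by (rewrite Eh; apply Rdiv_lt_0_compat; lra).
  assert (Enh : INR n * h = L) by (rewrite Eh; field; lra).
  destruct (index_bounds al be d n L Hal Hbe Hh Enh) as [HM1 HN1]. fold mu M N in HM1, HN1. fold h in HM1, HN1.
  assert (EmL : mu * exp L = 4 * (d * INR n)) by (rewrite EL; field; lra).
  rewrite EmL in HM1, HN1.
  (* This makes [M h] and [N h] nonnegative: [M] and [N] are naturals, and [exp (- T) <= 1] holds in
     [tail_bound_param]. *)
  pose proof (x_gamma_nonneg (al / 2) ltac:(lra)) as X1. pose proof (x_gamma_nonneg (be / 2) ltac:(lra)) as X2.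
  assert (HM0 : 0 <= IZR M * h) by lra. assert (HN0 : 0 <= IZR N * h) by lra.
  assert (ZM : (0 <= M)%Z) by (apply le_IZR, (Rmult_le_reg_r h); lra).
  assert (ZN : (0 <= N)%Z) by (apply le_IZR, (Rmult_le_reg_r h); lra).
  pose proof (truncation_total K al be d L (INR n) h (IZR M) (IZR N) HK Hal Hbe Hd HnR HL Eh EL HM0 HN0 HM1 HN1) as BT.
  pose proof (disc_bound_le K al be d L (INR n) h HK Hal Hbe Hd Hd2 ltac:(lra) HL Eh EL) as BD.
  fold mu nu in BT, BD.
  rewrite approx_F_de. fold xi.
  assert (EM : IZR M = INR (Z.to_nat M)) by (rewrite INR_IZR_INZ, Z2Nat.id; auto).
  assert (EN : IZR N = INR (Z.to_nat N)) by (rewrite INR_IZR_INZ, Z2Nat.id; auto).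
  apply Rle_trans with (disc_bound K mu nu h d + 3 / 2 * (tail_bound (K * (PI / 2) * Rpower 2 al) (al * (PI / 2)) h (IZR M * h)
         + tail_bound (K * (PI / 2) * Rpower 2 be) (be * (PI / 2)) h (IZR N * h))).
  + set (TT := 3 / 2 * _).
    (* Neither the integral nor the sum depends on the height, so the bound for all [e < d] passes
       to [d]. *)
    apply (le_of_continuous_from_left (fun e => disc_bound K mu nu h e + TT)); auto.
    * apply (continuous_plus (K := R_AbsRing) (V := R_NormedModule)); [|apply continuous_const].
      apply disc_bound_continuous; auto.
    * intros e He. unfold TT. rewrite EM, EN.
      rewrite <- (Z2Nat.id M ZM) at 1. rewrite <- (Z2Nat.id N ZN) at 1.
      apply fixed_height_bound with d; auto; lra.
  + eapply Rle_trans; [apply Rplus_le_compat; [exact BD|exact BT]|].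
    unfold const_C1. cbv zeta. fold mu nu. fold L. right. unfold Rdiv. ring.
Qed.
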